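(* Let $p>0$ be an odd integer and $r\in\mathbb C$. The maximal submodule of the Verma module $V[p,r]$ is generated by the subsingular vector $$w_{p,r}=\Biggl(S_p\Bigl(-\tfrac{\alpha}{c_{L,\alpha}}\Bigr)+\frac{1}{2c_{L,\alpha}^2}\sum_{k=1}^{\frac{p-1}2}\frac1k\Bigl(\sum_{i\ge0}\Psi\bigl(i+k-\tfrac p2\bigr)S_i\bigl(-\tfrac{\alpha}{2c_{L,\alpha}}\bigr)\Bigr)\Bigl(\sum_{j\ge0}\Psi\bigl(j-k-\tfrac p2\bigr)S_j\bigl(-\tfrac{\alpha}{2c_{L,\alpha}}\bigr)\Bigr)\Biggr)v_{p,r}.$$
   Context: The $N=1$ Heisenberg-Virasoro algebra $\mathcal{SH}$ is the complex Lie superalgebra with even basis elements $L(n),\alpha(n)$ ($n\in\mathbb Z$), odd basis elements $G(n+\frac12),\Psi(n+\frac12)$ ($n\in\mathbb Z$), and even central elements $C_L,C_\alpha,C_{L,\alpha}$, with (super)commutators, for $m,n\in\mathbb Z$: $[\alpha(m),\alpha(n)]=\delta_{m+n,0}\,m\,C_\alpha$; $[L(m),\alpha(n)]=-n\,\alpha(m+n)-\delta_{m+n,0}(m^2+m)C_{L,\alpha}$; $[L(m),L(n)]=(m-n)L(m+n)+\delta_{m+n,0}\frac{m^3-m}{12}C_L$; $[\Psi(m+\frac12),\Psi(n+\frac12)]_+=\delta_{m+n+1,0}C_\alpha$; $[\alpha(m),\Psi(n+\frac12)]=0$; $[G(m+\frac12),G(n+\frac12)]_+=2L(m+n+1)+\delta_{m+n+1,0}\frac{m^2+m}{3}C_L$;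 $[L(m),G(n+\frac12)]=(\frac m2-n-\frac12)G(m+n+\frac12)$; $[\alpha(m),G(n+\frac12)]=m\,\Psi(m+n+\frac12)$; $[\Psi(m+\frac12),L(n)]=\frac{2m+n+1}{2}\Psi(m+n+\frac12)$; $[\Psi(m+\frac12),G(n+\frac12)]_+=\alpha(m+n+1)+2m\,\delta_{m+n+1,0}C_{L,\alpha}$. Let $\mathcal{SH}^{+}$ be the span of $L(n),\alpha(n),G(n-\frac12),\Psi(n-\frac12)$, $n\ge1$. A singular vector is a nonzero vector annihilated by $\mathcal{SH}^+$. A subsingular vector in a module $V$ is a vector which is not singular but whose image in $V/N$ is a (nonzero) singular vector for some submodule $N\subset V$. Fix $c_L,c_{L,\alpha}\in\mathbb C$ with $c_{L,\alpha}\ne0$. For $h,h_\alpha\in\mathbb C$, $V(h,h_\alpha)$ denotes the Verma module: the universal $\mathcal{SH}$-module generated by a vector $v$ with $\mathcal{SH}^+v=0$, $L(0)v=hv$, $\alpha(0)v=h_\alpha v$, on which $C_L,C_\alpha,C_{L,\alpha}$ act by $c_L,0,c_{L,\alpha}$. Its maximal submodule is the unique maximal proper submodule. For $p,r\in\mathbb C$ put $h_{p,r}=(1-p^2)\frac{c_L-3}{24}-rp$ and $V[p,r]=V(h_{p,r},(1+p)c_{L,\alpha})$, with highest weight vector $v_{p,r}$. Schur polynomials: $S_k(\beta)=S_k(\beta(-1),\beta(-2),\dots)$ are defined by $\exp\left(\sum_{n\ge1}\beta(-n)\frac{z^n}{n}\right)=\sum_{k\ge0}S_k(\beta)z^k$;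 $S_k(-\frac{\alpha}{tc_{L,\alpha}})$, $t=1,2$, is obtained by substituting $\beta(-n)=-\frac{1}{tc_{L,\alpha}}\alpha(-n)$. The sums over $i,j$ are finite on $v_{p,r}$ because $\Psi(s)v_{p,r}=0$ for $s>0$ and the operators $\Psi(s)$, $\alpha(n)$ mutually (anti)commute at level zero. *)

(* Defs.v *)
From HB Require Import structures.
From mathcomp Require Import all_boot all_order all_algebra.
From mathcomp Require Import boolp classical_sets fsbigop.

Set Implicit Arguments.
Unset Strict Implicit.
Unset Printing Implicit Defensive.

Import GRing.Theory.
Local Open Scope classical_set_scope.
Local Open Scope ring_scope.

(* Basis of the N = 1 Heisenberg-Virasoro algebra. The odd elements are        *)
(* indexed by the integer part of their mode:                                 *)
(*   shG n = G(n + 1/2)   and   shPsi n = Psi(n + 1/2).                       *)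
Inductive sh_basis : Type :=
  | shL of int
  | shAlpha of int
  | shG of int
  | shPsi of int
  | shCL
  | shCalpha
  | shCLalpha.

Definition sh_odd (x : sh_basis) : bool :=
  match x with shG _ | shPsi _ => true | _ => false end.

Definition kron (K : fieldType) (n : int) : K := (n == 0)%:R.

(* The list [:: (c1, e1); ...; (cs, es)] stands for c1 e1 + ... + cs es. *)
Definition sh_table (K : fieldType) (x y : sh_basis) :
    option (seq (K * sh_basis)) :=
  match x, y with
  | shAlpha m, shAlpha n => Some [:: (kron K (m + n) * m%:~R, shCalpha)]
  | shL m, shAlpha n =>
      Some [:: (- n%:~R, shAlpha (m + n));
               (- (kron K (m + n) * (m ^+ 2 + m)%:~R), shCLalpha)]
  | shL m, shL n =>
      Some [:: ((m - n)%:~R, shL (m + n));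
               (kron K (m + n) * ((m ^+ 3 - m)%:~R / 12), shCL)]
  | shPsi m, shPsi n => Some [:: (kron K (m + n + 1), shCalpha)]
  | shAlpha m, shPsi n => Some [::]
  | shG m, shG n =>
      Some [:: (2, shL (m + n + 1));
               (kron K (m + n + 1) * ((m ^+ 2 + m)%:~R / 3), shCL)]
  | shL m, shG n => Some [:: (m%:~R / 2 - n%:~R - 1 / 2, shG (m + n))]
  | shAlpha m, shG n => Some [:: (m%:~R, shPsi (m + n))]
  | shPsi m, shL n => Some [:: ((2 * m + n + 1)%:~R / 2, shPsi (m + n))]
  | shPsi m, shG n =>
      Some [:: (1, shAlpha (m + n + 1));
               (2 * m%:~R * kron K (m + n + 1), shCLalpha)]
  | _, _ => None
  end.

(* The pairs missing from the table are filled in by super skew-symmetry      *)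
(* [x, y] = - (-1)^(|x||y|) [y, x]; what then remains involves a central      *)
(* element.                                                                   *)
Definition sh_bracket (K : fieldType) (x y : sh_basis) : seq (K * sh_basis) :=
  match sh_table K x y, sh_table K y x with
  | Some s, _ => s
  | None, Some s =>
      [seq (- (-1) ^+ (sh_odd x && sh_odd y) * t.1, t.2) | t <- s]
  | None, None => [::]
  end.

Record shModule (K : fieldType) := SHModule {
  sh_sort :> lmodType K;
  sh_act : sh_basis -> {linear sh_sort -> sh_sort};
  sh_actP : forall (x y : sh_basis) (u : sh_sort),
    sh_act x (sh_act y u)
      - (-1) ^+ (sh_odd x && sh_odd y) *: sh_act y (sh_act x u)
    = \sum_(t <- sh_bracket K x y) t.1 *: sh_act t.2 u
}.

Definition sh_hom (K : fieldType) (V W : shModule K)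
    (f : {linear V -> W}) : Prop :=
  forall (x : sh_basis) (u : V), f (sh_act V x u) = sh_act W x (f u).

(* The basis of SH^+; note that G(n + 1/2) with n >= 0 is G(n' - 1/2) with    *)
(* n' >= 1, and likewise for Psi.                                             *)
Definition sh_pos (x : sh_basis) : bool :=
  match x with
  | shL n | shAlpha n => 1 <= n
  | shG n | shPsi n => 0 <= n
  | _ => false
  end.

Definition submodule (K : fieldType) (V : shModule K) (N : set V) : Prop :=
  [/\ N 0,
      forall u v, N u -> N v -> N (u + v),
      forall (a : K) u, N u -> N (a *: u)
    & forall x u, N u -> N (sh_act V x u)].

Definition generated (K : fieldType) (V : shModule K) (w : V) : set V :=
  smallest (@submodule K V) [set w].

Definition maximal_submodule (K : fieldType) (V : shModule K)
    (N : set V) : Prop :=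
  [/\ submodule N, N != setT
    & forall N', submodule N' -> N' != setT -> N `<=` N' -> N' = N].

Definition singular (K : fieldType) (V : shModule K) (u : V) : Prop :=
  u <> 0 /\ forall x, sh_pos x -> sh_act V x u = 0.

(* The coset u + N is a singular vector of V / N: u + N <> 0 and              *)
(* x (u + N) = x u + N = 0 for x in SH^+.                                     *)
Definition singular_mod (K : fieldType) (V : shModule K) (N : set V)
    (u : V) : Prop :=
  ~ N u /\ forall x, sh_pos x -> N (sh_act V x u).

Definition subsingular (K : fieldType) (V : shModule K) (u : V) : Prop :=
  ~ singular u /\ exists2 N : set V, submodule N & singular_mod N u.

(* C_L, C_alpha, C_{L,alpha} act by cL, 0, cLa. *)
Definition hw_vector (K : fieldType) (cL cLa h ha : K) (V : shModule K)
    (v : V) : Prop :=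
  [/\ forall u : V, [/\ sh_act V shCL u = cL *: u,
                        sh_act V shCalpha u = 0
                      & sh_act V shCLalpha u = cLa *: u],
      forall x, sh_pos x -> sh_act V x v = 0,
      sh_act V (shL 0) v = h *: v
    & sh_act V (shAlpha 0) v = ha *: v].

(* (V, v) is the Verma module V(h, ha). Uniqueness of the homomorphism is     *)
(* automatic since v generates V.                                             *)
Definition verma (K : fieldType) (cL cLa h ha : K) (V : shModule K)
    (v : V) : Prop :=
  [/\ hw_vector cL cLa h ha v,
      generated v = setT
    & forall (M : shModule K) (m : M), hw_vector cL cLa h ha m ->
        exists f : {linear V -> M}, sh_hom f /\ f v = m].

Definition h_pr (K : fieldType) (cL p r : K) : K :=
  (1 - p ^+ 2) * ((cL - 3) / 24) - r * p.

Definition verma_pr (K : fieldType) (cL cLa p r : K) (V : shModule K)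
    (v : V) : Prop :=
  verma cL cLa (h_pr cL p r) ((1 + p) * cLa) v.

(* Schur polynomials in operators b n = beta(-n). A power series in z with    *)
(* coefficients in V is a function nat -> V, and [exponent b] is the action   *)
(* on V[[z]] of F(z) = sum_{n >= 1} beta(-n) z^n / n. Then [schur b k u] is   *)
(* the coefficient of z^k in exp(F(z)) u = sum_m F(z)^m u / m!; the terms     *)
(* m > k do not contribute, as F(z) has no constant term.                     *)
Definition exponent (K : fieldType) (V : lmodType K) (b : nat -> V -> V)
    (f : nat -> V) : nat -> V :=
  fun k => \sum_(1 <= n < k.+1) n%:R^-1 *: b n (f (k - n)%N).

Definition const_series (K : fieldType) (V : lmodType K) (u : V) : nat -> V :=
  fun k => if k == 0%N then u else 0.

Definition schur (K : fieldType) (V : lmodType K) (b : nat -> V -> V)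
    (k : nat) (u : V) : V :=
  \sum_(0 <= m < k.+1) (m`!%:R)^-1 *: iter m (exponent b) (const_series u) k.

(* S_k(- alpha / (t cLa)) *)
Definition schur_alpha (K : fieldType) (cLa : K) (V : shModule K) (t k : nat)
    (u : V) : V :=
  schur (fun n w => (- (t%:R * cLa)^-1) *: sh_act V (shAlpha (- n%:Z)) w) k u.

(* sum_{i >= 0} Psi(i + d + 1/2) S_i(- alpha / (2 cLa)) u, as a sum with      *)
(* finite support.                                                            *)
Definition psi_schur (K : fieldType) (cLa : K) (V : shModule K) (d : int)
    (u : V) : V :=
  \sum_(i \in [set: nat])
    sh_act V (shPsi (i%:Z + d)) (schur_alpha cLa 2 i u).

(* For p odd, p./2 = (p - 1)/2, and i +- k - p/2 = i + d + 1/2 with           *)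
(* d = +- k - (p + 1)/2 = +- k - p./2 - 1.                                    *)
Definition w_pr (K : fieldType) (cLa : K) (p : nat) (V : shModule K)
    (v : V) : V :=
  schur_alpha cLa 1 p v
  + (2 * cLa ^+ 2)^-1 *:
      \sum_(1 <= k < (p./2).+1)
        k%:R^-1 *:
          psi_schur cLa (k%:Z - (p./2)%:Z - 1)
            (psi_schur cLa (- k%:Z - (p./2)%:Z - 1) v).

(* Main.v *)
From HB Require Import structures.
Require Import Defs.
From mathcomp Require Import all_boot all_order all_algebra zify ring.
From mathcomp Require Import boolp classical_sets functions fsbigop reals.
From mathcomp Require Import complex.

(** Write [p = 2 h + 1] and let [u], [w] be the vectors [sing_vec], [sub_vec]; the
    latter is [w_{p,r}]. Let [Psi(z)] be the sum of the [Psi(- s) z^s] over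
    [s > 0], and [E_t(z) = exp (- (t cLa)^-1 sum_(n > 0) alpha(- n) z^n / n)], the
    generating series of the Schur polynomials.

    At level zero the [alpha]s and [Psi]s supercommute, so on the space [F] of
    polynomials in their negative modes applied to [v] their positive modes vanish
    and [G(s)], [s > 0], is an odd derivation up to the scalars coming from
    [alpha(0)] and [C_{L,alpha}]. This gives, on [v],
      [G(s) E_1(z) = - cLa^-1 z^s Psi(z) E_1(z)]  and
      [G(s) Psi(z) E_2(z) = z^s (cLa (p - 2 s) - 2 cLa z d/dz) E_2(z)]
    ([G_schur_alpha], [G_dressed_Psi]). By the second formula the coefficient [u] of
    [z^(p/2)] in [Psi(z) E_2(z) v] is singular, and the quadratic terms of [w]
    are those that cancel all of [G(s) S_p v] but a multiple of [u]
    ([G_sub_vec]). So [w] is singular modulo [u], and it generates [u]; it is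
    not singular because [u] is not zero.

    Let [N] be the submodule generated by [w]. Any vector of a submodule
    containing [N], if of minimal weight outside [N], is singular modulo [N]. Two
    operators of Euler type show that it is a multiple of [v] modulo [N].
    Normal ordered sums of [L(- n) alpha(n)] and [G(- s) Psi(s)], with
    coefficients that exist because no [p + n] or [p + 2 s] vanishes, count the [L]s
    and [G]s of a monomial up to terms that are shorter or less deep; being singular,
    the vector lies in [F] modulo [N] ([abel_singular]). The opposite sums of [alpha(- n) L(n)]
    and [Psi(- s) G(s)] count the [alpha]s and [Psi]s up to longer terms, except
    that the coefficients of [alpha(- p)] and [Psi(- p/2)] do not exist. But these
    two letters are the leading terms of [w] and [u], so they can be eliminated
    modulo [N] ([monomials_singular]). Hence [N] is maximal among the submodules
    not containing [v] ([Nw_maximal]). Submodules are graded by [L(0)], and [N]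
    lies in positive weight, being spanned by negative modes applied to [w] and
    [u]; so [N] is proper, and the sum of two proper submodules is proper, which
    gives uniqueness.

    What remains is that [v] and [u] do not vanish and that [w] is not in the
    submodule of [u]. By the universal property it suffices to detect the
    coefficients of [alpha(- p)] and [Psi(- p/2)] in one highest weight module with
    the same parameters. It is the Fock space of [alpha], [Psi] and of dual
    fields, with [G] quadratic in the free fields and a linear term that carries
    [cL] and [r] ([free_field_realization]); the relations hold there because an
    operator that supercommutes with the free fields is determined by its vacuum
    expectation ([free_field_schur]). *)

Set Implicit Arguments.
Unset Strict Implicit.
Unset Printing Implicit Defensive.

Import Order.TTheory GRing.Theory Num.Theory.
Local Open Scope ring_scope.

(** * Linear identities in a module *)

Section LinearNormalization.

Variables (K : pzRingType) (V : lmodType K).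

Inductive lin_expr :=
  | LinVar of nat
  | LinZero
  | LinAdd of lin_expr & lin_expr
  | LinOpp of lin_expr
  | LinScale of K & lin_expr.

Fixpoint lin_eval (env : seq V) (e : lin_expr) : V :=
  match e with
  | LinVar i => nth 0 env i
  | LinZero => 0
  | LinAdd e1 e2 => lin_eval env e1 + lin_eval env e2
  | LinOpp e1 => - lin_eval env e1
  | LinScale a e1 => a *: lin_eval env e1
  end.

Fixpoint lin_coef (e : lin_expr) (i : nat) : K :=
  match e with
  | LinVar j => if eqn j i then 1 else 0
  | LinZero => 0
  | LinAdd e1 e2 => lin_coef e1 i + lin_coef e2 i
  | LinOpp e1 => - lin_coef e1 i
  | LinScale a e1 => a * lin_coef e1 i
  end.

Lemma lin_evalE env e :
  lin_eval env e = \sum_(i < size env) lin_coef e i *: nth 0 env i.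
Proof.
elim: e => [j||e1 IH1 e2 IH2|e1 IH1|a e1 IH1] /=.
- have [lt_j|le_j] := ltnP j (size env).
    rewrite (bigD1 (Ordinal lt_j)) //= -[eqn j j]/(j == j) eqxx scale1r big1 ?addr0 // => i.
    by rewrite -val_eqE /= -[eqn j i]/(j == i) eq_sym => /negPf ->; rewrite scale0r.
  rewrite nth_default // big1 // => i _.
  rewrite -[eqn j i]/(j == i); have [e_ji|_] := eqVneq j i; last by rewrite scale0r.
  by have := ltn_ord i; rewrite -e_ji ltnNge le_j.
- by rewrite big1 // => i _; rewrite scale0r.
- by rewrite IH1 IH2 -big_split; apply: eq_bigr => i _; rewrite scalerDl.
- by rewrite IH1 -sumrN; apply: eq_bigr => i _; rewrite scaleNr.
- by rewrite IH1 scaler_sumr; apply: eq_bigr => i _; rewrite scalerA.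
Qed.

Fixpoint lin_coef_eq (n : nat) (e1 e2 : lin_expr) : Prop :=
  if n is n'.+1 then lin_coef e1 n' = lin_coef e2 n' /\ lin_coef_eq n' e1 e2
  else True.

(** The reflection step of [lin_coefs]. *)
Lemma lin_eval_eq env e1 e2 :
  lin_coef_eq (size env) e1 e2 -> lin_eval env e1 = lin_eval env e2.
Proof.
move=> eq12; rewrite !lin_evalE; apply: eq_bigr => i _; congr (_ *: _).
have := ltn_ord i; move: (nat_of_ord i) => {i} j.
elim: (size env) eq12 => //= n IHn [eq_n eq12].
by rewrite ltnS leq_eqVlt => /predU1P[->|/IHn->].
Qed.

End LinearNormalization.

Ltac lin_mem x l :=
  lazymatch l with
  | nil => constr:(false)
  | cons ?y ?l' =>
      match goal with
      | _ => let _ := match goal with _ => unify x y end in constr:(true)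
      | _ => lin_mem x l'
      end
  end.

Ltac lin_atoms t l :=
  lazymatch t with
  | GRing.add ?a ?b => let l1 := lin_atoms a l in lin_atoms b l1
  | GRing.opp ?a => lin_atoms a l
  | GRing.zero => l
  | GRing.scale _ ?a => lin_atoms a l
  | _ => lazymatch lin_mem t l with
         | true => l
         | false => constr:(cons t l)
         end
  end.

Ltac lin_index x l :=
  lazymatch l with
  | cons ?y ?l' =>
      match goal with
      | _ => let _ := match goal with _ => unify x y end in constr:(0%N)
      | _ => let i := lin_index x l' in constr:(S i)
      end
  end.

Ltac lin_reify K t l :=
  lazymatch t with
  | GRing.add ?a ?b =>
      let e1 := lin_reify K a l in let e2 := lin_reify K b l in
      constr:(@LinAdd K e1 e2)
  | GRing.opp ?a => let e1 := lin_reify K a l in constr:(@LinOpp K e1)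
  | GRing.zero => constr:(@LinZero K)
  | GRing.scale ?c ?a =>
      let e1 := lin_reify K a l in constr:(@LinScale K c e1)
  | _ => let i := lin_index t l in constr:(@LinVar K i)
  end.

(** The vectors occurring in the goal are treated as if they were linearly
    independent, so the goals produced are sufficient but not necessary. *)
Ltac lin_coefs K V :=
  lazymatch goal with
  | |- @eq ?T ?a ?b =>
      let l0 := lin_atoms a (@nil T) in
      let l := lin_atoms b l0 in
      let e1 := lin_reify K a l in
      let e2 := lin_reify K b l in
      apply: (@lin_eval_eq K V l e1 e2);
      cbn [size lin_coef_eq lin_coef eqn];
      repeat split
  end.

Lemma linear_split (K : pzRingType) (U V : lmodType K) (f : U -> V) : linear f ->
  [/\ f 0 = 0, forall x y, f (x + y) = f x + f y & forall a x, f (a *: x) = a *: f x].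
Proof.
move=> f_lin; have fD x y : f (x + y) = f x + f y by rewrite -[x]scale1r f_lin !scale1r.
have f0 : f 0 = 0 by apply: (addrI (f 0)); rewrite -fD !addr0.
by split=> // a x; rewrite -[a *: x]addr0 f_lin f0 addr0.
Qed.

(** * Spans and closures under a set of operators *)

Section OpSpan.

Variables (K : fieldType) (V : shModule K).
Implicit Types (A B : pred sh_basis) (S : V -> Prop).

(** The module that [S] generates over the algebra of operators generated by
    [A]: what PBW arguments call [U(A) S]. *)
Inductive opspan A S : V -> Prop :=
  | opspan_base x of S x : opspan A S x
  | opspan0 : opspan A S 0
  | opspanD x y of opspan A S x & opspan A S y : opspan A S (x + y)
  | opspanZ a x of opspan A S x : opspan A S (a *: x)
  | opspan_act b x of A b & opspan A S x : opspan A S (sh_act V b x).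

Definition subspace (P : V -> Prop) :=
  [/\ P 0, forall x y, P x -> P y -> P (x + y)
    & forall a x, P x -> P (a *: x)].

Lemma subspaceN P x : subspace P -> P x -> P (- x).
Proof. by case=> _ _ PZ Px; rewrite -scaleN1r; apply: PZ. Qed.

Lemma subspaceB P x y : subspace P -> P x -> P y -> P (x - y).
Proof. by move=> sP Px Py; case: (sP) => _ PD _; apply: PD => //; apply: subspaceN. Qed.

Lemma subspace_sum P (I : Type) (r : seq I) (C : pred I) (F : I -> V) :
  subspace P -> (forall i, C i -> P (F i)) -> P (\sum_(i <- r | C i) F i).
Proof. by case=> P0 PD _; apply: big_ind. Qed.

Lemma opspan_subspace A S : subspace (opspan A S).
Proof. by split; [exact: opspan0|exact: opspanD|exact: opspanZ]. Qed.

Lemma opspan_sub A S (P : V -> Prop) :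
  subspace P -> (forall x, S x -> P x) ->
  (forall b x, A b -> P x -> P (sh_act V b x)) ->
  forall x, opspan A S x -> P x.
Proof.
case=> P0 PD PZ PS PA x.
by elim=> [s /PS||y z _ Py _ /(PD _ _ Py)|a y _ /PZ|b y Ab _ /PA]; auto.
Qed.

Lemma sh_swap y b (x : V) :
  sh_act V y (sh_act V b x)
  = (-1) ^+ (sh_odd y && sh_odd b) *: sh_act V b (sh_act V y x)
    + \sum_(t <- sh_bracket K y b) t.1 *: sh_act V t.2 x.
Proof. by rewrite -(sh_actP y b x) addrCA subrr addr0. Qed.

Lemma bracket_mem (P : V -> Prop) y b (x : V) : subspace P ->
  (forall t, List.In t (sh_bracket K y b) -> P (t.1 *: sh_act V t.2 x)) ->
  P (\sum_(t <- sh_bracket K y b) t.1 *: sh_act V t.2 x).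
Proof.
case=> P0 PD PZ; elim: (sh_bracket K y b) => [|t s IHs] Pt.
  by rewrite big_nil.
rewrite big_cons; apply: PD; first by apply: Pt; left.
by apply: IHs => u us; apply: Pt; right.
Qed.

(** The PBW argument behind every triangular decomposition below: operators
    in [B] can be moved to the right through the letters in [A], leaving
    brackets that are again in [A] or [B]. *)
Lemma opspan_stable A B S :
  (forall y b t, B y -> A b -> List.In t (sh_bracket K y b) -> A t.2 || B t.2) ->
  (forall y s, B y -> S s -> opspan A S (sh_act V y s)) ->
  forall y x, B y -> opspan A S x -> opspan A S (sh_act V y x).
Proof.
move=> AB BS y x By cx; elim: cx y By => [s Ss|| x1 x2 _ IH1 _ IH2 | a x1 _ IH1
  | b x1 Ab cx1 IH1] y By.
- exact: BS.
- by rewrite linear0; apply: opspan0.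
- by rewrite linearD; apply: opspanD; [apply: IH1|apply: IH2].
- by rewrite linearZ; apply: opspanZ; apply: IH1.
rewrite sh_swap; apply: opspanD.
  by apply: opspanZ; apply: opspan_act => //; apply: IH1.
apply: bracket_mem; first exact: opspan_subspace.
move=> t /AB-/(_ By Ab)/orP[At|Bt]; apply: opspanZ; last exact: IH1.
exact: opspan_act.
Qed.

End OpSpan.

(** * Schur polynomials *)

Lemma sum_triangle (V : nmodType) (k : nat) (F : nat -> nat -> V) :
  \sum_(1 <= n < k.+1) \sum_(1 <= j < (k - n).+1) F n j
  = \sum_(1 <= j < k.+1) \sum_(1 <= n < (k - j).+1) F n j.
Proof.
transitivity (\sum_(1 <= n < k.+1) \sum_(1 <= j < k.+1 | (n + j <= k)%N) F n j).
  apply: eq_big_nat => n n_k; rewrite (big_nat_widen _ _ k.+1); last by lia.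
  by apply: eq_bigl => j /=; lia.
rewrite (exchange_big_dep_nat predT) //=.
apply: eq_big_nat => n n_k; rewrite [RHS](big_nat_widen _ _ k.+1); last by lia.
by apply: eq_bigl => j /=; lia.
Qed.

Section Schur.

Variables (K : numFieldType) (V : lmodType K) (b : nat -> V -> V).
Hypothesis b_linear : forall n, linear (b n).
Hypothesis b_comm : forall m n x, b m (b n x) = b n (b m x).

Lemma schur_opD n x y : b n (x + y) = b n x + b n y.
Proof. by case: (linear_split (b_linear n)). Qed.

Lemma schur_op0 n : b n 0 = 0.
Proof. by case: (linear_split (b_linear n)). Qed.

Lemma schur_opZ n a x : b n (a *: x) = a *: b n x.
Proof. by case: (linear_split (b_linear n)). Qed.

Lemma schur_op_sum n (I : Type) (r : seq I) (P : pred I) (F : I -> V) :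
  b n (\sum_(i <- r | P i) F i) = \sum_(i <- r | P i) b n (F i).
Proof. exact: (big_morph (b n) (schur_opD n) (schur_op0 n)). Qed.

Let pow u m := iter m (exponent b) (const_series u).

Lemma exponent_iter_gt u m k : (k < m)%N -> pow u m k = 0.
Proof.
elim: m k => // m IHm k lt_km; rewrite /pow /= /exponent big_nat big1 // => n.
by move=> n_k; rewrite -/(pow u m) IHm ?schur_op0 ?scaler0 //; lia.
Qed.

(** The chain rule [z d/dz F^(m+1) = (m + 1) F^m z dF/dz]. *)
Lemma exponent_iter_deriv u m k :
  k%:R *: pow u m.+1 k
  = m.+1%:R *: \sum_(1 <= n < k.+1) b n (pow u m (k - n)).
Proof.
elim: m k => [|m IHm] k.
  rewrite scale1r /pow /= /exponent scaler_sumr; apply: eq_big_nat => n n_k.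
  rewrite /const_series subn_eq0.
  case: leqP => [le_kn|]; last by rewrite !schur_op0 !scaler0.
  have -> : n = k by lia.
  by rewrite scalerA mulfV ?scale1r // pnatr_eq0; lia.
rewrite -[pow u m.+2 k]/(exponent b (pow u m.+1) k) /exponent scaler_sumr.
transitivity (\sum_(1 <= n < k.+1) (b n (pow u m.+1 (k - n))
   + n%:R^-1 *: b n ((k - n)%:R *: pow u m.+1 (k - n)))).
  apply: eq_big_nat => n n_k; rewrite schur_opZ !scalerA -[X in X + _]scale1r -scalerDl.
  by congr (_ *: _); rewrite natrB; [field; rewrite pnatr_eq0|]; lia.
rewrite big_split /= -(addn1 m.+1) natrD scalerDl scale1r addrC; congr (_ + _).
under eq_bigr => n _ do rewrite IHm schur_opZ scalerA mulrC -scalerA schur_op_sum.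
rewrite -scaler_sumr; congr (_ *: _).
transitivity (\sum_(1 <= n < k.+1) \sum_(1 <= j < (k - n).+1)
    n%:R^-1 *: b n (b j (pow u m (k - n - j)))).
  by apply: eq_bigr => n _; rewrite scaler_sumr.
rewrite sum_triangle; apply: eq_big_nat => j j_k; rewrite /exponent schur_op_sum.
apply: eq_big_nat => n n_k; rewrite schur_opZ b_comm.
by congr (_ *: b _ (b _ (pow _ _ _))); lia.
Qed.

Lemma schur_widen u k N : (k < N)%N ->
  schur b k u = \sum_(0 <= m < N) (m`!%:R)^-1 *: pow u m k.
Proof.
move=> lt_kN; rewrite (big_cat_nat (n := k.+1)) //= [X in _ + X]big_nat [X in _ + X]big1 ?addr0 //.
by move=> m m_k; rewrite exponent_iter_gt ?scaler0 //; lia.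
Qed.

Lemma schur0 u : schur b 0 u = u.
Proof. by rewrite /schur big_nat1 /= /const_series /= fact0 invr1 scale1r. Qed.

(** Newton's recursion, i.e. [z d/dz exp F = (z dF/dz) exp F] with
    [F(z) = sum_(n > 0) b n z^n / n]. *)
Lemma schur_rec u k :
  k%:R *: schur b k u = \sum_(1 <= n < k.+1) b n (schur b (k - n) u).
Proof.
rewrite (@schur_widen u k k.+2) // big_nat_recl // scalerDr scaler_sumr.
have -> : k%:R *: ((0`!)%:R^-1 *: pow u 0 k) = 0.
  by case: k => [|k]; rewrite /pow /= /const_series ?scale0r ?scaler0.
rewrite add0r; under eq_bigr => m _.
  rewrite scalerA mulrC -scalerA exponent_iter_deriv scalerA.
  rewrite factS natrM invfM mulrAC mulVf ?mul1r ?pnatr_eq0 // scaler_sumr.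
over.
rewrite exchange_big_nat; apply: eq_big_nat => n n_k.
rewrite (@schur_widen u (k - n) k.+1); last by lia.
by rewrite schur_op_sum; apply: eq_bigr => m _; rewrite schur_opZ.
Qed.

(** Exponentials are identified by their logarithmic derivatives: in
    characteristic zero the recursion determines all the coefficients. *)
Lemma schur_unique u (f : nat -> V) : f 0%N = u ->
  (forall k, (0 < k)%N -> k%:R *: f k = \sum_(1 <= n < k.+1) b n (f (k - n)%N)) ->
  forall k, f k = schur b k u.
Proof.
move=> f0 fS; elim/ltn_ind=> [[|k]] IHk; first by rewrite schur0.
have nz_k : k.+1%:R != 0 :> K by rewrite pnatr_eq0.
apply: (scalerI nz_k); rewrite fS // schur_rec; apply: eq_big_nat => n n_k.
by rewrite IHk //; lia.
Qed.

Lemma schur_linear k a x y : schur b k (a *: x + y) = a *: schur b k x + schur b k y.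
Proof.
symmetry; apply: (@schur_unique _ (fun k => a *: schur b k x + schur b k y)).
  by rewrite !schur0.
move=> j j_gt0; rewrite scalerDr scalerA mulrC -scalerA !schur_rec scaler_sumr.
by rewrite -big_split; apply: eq_bigr => n _; rewrite b_linear.
Qed.

Lemma schur_comm (f : V -> V) k x : linear f -> (forall n y, b n (f y) = f (b n y)) ->
  schur b k (f x) = f (schur b k x).
Proof.
move=> /linear_split[f0 fD fZ] fb.
symmetry; apply: (@schur_unique _ (fun k => f (schur b k x))).
  by rewrite schur0.
move=> j j_gt0; rewrite -fZ schur_rec (big_morph f fD f0).
by apply: eq_bigr => n _; rewrite fb.
Qed.

End Schur.

(** [exp F = exp (F / 2) ^ 2], because both sides have the same logarithmic
    derivative: each factor of the product contributes one half of it. *)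
Lemma schur_square (K : numFieldType) (V : lmodType K) (b c : nat -> V -> V) k x :
  (forall n, linear (b n)) -> (forall m n y, b m (b n y) = b n (b m y)) ->
  (forall n y, c n y = 2 *: b n y) ->
  schur c k x = \sum_(0 <= i < k.+1) schur b i (schur b (k - i) x).
Proof.
move=> bL bC cb.
have cL n : linear (c n) by move=> a y z; rewrite !cb bL scalerDr !scalerA mulrC.
have cC m n y : c m (c n y) = c n (c m y).
  by rewrite !cb !(schur_opZ bL) bC.
symmetry; apply: (schur_unique cL cC
  (f := fun k => \sum_(0 <= i < k.+1) schur b i (schur b (k - i) x))).
  by rewrite big_nat1 !schur0.
move=> {}k k_gt0.
have bS n i y : b n (schur b i y) = schur b i (b n y).
  by rewrite (schur_comm bL bC) // => m z; apply: bC.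
have Slin i := linear_split (schur_linear bL bC i).
have SZ i a y : schur b i (a *: y) = a *: schur b i y by case: (Slin i).
have Ssum i (r : seq nat) (F : nat -> V) :
    schur b i (\sum_(j <- r) F j) = \sum_(j <- r) schur b i (F j).
  by have [S0 SD _] := Slin i; apply: (big_morph (schur b i) SD S0).
pose f i j := schur b i (schur b j x).
have frec1 i j : i%:R *: f i j = \sum_(1 <= n < i.+1) b n (f (i - n)%N j).
  by rewrite /f (schur_rec bL bC).
have frec2 i j : j%:R *: f i j = \sum_(1 <= n < j.+1) b n (f i (j - n)%N).
  by rewrite /f -SZ (schur_rec bL bC) // Ssum; apply: eq_bigr => n _; rewrite -bS.
have half1 : \sum_(0 <= i < k.+1) i%:R *: f i (k - i)%N
    = \sum_(1 <= n < k.+1) b n (\sum_(0 <= i < (k - n).+1) f i (k - n - i)%N).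
  under eq_bigr => i _ do rewrite frec1.
  transitivity (\sum_(0 <= i < k.+1) \sum_(1 <= n < k.+1 | (n <= i)%N) b n (f (i - n)%N (k - i)%N)).
    apply: eq_big_nat => i i_k; rewrite (big_nat_widen _ _ k.+1); last by lia.
    by apply: eq_bigl => n /=; lia.
  rewrite (exchange_big_dep_nat predT) //=; apply: eq_big_nat => n n_k.
  rewrite (schur_op_sum bL) (big_cat_nat (n := n)) //=; last by lia.
  rewrite [X in X + _]big_nat_cond [X in X + _]big_pred0 ?add0r; last by move=> i; lia.
  rewrite -[X in index_iota X k.+1]add0n big_addn subSn; last by lia.
  apply: eq_big => [i|i _]; first by rewrite leq_addl.
  by congr (b _ (f _ _)); lia.
have half2 : \sum_(0 <= i < k.+1) (k - i)%:R *: f i (k - i)%N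
    = \sum_(1 <= n < k.+1) b n (\sum_(0 <= i < (k - n).+1) f i (k - n - i)%N).
  under eq_bigr => i _ do rewrite frec2.
  transitivity (\sum_(0 <= i < k.+1) \sum_(1 <= n < k.+1 | (n + i <= k)%N) b n (f i (k - i - n)%N)).
    apply: eq_big_nat => i i_k; rewrite (big_nat_widen _ _ k.+1); last by lia.
    by apply: eq_bigl => n /=; lia.
  rewrite (exchange_big_dep_nat predT) //=; apply: eq_big_nat => n n_k.
  rewrite (schur_op_sum bL) [RHS](big_nat_widen _ _ k.+1); last by lia.
  apply: eq_big => [i|i _]; first by lia.
  by congr (b _ (f _ _)); lia.
transitivity (\sum_(0 <= i < k.+1) (i%:R *: f i (k - i)%N + (k - i)%:R *: f i (k - i)%N)).
  rewrite scaler_sumr; apply: eq_big_nat => i i_k; rewrite -scalerDl -natrD.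
  by congr (_%:R *: _); lia.
rewrite big_split /= half1 half2 -big_split; apply: eq_bigr => n _.
by rewrite cb scaler_nat mulr2n.
Qed.

(** * Relations in a module at level zero *)

Definition level_zero (K : fieldType) (cLa : K) (V : shModule K) :=
  forall u : V, sh_act V shCalpha u = 0 /\ sh_act V shCLalpha u = cLa *: u.

Lemma kron_neq (K : fieldType) (n : int) : n != 0 -> kron K n = 0.
Proof. by rewrite /kron => /negPf ->. Qed.

Lemma kron0 (K : fieldType) : kron K 0 = 1.
Proof. by rewrite /kron eqxx. Qed.

Section Action.

Variables (K : fieldType) (V : shModule K).
Implicit Types (b : sh_basis) (x y : V).

Lemma act0 b : sh_act V b 0 = 0. Proof. exact: linear0. Qed.
Lemma actD b x y : sh_act V b (x + y) = sh_act V b x + sh_act V b y.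
Proof. exact: linearD. Qed.
Lemma actN b x : sh_act V b (- x) = - sh_act V b x. Proof. exact: linearN. Qed.
Lemma actB b x y : sh_act V b (x - y) = sh_act V b x - sh_act V b y.
Proof. exact: linearB. Qed.
Lemma actZ b a x : sh_act V b (a *: x) = a *: sh_act V b x.
Proof. exact: linearZ. Qed.
Lemma act_sum b (I : Type) (r : seq I) (P : pred I) (F : I -> V) :
  sh_act V b (\sum_(i <- r | P i) F i) = \sum_(i <- r | P i) sh_act V b (F i).
Proof. exact: linear_sum. Qed.

End Action.

Section Relations.

Variables (K : numFieldType) (cLa : K) (V : shModule K).
Hypothesis V0 : level_zero cLa V.

Local Notation L n := (sh_act V (shL n)).
Local Notation al n := (sh_act V (shAlpha n)).
Local Notation G n := (sh_act V (shG n)).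
Local Notation Psi n := (sh_act V (shPsi n)).

Let cent_alpha x : sh_act V shCalpha x = 0. Proof. by case: (V0 x). Qed.
Let cent_La x : sh_act V shCLalpha x = cLa *: x. Proof. by case: (V0 x). Qed.

Lemma alphaC m n x : al m (al n x) = al n (al m x).
Proof.
apply/eqP; rewrite -subr_eq0 -[X in _ - X]scale1r.
have /= := sh_actP (shAlpha m) (shAlpha n) x; rewrite expr0 => ->.
by rewrite big_seq1 cent_alpha scaler0.
Qed.

Lemma alpha_PsiC m n x : al m (Psi n x) = Psi n (al m x).
Proof.
apply/eqP; rewrite -subr_eq0 -[X in _ - X]scale1r.
by have /= := sh_actP (shAlpha m) (shPsi n) x; rewrite expr0 => ->; rewrite big_nil.
Qed.

Lemma PsiC m n x : Psi m (Psi n x) = - Psi n (Psi m x).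
Proof.
apply/eqP; rewrite -subr_eq0 -[X in _ - X]scaleN1r.
have /= := sh_actP (shPsi m) (shPsi n) x; rewrite expr1 => ->.
by rewrite big_seq1 cent_alpha scaler0.
Qed.

Lemma alpha_G m n x : al m (G n x) = G n (al m x) + m%:~R *: Psi (m + n) x.
Proof.
have /= := sh_actP (shAlpha m) (shG n) x; rewrite expr0 scale1r.
by rewrite big_seq1 /= => /(canRL (subrK _)) ->; rewrite addrC.
Qed.

Lemma G_alpha m n x : G m (al n x) = al n (G m x) - n%:~R *: Psi (n + m) x.
Proof. by rewrite alpha_G addrK. Qed.

Lemma Psi_G m n x : Psi m (G n x)
  = - G n (Psi m x) + al (m + n + 1) x + (2 * m%:~R * kron K (m + n + 1) * cLa) *: x.
Proof.
have /= := sh_actP (shPsi m) (shG n) x; rewrite expr1 scaleN1r opprK.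
rewrite !big_cons big_nil addr0 scale1r /= cent_La scalerA => /(canRL (addrK _)) ->.
by rewrite addrC addrA.
Qed.

Lemma G_Psi m n x : G m (Psi n x)
  = - Psi n (G m x) + al (n + m + 1) x + (2 * n%:~R * kron K (n + m + 1) * cLa) *: x.
Proof. by rewrite Psi_G; lin_coefs K V; ring. Qed.

Lemma L_alpha m n x : L m (al n x)
  = al n (L m x) - n%:~R *: al (m + n) x
    - (kron K (m + n) * (m ^+ 2 + m)%:~R * cLa) *: x.
Proof.
have /= := sh_actP (shL m) (shAlpha n) x; rewrite expr0 scale1r.
rewrite !big_cons big_nil addr0 /= cent_La scalerA => /(canRL (subrK _)) ->.
by lin_coefs K V; ring.
Qed.

Lemma alpha_L m n x : al n (L m x)
  = L m (al n x) + n%:~R *: al (m + n) x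
    + (kron K (m + n) * (m ^+ 2 + m)%:~R * cLa) *: x.
Proof. by rewrite L_alpha; lin_coefs K V; ring. Qed.

Lemma Psi_L m n x : Psi m (L n x)
  = L n (Psi m x) + ((2 * m + n + 1)%:~R / 2) *: Psi (m + n) x.
Proof.
have /= := sh_actP (shPsi m) (shL n) x; rewrite expr0 scale1r.
by rewrite big_seq1 /= => /(canRL (subrK _)) ->; rewrite addrC.
Qed.

Lemma L_Psi m n x : L n (Psi m x)
  = Psi m (L n x) - ((2 * m + n + 1)%:~R / 2) *: Psi (m + n) x.
Proof. by rewrite Psi_L addrK. Qed.

Lemma L_G m n x : L m (G n x)
  = G n (L m x) + (m%:~R / 2 - n%:~R - 1 / 2) *: G (m + n) x.
Proof.
have /= := sh_actP (shL m) (shG n) x; rewrite expr0 scale1r.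
by rewrite big_seq1 /= => /(canRL (subrK _)) ->; rewrite addrC.
Qed.

Lemma G_G m n x : G m (G n x) = - G n (G m x) + 2 *: L (m + n + 1) x
  + (kron K (m + n + 1) * ((m ^+ 2 + m)%:~R / 3)) *: sh_act V shCL x.
Proof.
have /= := sh_actP (shG m) (shG n) x; rewrite expr1 scaleN1r opprK.
by rewrite !big_cons big_nil addr0 => /(canRL (addrK _)) ->; rewrite addrC addrA.
Qed.

Lemma L_L m n x : L m (L n x) = L n (L m x) + (m - n)%:~R *: L (m + n) x
  + (kron K (m + n) * ((m ^+ 3 - m)%:~R / 12)) *: sh_act V shCL x.
Proof.
have /= := sh_actP (shL m) (shL n) x; rewrite expr0 scale1r.
by rewrite !big_cons big_nil addr0 => /(canRL (subrK _)) ->; rewrite addrC addrA.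
Qed.

(** Reduces every statement about the positive modes of [L] to the modes of
    [G]. *)
Lemma L_of_G n x : n != 0 -> L n x = 2^-1 *: (G (n - 1) (G 0 x) + G 0 (G (n - 1) x)).
Proof.
move=> nz_n; rewrite G_G addr0 subrK kron_neq // mul0r scale0r addr0.
by rewrite addrAC addNr add0r scalerA mulVf ?scale1r // pnatr_eq0.
Qed.

End Relations.

(** * The singular vector and the subsingular vector *)

Section SingularVectors.

Variables (K : numFieldType) (cLa : K) (V : shModule K).
Hypothesis cLa_neq0 : cLa != 0.
Hypothesis V0 : level_zero cLa V.

Local Notation L n := (sh_act V (shL n)).
Local Notation al n := (sh_act V (shAlpha n)).
Local Notation G n := (sh_act V (shG n)).
Local Notation Psi n := (sh_act V (shPsi n)).
Local Notation S t k := (@schur_alpha K cLa V t k).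

(** What all polynomials in [alpha(-n)], [Psi(-n+1/2)] inherit from the highest
    weight vector, the [alpha]s and [Psi]s being supercommutative. *)
Definition inert (ha : K) (x : V) : Prop :=
  [/\ forall n : int, 1 <= n -> al n x = 0,
      forall j : int, 0 <= j -> Psi j x = 0
    & al 0 x = ha *: x].

Lemma inert_subspace ha : subspace (inert ha).
Proof.
split=> [|x y [x1 x2 x3] [y1 y2 y3]|a x [x1 x2 x3]].
- by split=> [n|j|] *; rewrite !act0 ?scaler0.
- split=> [n n1|j j0|]; first by rewrite actD x1 // y1 // addr0.
    by rewrite actD x2 // y2 // addr0.
  by rewrite actD x3 y3 scalerDr.
split=> [n n1|j j0|]; first by rewrite actZ /= x1 // scaler0.
  by rewrite actZ /= x2 // scaler0.
by rewrite actZ /= x3 !scalerA mulrC.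
Qed.

Lemma inert_alpha ha m x : inert ha x -> inert ha (al m x).
Proof.
case=> x1 x2 x3; split=> [n n1|j j0|].
- by rewrite (alphaC V0) x1 // act0.
- by rewrite -(alpha_PsiC) x2 // act0.
by rewrite (alphaC V0) x3 actZ.
Qed.

Lemma inert_Psi ha m x : inert ha x -> inert ha (Psi m x).
Proof.
case=> x1 x2 x3; split=> [n n1|j j0|].
- by rewrite alpha_PsiC x1 // act0.
- by rewrite (PsiC V0) x2 // act0 oppr0.
by rewrite alpha_PsiC x3 actZ.
Qed.

Definition schur_op t n (w : V) : V := (- (t%:R * cLa)^-1) *: al (- n%:Z) w.

Lemma schur_op_linear t n : linear (schur_op t n).
Proof.
move=> a x y; rewrite /schur_op linearP scalerDr !scalerA.
by rewrite [_ * a]mulrC.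
Qed.

Lemma schur_op_comm t m n x :
  schur_op t m (schur_op t n x) = schur_op t n (schur_op t m x).
Proof. by rewrite /schur_op !actZ /= (alphaC V0). Qed.

Let Sl t k a x y : S t k (a *: x + y) = a *: S t k x + S t k y :=
  schur_linear (schur_op_linear t) (schur_op_comm t) k a x y.

Lemma schur_alpha_rec t k x : k%:R *: S t k x
  = \sum_(1 <= n < k.+1) (- (t%:R * cLa)^-1) *: al (- n%:Z) (S t (k - n) x).
Proof. exact: (schur_rec (schur_op_linear t) (schur_op_comm t)). Qed.

Lemma schur_alpha0 t x : S t 0 x = x.
Proof. exact: schur0. Qed.

Lemma schur_alphaD t k x y : S t k (x + y) = S t k x + S t k y.
Proof. by case: (linear_split (Sl t k)). Qed.

Lemma schur_alpha_0 t k : S t k 0 = 0.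
Proof. by case: (linear_split (Sl t k)). Qed.

Lemma schur_alphaZ t k a x : S t k (a *: x) = a *: S t k x.
Proof. by case: (linear_split (Sl t k)). Qed.

Lemma schur_alpha_sum t k (I : Type) (r : seq I) (P : pred I) (F : I -> V) :
  S t k (\sum_(i <- r | P i) F i) = \sum_(i <- r | P i) S t k (F i).
Proof. exact: (big_morph (S t k) (schur_alphaD t k) (schur_alpha_0 t k)). Qed.

Lemma schur_alpha_comm t k (f : V -> V) x : linear f ->
  (forall n y, al n (f y) = f (al n y)) -> S t k (f x) = f (S t k x).
Proof.
move=> f_lin f_al; apply: (schur_comm (schur_op_linear t) (schur_op_comm t)) => //.
by move=> n y; rewrite /schur_op f_al; case: (linear_split f_lin).
Qed.

Lemma schur_alpha_al t k n x : S t k (al n x) = al n (S t k x).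
Proof.
by apply: schur_alpha_comm => [a y z|m y]; [rewrite linearP|rewrite (alphaC V0)].
Qed.

Lemma schur_alpha_Psi t k n x : S t k (Psi n x) = Psi n (S t k x).
Proof.
by apply: schur_alpha_comm => [a y z|m y]; [rewrite linearP|rewrite alpha_PsiC].
Qed.

Lemma schur_alphaC t k s l x : S t k (S s l x) = S s l (S t k x).
Proof. by apply: schur_alpha_comm => [a y z|m y]; rewrite ?Sl ?schur_alpha_al. Qed.

Lemma inert_schur ha t k x : inert ha x -> inert ha (S t k x).
Proof.
case=> x1 x2 x3; split=> [n n1|j j0|].
- by rewrite -schur_alpha_al x1 // schur_alpha_0.
- by rewrite -schur_alpha_Psi x2 // schur_alpha_0.
by rewrite -schur_alpha_al x3 schur_alphaZ.
Qed.

Lemma schur_alpha_square k x :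
  S 1 k x = \sum_(0 <= i < k.+1) S 2 i (S 2 (k - i) x).
Proof.
apply: (schur_square _ _ (schur_op_linear 2) (schur_op_comm 2)).
move=> n y; rewrite scalerA; congr (_ *: _); field.
exact: cLa_neq0.
Qed.

Opaque schur_alpha.

(** [G(s)] acts as an odd derivation, so it sends the exponential [E_t(z)] to
    its product with the odd series [- (t cLa)^-1 z^s Psi(z)]; the truncation of
    the sum at [k] accounts for the factor [z^s]. *)
Lemma G_schur_alpha t k j x : (0 < t)%N ->
  G j (S t k x) = S t k (G j x)
    - (t%:R * cLa)^-1 *: \sum_(1 <= n < k.+1) Psi (j - n%:Z) (S t (k - n) x).
Proof.
move=> t_gt0; have nz_t : t%:R != 0 :> K by rewrite pnatr_eq0 -lt0n.
elim/ltn_ind: k => [[|k]] IHk.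
  by rewrite big_geq // scaler0 subr0 !schur_alpha0.
have nz_k : k.+1%:R != 0 :> K by rewrite pnatr_eq0.
apply: (scalerI nz_k); rewrite scalerBr -actZ /= !schur_alpha_rec act_sum.
set c := (t%:R * cLa)^-1.
transitivity (\sum_(1 <= n < k.+2) ((- c) *: al (- n%:Z) (S t (k.+1 - n) (G j x))
   - c *: (n%:R *: Psi (j - n%:Z) (S t (k.+1 - n) x)
     + \sum_(1 <= m < (k.+1 - n).+1)
         Psi (j - m%:Z) ((- c) *: al (- n%:Z) (S t (k.+1 - n - m) x))))).
  apply: eq_big_nat => n n_k; rewrite actZ /= G_alpha IHk; last by lia.
  rewrite [al _ (_ - _)]actB /= [al _ (_ *: _)]actZ /=.
  rewrite [al _ (\sum_(1 <= _ < _) _)]act_sum /= -/c.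
  have -> : \sum_(1 <= m < (k.+1 - n).+1)
      Psi (j - m%:Z) ((- c) *: al (- n%:Z) (S t (k.+1 - n - m) x))
     = (- c) *: \sum_(1 <= m < (k.+1 - n).+1)
         al (- n%:Z) (Psi (j - m%:Z) (S t (k.+1 - n - m) x)).
    rewrite scaler_sumr; apply: eq_bigr => m _; rewrite actZ /=.
    by rewrite alpha_PsiC.
  have -> : - n%:Z + j = j - n%:Z by lia.
  have -> : (- n%:Z)%:~R = - (n%:R) :> K by rewrite mulrNz.
  by lin_coefs K V; ring.
rewrite sumrB; congr (_ - _); rewrite -scaler_sumr scalerA mulrC -scalerA.
congr (_ *: _); rewrite big_split /= sum_triangle -big_split scaler_sumr /=.
apply: eq_big_nat => n n_k; rewrite -act_sum /c.
under eq_bigr => m _ do rewrite subnAC.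
rewrite -schur_alpha_rec actZ /=.
rewrite -scalerDl -natrD; congr (_%:R *: _); lia.
Qed.

(** The coefficient of [z^(e-1/2)] in [Psi(z) E_2(z)]. *)
Definition dressed_Psi (e : nat) (x : V) : V :=
  \sum_(0 <= i < e) Psi (i%:Z - e%:Z) (S 2 i x).
Local Notation T := dressed_Psi.

Lemma psi_schurE ha e x : inert ha x -> psi_schur cLa (- e%:Z) x = T e x.
Proof.
case=> _ Psi_x _; rewrite /psi_schur /dressed_Psi big_mkord.
rewrite (@fsbig_ord _ _ _ e (fun i => Psi (i%:Z - e%:Z) (S 2 i x))).
rewrite -(@fsbig_widen _ _ _ _ `I_e%classic setT) //.
move=> i [_ /= /negP]; rewrite -leqNgt => le_ei.
by rewrite -schur_alpha_Psi Psi_x ?schur_alpha_0 //; lia.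
Qed.

Lemma dressed_Psi_linear e a x y : T e (a *: x + y) = a *: T e x + T e y.
Proof.
rewrite /T scaler_sumr -big_split; apply: eq_bigr => i _.
by rewrite Sl linearP.
Qed.

Lemma dressed_Psi0 e : T e 0 = 0.
Proof. by case: (linear_split (dressed_Psi_linear e)). Qed.

Lemma dressed_PsiZ e a x : T e (a *: x) = a *: T e x.
Proof. by case: (linear_split (dressed_Psi_linear e)). Qed.

Lemma dressed_Psi_schur e t k x : T e (S t k x) = S t k (T e x).
Proof.
rewrite /T schur_alpha_sum; apply: eq_bigr => i _.
by rewrite schur_alphaC schur_alpha_Psi.
Qed.

Lemma inert_dressed_Psi ha e x : inert ha x -> inert ha (T e x).
Proof.
move=> x0; apply: subspace_sum; first exact: inert_subspace.
by move=> i _; apply: inert_Psi; apply: inert_schur.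
Qed.

(** [Psi(z) Psi(z) = 0]: the terms cancel in pairs by anticommutativity. *)
Lemma Psi_square0 ha (j m : nat) y : inert ha y ->
  \sum_(1 <= n < m) Psi (n%:Z - m%:Z) (Psi (j%:Z - n%:Z) y) = 0.
Proof.
move=> [_ Psi_y _].
have [le_mj|lt_jm] := leqP m j.+1.
  rewrite big_nat big1 // => n n_m; rewrite Psi_y ?act0 //; lia.
rewrite (big_cat_nat (n := j.+1)) //=; last by lia.
rewrite [X in X + _]big_nat [X in X + _]big1 ?add0r.
  set X := (X in X = 0); suff X_opp : X = - X.
    have two_neq0 : (2 : K) != 0 by rewrite pnatr_eq0.
    apply: (scalerI two_neq0); rewrite scaler0 scaler_nat mulr2n {1}X_opp.
    by rewrite addNr.
  rewrite /X [LHS]big_nat_rev /= -sumrN; apply: eq_big_nat => n n_m.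
  rewrite (PsiC V0); congr (- _); congr (Psi _ (Psi _ _)); lia.
by move=> n n_j; rewrite Psi_y ?act0 //; lia.
Qed.

(** In generating functions, [G(s)] sends [Psi(z) E_2(z)] to
    [z^s (cLa (p - 2s) - 2 cLa z d/dz) E_2(z)]: the constant term comes from
    [alpha(0)] and the central charge, the derivative from
    [alpha(z) E_2(z) = - 2 cLa z d/dz E_2(z)], and the derivative of the
    exponential contributes nothing since [Psi(z) Psi(z) = 0]. *)
Lemma G_dressed_Psi (p : K) e (j : nat) x : inert ((1 + p) * cLa) x ->
  G j%:Z (T e x) = - T e (G j%:Z x)
    + (cLa * (p + 1 - 2 * e%:R)) *: (if (j < e)%N then S 2 (e - j.+1) x else 0).
Proof.
move=> x0; have [al_x Psi_x al0_x] := x0.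
pose c := (2%:R * cLa)^-1.
have PsiPsi : \sum_(0 <= i < e) \sum_(1 <= n < i.+1)
    Psi (i%:Z - e%:Z) (Psi (j%:Z - n%:Z) (S 2 (i - n) x)) = 0.
  transitivity (\sum_(0 <= i < e) \sum_(0 <= l < e | (l < i)%N)
      Psi (i%:Z - e%:Z) (Psi (j%:Z - (i - l)%N%:Z) (S 2 l x))).
    apply: eq_big_nat => i i_e; rewrite big_add1 /=.
    rewrite big_nat_rev /= add0n [LHS](big_nat_widen _ _ e); last by lia.
    apply: eq_big => [l|l]; first by lia.
    move=> /andP[_ l_i]; congr (Psi _ (Psi _ (S 2 _ x))); lia.
  rewrite (exchange_big_dep_nat predT) //= big_nat big1 // => l l_e.
  rewrite (big_cat_nat (n := l)) //=; last by lia.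
  rewrite [X in X + _]big_nat_cond [X in X + _]big_pred0 ?add0r; last by move=> i; lia.
  rewrite -[RHS](@Psi_square0 _ j (e - l) (S 2 l x) (inert_schur _ _ x0)).
  rewrite -[X in index_iota X e]add0n big_addn big_mkcond /=.
  case e_l: (e - l)%N => [|m]; first by rewrite !big_geq.
  rewrite [LHS]big_ltn // add0n ltnn add0r [LHS]big_nat [RHS]big_nat.
  apply: eq_bigr => n n_m; rewrite ifT; last by lia.
  congr (Psi _ (Psi _ _)); lia.
transitivity (\sum_(0 <= i < e) (- Psi (i%:Z - e%:Z) (S 2 i (G j%:Z x))
   + c *: (\sum_(1 <= n < i.+1) Psi (i%:Z - e%:Z) (Psi (j%:Z - n%:Z) (S 2 (i - n) x)))
   + (al (i%:Z - e%:Z + j%:Z + 1) (S 2 i x)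
      + (2 * (i%:Z - e%:Z)%:~R * kron K (i%:Z - e%:Z + j%:Z + 1) * cLa) *: S 2 i x))).
  rewrite /T act_sum; apply: eq_bigr => i _ /=.
  rewrite (G_Psi V0) G_schur_alpha // [Psi _ (_ - _)]actB /=.
  rewrite [Psi _ (_ *: _)]actZ /= [Psi _ (\sum_(1 <= _ < _) _)]act_sum /=.
  by rewrite -/c; lin_coefs K V; ring.
rewrite !big_split /= sumrN -scaler_sumr PsiPsi scaler0 addr0 -/(T e _).
congr (- _ + _); rewrite -big_split /=.
case: ltnP => [lt_je|le_ej].
  set i0 := (e - j.+1)%N.
  have -> : e = (i0 + j.+1)%N by rewrite /i0; lia.
  rewrite (big_cat_nat (n := i0.+1)) //=; last by lia.
  rewrite [X in _ + X]big_nat [X in _ + X]big1 ?addr0; last first.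
    move=> i i_e; rewrite -schur_alpha_al al_x; last by lia.
    by rewrite kron_neq ?mulr0 ?mul0r ?scale0r ?schur_alpha_0 ?addr0 //; lia.
  rewrite big_nat_recr //=.
  have -> : i0%:Z - (i0 + j.+1)%N%:Z + j%:Z + 1 = 0 by lia.
  rewrite -schur_alpha_al al0_x schur_alphaZ kron0.
  transitivity ((- (2 * cLa)) *: (i0%:R *: S 2 i0 x)
     + ((1 + p) * cLa + 2 * (i0%:R - (i0%:R + j.+1%:R)) * cLa) *: S 2 i0 x).
    rewrite schur_alpha_rec [_ *: (\sum_(1 <= _ < _) _)]scaler_sumr; congr (_ + _).
      rewrite [RHS]big_add1 /= [RHS]big_nat_rev /= add0n; apply: eq_big_nat => i i_i0.
      rewrite kron_neq; last by lia.
      rewrite mulr0 mul0r scale0r addr0 scalerA mulrN mulNr opprK divff ?scale1r.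
        by congr (al _ (S 2 _ x)); lia.
      by rewrite mulf_neq0 // pnatr_eq0.
    rewrite -scalerDl; congr (_ *: _).
    by rewrite rmorphB /= -!pmulrn natrD; ring.
  by rewrite scalerA -scalerDl natrD; congr (_ *: _); ring.
rewrite scaler0 big_nat big1 // => i i_e.
rewrite -schur_alpha_al al_x; last by lia.
by rewrite kron_neq ?mulr0 ?mul0r ?scale0r ?schur_alpha_0 ?addr0 //; lia.
Qed.

(** ** The vectors [u] of weight [p/2] and [w] of weight [p], for [p = 2 h + 1] *)

Variables (h : nat) (v : V).
Hypothesis v_inert : inert ((1 + h.*2.+1%:R) * cLa) v.
Hypothesis G_v : forall j : nat, G j%:Z v = 0.

(** The critical mode of [Psi]: [2 e = p + 1] makes the factor [p + 1 - 2 e] of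
    [G_dressed_Psi] vanish. *)
Definition sing_vec : V := T h.+1 v.

Definition sub_vec : V := S 1 h.*2.+1 v + (2 * cLa ^+ 2)^-1 *:
  \sum_(1 <= k < h.+1) k%:R^-1 *: T (h.+1 - k) (T (h.+1 + k) v).

Lemma w_prE : w_pr cLa h.*2.+1 v = sub_vec.
Proof.
rewrite /w_pr /sub_vec [h.*2.+1./2]/= uphalf_double; congr (_ + _ *: _).
apply: eq_big_nat => k k_h; congr (_ *: _).
have -> : - k%:Z - h%:Z - 1 = - (h.+1 + k)%N%:Z by lia.
have -> : k%:Z - h%:Z - 1 = - (h.+1 - k)%N%:Z by lia.
rewrite (psi_schurE _ v_inert).
by rewrite (psi_schurE _ (inert_dressed_Psi _ v_inert)).
Qed.

Lemma inert_sing_vec : inert ((1 + h.*2.+1%:R) * cLa) sing_vec.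
Proof. exact: inert_dressed_Psi. Qed.

Lemma inert_sub_vec : inert ((1 + h.*2.+1%:R) * cLa) sub_vec.
Proof.
have [_ iD iZ] := inert_subspace ((1 + h.*2.+1%:R) * cLa).
apply: (iD); first exact: inert_schur.
apply: (iZ); apply: subspace_sum; first exact: inert_subspace.
by move=> k _; apply: (iZ); do 2 apply: inert_dressed_Psi.
Qed.

Lemma G_sing_vec (j : nat) : G j%:Z sing_vec = 0.
Proof.
rewrite /sing_vec (G_dressed_Psi _ _ v_inert) G_v dressed_Psi0 oppr0 add0r.
have -> : h.*2.+1%:R + 1 - 2 * h.+1%:R = 0 :> K.
  by rewrite -muln2 -!natr1 natrM; ring.
by rewrite mulr0 scale0r.
Qed.

Let R j e := if (e + j <= h.*2.+1)%N then T e (S 2 (h.*2.+1 - j - e) v) else 0.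

(** [G(s) E_1(z) = - cLa^-1 z^s (Psi(z) E_2(z)) E_2(z)], since [E_1 = E_2 ^ 2]. *)
Lemma G_schur_top (j : nat) : G j%:Z (S 1 h.*2.+1 v)
  = (- cLa^-1) *: \sum_(1 <= e < h.*2.+2) R j e.
Proof.
set p := h.*2.+1; have [al_v Psi_v _] := v_inert.
rewrite G_schur_alpha // G_v schur_alpha_0 sub0r mul1r scaleNr; congr (- (_ *: _)).
transitivity (\sum_(0 <= l < p) \sum_(0 <= i < p | (i + l < p)%N)
    Psi (i%:Z - (p - l)%N%:Z + j%:Z) (S 2 i (S 2 l v))).
  transitivity (\sum_(1 <= n < p.+1) \sum_(0 <= l < p | (l + n <= p)%N)
     Psi (j%:Z - n%:Z) (S 2 (p - n - l) (S 2 l v))).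
    apply: eq_big_nat => n n_p; rewrite schur_alpha_square act_sum.
    rewrite big_nat_rev /= add0n (big_nat_widen _ _ p); last by lia.
    apply: eq_big => [l|l /andP[_ l_n]]; first by lia.
    by congr (Psi _ (S 2 _ (S 2 _ v))); lia.
  rewrite (exchange_big_dep_nat predT) //=; apply: eq_big_nat => l l_p.
  rewrite big_add1 /= big_nat_rev /= add0n big_nat_cond [RHS]big_nat_cond.
  rewrite [RHS](big_cat_nat (n := (p - l)%N)) //=; last by lia.
  rewrite [X in _ + X]big_nat_cond [X in _ + X]big_pred0 ?addr0; last by move=> i; lia.
  rewrite [LHS](big_cat_nat (n := l)) //=; last by lia.
  rewrite [X in X + _]big_nat_cond [X in X + _]big_pred0 ?add0r; last by move=> i; lia.
  rewrite -[X in index_iota X p]add0n big_addn.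
  apply: eq_big => [i|i i_p]; first by lia.
  by congr (Psi _ (S 2 _ (S 2 _ v))); lia.
rewrite [RHS]big_add1 /= [RHS]big_nat_rev /= add0n.
rewrite [LHS](big_cat_nat (n := (p - j)%N)) //=; last by lia.
rewrite [X in _ + X]big_nat [X in _ + X]big1 ?addr0; last first.
  move=> l l_p; apply: big1 => i _.
  by rewrite -!schur_alpha_Psi Psi_v ?schur_alpha_0 //; lia.
have [lt_jp|le_pj] := ltnP j p; last first.
  rewrite big_geq; last by lia.
  by rewrite big_nat big1 // => e e_p; rewrite /R ifF //; lia.
rewrite [RHS](big_cat_nat (n := j)) //=; last by lia.
rewrite [X in _ = X + _]big_nat [X in _ = X + _]big1 ?add0r; last first.
  by move=> e e_j; rewrite /R ifF //; lia.
rewrite -[X in _ = \sum_(X <= _ < _) _]add0n big_addn.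
apply: eq_big_nat => l l_p; rewrite /R ifT; last by lia.
have -> : (p - (l + j).+1).+1 = (p - l - j)%N by lia.
have -> : (h.*2.+1 - j - (p - l - j))%N = l by lia.
rewrite /dressed_Psi [RHS](big_nat_widen 0 (p - l - j) p) /=; last by lia.
rewrite [LHS]big_mkcond [RHS]big_mkcond /=; apply: eq_bigr => i _.
case: ifP => [i_p|]; case: ifP => // i_p'; try lia.
  by congr (Psi _ _); lia.
by rewrite -!schur_alpha_Psi Psi_v ?schur_alpha_0 //; lia.
Qed.

(** The quadratic part of [sub_vec] cancels everything in [G_schur_top] but
    the term [e = h + 1]. *)
Lemma G_sub_vec (j : nat) : G j%:Z sub_vec
  = (- cLa^-1) *: (if (j <= h)%N then S 2 (h - j) sing_vec else 0).
Proof.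
have GTT k : (0 < k <= h)%N ->
    G j%:Z (T (h.+1 - k) (T (h.+1 + k) v))
    = (2 * k%:R * cLa) *: (R j (h.+1 - k) + R j (h.+1 + k)).
  move=> k_h; rewrite (G_dressed_Psi _ _ (inert_dressed_Psi _ v_inert)).
  rewrite (G_dressed_Psi _ _ v_inert) G_v dressed_Psi0 oppr0 add0r dressed_PsiZ.
  have -> : h.*2.+1%:R + 1 - 2 * (h.+1 + k)%:R = - (2 * k%:R) :> K.
    by rewrite -muln2 natrD -!natr1 natrM; ring.
  have -> : h.*2.+1%:R + 1 - 2 * (h.+1 - k)%:R = 2 * k%:R :> K.
    by rewrite -muln2 natrB; [rewrite -!natr1 natrM; ring|lia].
  rewrite mulrN scaleNr opprK scalerDr mulrC; congr (_ *: _ + _ *: _).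
    rewrite /R; case: ifP => j_h; last by rewrite dressed_Psi0 ifF //; lia.
    by rewrite ifT; [congr (T _ (S 2 _ v)) | ]; lia.
  rewrite /R; case: ifP => j_h; last by rewrite ifF //; lia.
  by rewrite ifT ?dressed_Psi_schur; [congr (S 2 _ _)|]; lia.
rewrite /sub_vec actD actZ G_schur_top [G _ (\sum_(1 <= _ < _) _)]act_sum.
have -> : \sum_(1 <= k < h.+1) G j%:Z (k%:R^-1 *: T (h.+1 - k) (T (h.+1 + k) v))
    = (2 * cLa) *: \sum_(1 <= k < h.+1) (R j (h.+1 - k) + R j (h.+1 + k)).
  rewrite scaler_sumr; apply: eq_big_nat => k k_h; rewrite actZ GTT; last by lia.
  rewrite scalerA; congr (_ *: _); field.
  by rewrite pnatr_eq0; lia.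
have -> : (if (j <= h)%N then S 2 (h - j) sing_vec else 0) = R j h.+1.
  rewrite /R; case: ifP => j_h; last by rewrite ifF //; lia.
  by rewrite ifT ?dressed_Psi_schur; [congr (S 2 _ _)|]; lia.
have -> : \sum_(1 <= e < h.*2.+2) R j e
    = R j h.+1 + \sum_(1 <= k < h.+1) (R j (h.+1 - k) + R j (h.+1 + k)).
  rewrite (big_cat_nat (n := h.+1)) //=; last by lia.
  rewrite [X in _ + X]big_ltn; last by lia.
  rewrite addrCA big_split /=; congr (_ + (_ + _)).
    by rewrite big_nat_rev /=; apply: eq_big_nat => k k_h; congr (R j _); lia.
  rewrite -[X in index_iota X h.*2.+2]/(1 + h.+1)%N big_addn.
  have -> : (h.*2.+2 - h.+1)%N = h.+1 by lia.
  by apply: eq_bigr => k _; rewrite addnC.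
lin_coefs K V; field; exact: cLa_neq0.
Qed.

Transparent schur_alpha.

End SingularVectors.

(** * The weight grading of a highest weight module *)

(** Twice the [L(0)]-weight, so that it is an integer. *)
Definition wt2 (b : sh_basis) : int :=
  match b with
  | shL n | shAlpha n => - (2 * n)
  | shG n | shPsi n => - (2 * n + 1)
  | _ => 0
  end.

Lemma bracket_wt2 (K : fieldType) x y t : List.In t (sh_bracket K x y) ->
  t.1 = 0 \/ wt2 t.2 = wt2 x + wt2 y.
Proof.
have kronE n : kron K n = 0 \/ n = 0.
  by rewrite /kron; case: eqVneq => [->|_]; [right|left].
by case: x y => [m|m|m|m|||] [n|n|n|n|||] //=; repeat case=> //; move=> <- /=;
  first [by right; lia
        | by case: (kronE (m + n)) => [->|?];
            [left; rewrite ?mul0r ?mulr0 ?oppr0 ?mulr0 | right; lia]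
        | by case: (kronE (n + m)) => [->|?];
            [left; rewrite ?mul0r ?mulr0 ?oppr0 ?mulr0 | right; lia]
        | by case: (kronE (m + n + 1)) => [->|?];
            [left; rewrite ?mul0r ?mulr0 ?oppr0 ?mulr0 | right; lia]
        | by case: (kronE (n + m + 1)) => [->|?];
            [left; rewrite ?mul0r ?mulr0 ?oppr0 ?mulr0 | right; lia]].
Qed.

Section Grading.

Variables (K : numFieldType) (cL cLa hw ha : K) (V : shModule K) (v : V).
Hypothesis v_hw : hw_vector cL cLa hw ha v.
Hypothesis v_gen : generated v = setT.

Local Notation L n := (sh_act V (shL n)).
Local Notation al n := (sh_act V (shAlpha n)).
Local Notation G n := (sh_act V (shG n)).
Local Notation Psi n := (sh_act V (shPsi n)).

Lemma hw_level_zero : level_zero cLa V.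
Proof. by case: v_hw => cent _ _ _ u; case: (cent u). Qed.

Lemma gen_ind (P : V -> Prop) : subspace P -> P v ->
  (forall b x, P x -> P (sh_act V b x)) -> forall x, P x.
Proof.
case=> P0 PD PZ Pv Pact x; have: generated v x by rewrite v_gen.
by move/(_ [set y | P y])%classic; apply; split=> // y ->.
Qed.

(** The weight is [hw + d / 2]. Only operators of positive weight are applied
    to [v], so there is nothing below [v] by construction; that the other
    operators respect the grading is then the content of [homog_stable]. *)
Inductive homog : int -> V -> Prop :=
  | homog_hw : homog 0 v
  | homog0 d : homog d 0
  | homogD d x y of homog d x & homog d y : homog d (x + y)
  | homogZ d a x of homog d x : homog d (a *: x)
  | homog_act b d d' x of 0 < wt2 b & homog d x & d' = wt2 b + d :
      homog d' (sh_act V b x).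

Lemma homog_subspace d : subspace (homog d).
Proof. by split; [exact: homog0|exact: homogD|exact: homogZ]. Qed.

Lemma homog_stable b d x : homog d x -> homog (wt2 b + d) (sh_act V b x).
Proof.
move=> hx; elim: hx b => {d x} [|d|d x y _ IHx _ IHy|d a x _ IHx
  |b' d d' x b'_gt0 hx IHx ->] b.
- have [b_gt0|b_le0] := ltP 0 (wt2 b).
    by apply: (homog_act (d := 0)) => //; apply: homog_hw.
  case: v_hw => cent pos_v L0_v al0_v.
  have [cent_L cent_a cent_La] := cent v.
  have hwZ d a : d = 0 -> homog d (a *: v).
    by move=> ->; apply: homogZ; apply: homog_hw.
  case: b b_le0 => [n|n|n|n|||] /= b_le0.
  + have [n1|n0] := lerP 1 n; first by rewrite pos_v //; apply: homog0.
    by have -> : n = 0 by [lia]; rewrite L0_v; apply: hwZ.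
  + have [n1|n0] := lerP 1 n; first by rewrite pos_v //; apply: homog0.
    by have -> : n = 0 by [lia]; rewrite al0_v; apply: hwZ.
  + by rewrite pos_v //=; [apply: homog0|lia].
  + by rewrite pos_v //=; [apply: homog0|lia].
  + by rewrite cent_L; apply: hwZ.
  + by rewrite cent_a; apply: homog0.
  + by rewrite cent_La; apply: hwZ.
- by rewrite act0; apply: homog0.
- by rewrite actD; apply: homogD; [apply: IHx|apply: IHy].
- by rewrite actZ; apply: homogZ; apply: IHx.
have [b_gt0|b_le0] := ltP 0 (wt2 b).
  by apply: (homog_act (d := wt2 b' + d)) => //; apply: homog_act hx _.
rewrite sh_swap; apply: homogD.
  by apply: homogZ; apply: (homog_act (d := wt2 b + d)) => //; lia.
apply: bracket_mem; first exact: homog_subspace.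
move=> t /bracket_wt2[->|wt_t]; first by rewrite scale0r; apply: homog0.
by rewrite addrA -wt_t; apply: homogZ; apply: IHx.
Qed.

Lemma homog_low d x : homog d x ->
  (d < 0 -> x = 0) /\ (d <= 0 -> exists c, x = c *: v).
Proof.
elim=> {d x} [|d|d x y _ [IHx IHx'] _ [IHy IHy']|d a x _ [IHx IHx']
  |b d d' x b_gt0 _ [IHx _] ->].
- by split=> // _; exists 1; rewrite scale1r.
- by split=> // _; exists 0; rewrite scale0r.
- split=> d0; first by rewrite IHx // IHy // addr0.
  have [c ->] := IHx' d0; have [c' ->] := IHy' d0.
  by exists (c + c'); rewrite scalerDl.
- split=> d0; first by rewrite IHx // scaler0.
  by have [c ->] := IHx' d0; exists (a * c); rewrite scalerA.
split=> d0; first by rewrite IHx ?act0 //; lia.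
by exists 0; rewrite IHx ?act0 ?scale0r //; lia.
Qed.

Lemma L0_act b x : 0 < wt2 b ->
  L 0 (sh_act V b x) = sh_act V b (L 0 x) + ((wt2 b)%:~R / 2) *: sh_act V b x.
Proof.
case: b => [n|n|n|n|||] //= b_gt0.
- rewrite L_L kron_neq ?mul0r ?scale0r ?addr0 ?add0r; last by lia.
  by congr (_ + _ *: _); field.
- rewrite (L_alpha hw_level_zero) kron_neq ?mul0r ?scale0r ?subr0 ?add0r; last by lia.
  by rewrite -scaleNr; congr (_ + _ *: _); rewrite -mulrNz; field.
- by rewrite L_G add0r; congr (_ + _ *: _); field.
by rewrite L_Psi !addr0 -scaleNr; congr (_ + _ *: _); field.
Qed.

Lemma L0_homog d x : homog d x -> L 0 x = (hw + d%:~R / 2) *: x.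
Proof.
elim=> {d x} [|d|d x y _ IHx _ IHy|d a x _ IHx|b d d' x b_gt0 _ IHx ->].
- by case: v_hw => _ _ -> _; rewrite mul0r addr0.
- by rewrite act0 scaler0.
- by rewrite actD IHx IHy scalerDr.
- by rewrite actZ IHx !scalerA mulrC.
by rewrite L0_act // IHx actZ -scalerDl; congr (_ *: _); field.
Qed.

(** Without operators, [opspan] is the linear span. *)
Definition homog_le (d : int) : V -> Prop :=
  opspan pred0 (fun y => exists2 d', d' <= d & homog d' y).

Lemma homog_le_mono d d' x : d <= d' -> homog_le d x -> homog_le d' x.
Proof.
move=> le_dd'; apply: opspan_sub => // [|y [e le_ed hy]].
  exact: opspan_subspace.
by apply: opspan_base; exists e => //; apply: le_trans le_dd'.
Qed.

Lemma homog_le_stable b d x : homog_le d x -> homog_le (wt2 b + d) (sh_act V b x).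
Proof.
elim=> {x} [y [e le_ed hy]||y z _ IHy _ IHz|a y _ IHy|//].
- apply: opspan_base; exists (wt2 b + e); first by rewrite lerD2l.
  exact: homog_stable.
- by rewrite act0; apply: opspan0.
- by rewrite actD; apply: opspanD.
by rewrite actZ; apply: opspanZ.
Qed.

Lemma homog_le_low d x : homog_le d x ->
  (d < 0 -> x = 0) /\ (d <= 0 -> exists c, x = c *: v).
Proof.
elim=> {x} [x [e le_ed hx]||x y _ [IHx IHx'] _ [IHy IHy']|a x _ [IHx IHx']|//].
- have [x_lt0 x_le0] := homog_low hx.
  by split=> d0; [apply: x_lt0|apply: x_le0]; lia.
- by split=> // _; exists 0; rewrite scale0r.
- split=> d0; first by rewrite IHx // IHy // addr0.
  have [c ->] := IHx' d0; have [c' ->] := IHy' d0.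
  by exists (c + c'); rewrite scalerDl.
split=> d0; first by rewrite IHx // scaler0.
by have [c ->] := IHx' d0; exists (a * c); rewrite scalerA.
Qed.

Lemma homog_le_exists x : exists n : nat, homog_le n%:Z x.
Proof.
move: x; apply: (gen_ind (P := fun x => exists n : nat, homog_le n%:Z x)) => [||b x [n hx]].
- split=> [|x y [m hx] [n hy]|a x [m hx]].
  + by exists 0%N; apply: opspan0.
  + exists (maxn m n); apply: opspanD.
      by apply: homog_le_mono hx; lia.
    by apply: homog_le_mono hy; lia.
  by exists m; apply: opspanZ.
- by exists 0%N; apply: opspan_base; exists 0 => //; apply: homog_hw.
exists `|(wt2 b + n%:Z)%R|%N; apply: homog_le_mono (homog_le_stable b hx); lia.
Qed.

Definition homog_pos : V -> Prop :=
  opspan pred0 (fun y => exists2 d : int, 0 < d & homog d y).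

Lemma homog_pos_neg_act b x : 0 < wt2 b -> homog_pos x -> homog_pos (sh_act V b x).
Proof.
move=> b_gt0; elim=> {x} [y [e e_gt0 hy]||y z _ IHy _ IHz|a y _ IHy|//].
- apply: opspan_base; exists (wt2 b + e); first exact: addr_gt0.
  exact: homog_stable.
- by rewrite act0; apply: opspan0.
- by rewrite actD; apply: opspanD.
by rewrite actZ; apply: opspanZ.
Qed.

Lemma homog_pos_decomp x : exists c y, homog_pos y /\ x = c *: v + y.
Proof.
pose P x := exists c y, homog_pos y /\ x = c *: v + y.
have sP : subspace P.
  split=> [|x1 x2 [c1 [y1 [hy1 ->]]] [c2 [y2 [hy2 ->]]]|a x1 [c [y [hy ->]]]].
  - by exists 0, 0; split; [exact: opspan0|rewrite scale0r addr0].
  - exists (c1 + c2), (y1 + y2); split; first exact: opspanD.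
    by rewrite scalerDl addrACA.
  by exists (a * c), (a *: y); split; [exact: opspanZ|rewrite scalerDr scalerA].
have homP d y : homog d y -> P y.
  move=> hy; have [d_le0|d_gt0] := lerP d 0.
    have [_ /(_ d_le0)[c ->]] := homog_low hy.
    by exists c, 0; split; [exact: opspan0|rewrite addr0].
  exists 0, y; split; last by rewrite scale0r add0r.
  by apply: opspan_base; exists d.
move: x; apply: (gen_ind (P := P)) => //; first by apply: homP homog_hw.
have [P0 PD PZ] := sP.
move=> b _ [c [y [hy ->]]]; rewrite actD actZ; apply: (PD).
  by apply: (PZ); apply: homP (homog_stable b homog_hw).
elim: hy => {y} [y [e _ he]||y z _ IHy _ IHz|a y _ IHy|//].
- exact: homP (homog_stable b he).
- by rewrite act0.
- by rewrite actD; apply: (PD).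
by rewrite actZ; apply: (PZ).
Qed.

Lemma homog_pos_sum y : homog_pos y -> exists s : seq (nat * V),
  (forall q, q \in s -> homog q.1.+1%:Z q.2) /\ y = \sum_(q <- s) q.2.
Proof.
elim=> {y} [y [e e_gt0 hy]||y z _ [s [hs ->]] _ [t [ht ->]]|a y _ [s [hs ->]]|//].
- exists [:: (`|e|.-1, y)%N]; split; last by rewrite big_seq1.
  by move=> q; rewrite inE => /eqP -> /=; rewrite prednK; [|lia];
     have -> : `|e|%N%:Z = e by lia.
- by exists [::]; split=> //; rewrite big_nil.
- exists (s ++ t); split; last by rewrite big_cat.
  by move=> q; rewrite mem_cat => /orP[/hs|/ht].
exists [seq (q.1, a *: q.2) | q <- s]; split.
  by move=> _ /mapP[q /hs hq ->]; apply: homogZ.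
by rewrite big_map scaler_sumr.
Qed.

(** Subtracting from [L(0)] the weight of a homogeneous component of [y] removes
    this component and only rescales [c *: v]. *)
Lemma submodule_lowest (N : set V) c y : submodule N -> homog_pos y ->
  N (c *: v + y) -> N (c *: v).
Proof.
move=> [N0 ND NZ Nact] /homog_pos_sum[s [hs ->]].
elim: (size s) {-2}s (erefl (size s)) c hs => {s} [|n IHn] s.
  by move/size0nil=> -> c _; rewrite big_nil addr0.
case: s => // -[d x] s [sz_s] c hs.
have [Nx hx] : homog d.+1%:Z x /\ forall q, q \in s -> homog q.1.+1%:Z q.2.
  split; first by apply: (hs (d, x)); rewrite inE eqxx.
  by move=> q qs; apply: hs; rewrite inE qs orbT.
pose e : K := d.+1%:R / 2.
have nz_e : e != 0 by rewrite /e mulf_neq0 ?invr_eq0 ?pnatr_eq0.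
rewrite big_cons /= => Ncx.
pose s' := [seq (q.1, (q.1.+1%:R / 2 - e) *: q.2) | q <- s].
have Ns' : N (- (e * c) *: v + \sum_(q <- s') q.2).
  have -> : - (e * c) *: v + \sum_(q <- s') q.2 =
      L 0 (c *: v + (x + \sum_(q <- s) q.2))
      + (- (hw + e)) *: (c *: v + (x + \sum_(q <- s) q.2)).
    rewrite !actD actZ (L0_homog homog_hw) (L0_homog Nx).
    have -> : L 0 (\sum_(q <- s) q.2) = \sum_(q <- s') q.2 + (hw + e) *: \sum_(q <- s) q.2.
      rewrite act_sum /s' big_map scaler_sumr -big_split; apply: eq_big_seq => q qs.
      by rewrite (L0_homog (hx q qs)) /= -scalerDl; congr (_ *: _); rewrite -pmulrn; ring.
    rewrite -[X in (hw + X / 2) *: x]pmulrn -/e.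
    by lin_coefs K V; ring.
  by apply: ND; [exact: Nact|exact: NZ].
have {}Ns' : N (- (e * c) *: v).
  apply: (IHn s') => //; first by rewrite size_map.
  by move=> _ /mapP[q /hx hq ->]; apply: homogZ.
have := NZ (- e^-1) _ Ns'; rewrite scalerA mulrNN mulrA mulVf // mul1r; apply.
Qed.

Lemma hw_notin_pos : v <> 0 -> ~ homog_pos v.
Proof.
move=> nz_v hv; apply: nz_v.
have sub0 : submodule [set (0 : V)]%classic.
  by split=> [|x y -> ->|a x ->|b x ->] //=; rewrite ?addr0 ?scaler0 ?act0.
have := @submodule_lowest _ (-1) v sub0 hv.
by rewrite scaleN1r addNr => /(_ erefl) /eqP; rewrite oppr_eq0 => /eqP.
Qed.

End Grading.

(** * Vectors annihilated by the positive [alpha]s and [Psi]s *)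

Definition abel (b : sh_basis) : bool :=
  match b with shAlpha _ | shPsi _ => true | _ => false end.

Definition abel_pos (b : sh_basis) : bool :=
  match b with shAlpha n => 1 <= n | shPsi n => 0 <= n | _ => false end.

Definition abel_neg (b : sh_basis) : bool :=
  match b with shAlpha n | shPsi n => n < 0 | _ => false end.

Definition ns_neg (b : sh_basis) : bool :=
  match b with shL n | shG n => n < 0 | _ => false end.

Definition depth (b : sh_basis) : nat := `|wt2 b|%N.

Lemma sum_delta (V : nmodType) (a b n : nat) (x : V) : (a <= n < b)%N ->
  \sum_(a <= i < b) (if i == n then x else 0) = x.
Proof.
move=> /andP[le_an lt_nb]; rewrite -big_mkcond /= big_nat1_eq.
by rewrite le_an lt_nb.
Qed.

Section Straightening.

Variables (K : numFieldType) (cLa : K) (V : shModule K) (p : nat).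
Hypothesis cLa_neq0 : cLa != 0.
Hypothesis V0 : level_zero cLa V.

Local Notation L n := (sh_act V (shL n)).
Local Notation al n := (sh_act V (shAlpha n)).
Local Notation G n := (sh_act V (shG n)).
Local Notation Psi n := (sh_act V (shPsi n)).
Local Notation ha := ((1 + p%:R) * cLa).

Variable J : V -> Prop.
Hypothesis J_subspace : subspace J.
Hypothesis J_inert : forall x, J x -> inert ha x.
Hypothesis J_abel : forall b x, abel b -> J x -> J (sh_act V b x).

(** The filtration of [U(ns_neg) J] by the length of words and, within a length,
    by their depth. *)
Inductive words : nat -> nat -> V -> Prop :=
  | words_base k d x of J x : words k d x
  | wordsD k d x y of words k d x & words k d y : words k d (x + y)
  | wordsZ k d a x of words k d x : words k d (a *: x)
  | words_act k d k' d' b x of words k d x & ns_neg b &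
      (k.+1 < k')%N || (k.+1 == k') && (d + depth b <= d')%N :
      words k' d' (sh_act V b x).

Lemma words_subspace k d : subspace (words k d).
Proof.
have [J0 _ _] := J_subspace.
by split; [exact: words_base|exact: wordsD|exact: wordsZ].
Qed.

Lemma words_mono k d k' d' x : words k d x ->
  (k < k')%N || (k == k') && (d <= d')%N -> words k' d' x.
Proof.
elim=> {k d x} [k d x Jx|k d x y _ IHx _ IHy|k d a x _ IHx|k d k1 d1 b x wx _ b_neg lt1] lt2.
- exact: words_base.
- by apply: wordsD; [apply: IHx|apply: IHy].
- by apply: wordsZ; apply: IHx.
apply: (words_act wx) => //; lia.
Qed.

Lemma opspan_words x : opspan ns_neg J x -> exists k d, words k d x.
Proof.
have lub k d k' d' y : words k d y -> words (maxn k k') (maxn d d') y.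
  by move=> wy; apply: words_mono wy _; lia.
have lub' k d k' d' y : words k d y -> words (maxn k' k) (maxn d' d) y.
  by rewrite maxnC (maxnC d'); apply: lub.
elim=> {x} [x Jx||x y _ [k [d wx]] _ [k' [d' wy]]|a x _ [k [d wx]]|b x b_neg _ [k [d wx]]].
- by exists 0%N, 0%N; apply: words_base.
- by exists 0%N, 0%N; apply: words_base; case: J_subspace.
- by exists (maxn k k'), (maxn d d'); apply: wordsD; [apply: lub|apply: lub'].
- by exists k, d; apply: wordsZ.
exists k.+1, (d + depth b)%N; apply: (words_act wx) => //.
by rewrite eqxx leqnn orbT.
Qed.

Lemma words0 d x : words 0 d x -> J x.
Proof.
have [J0 JD JZ] := J_subspace.
move e_k: 0%N => k wx; elim: wx e_k => {k d x} //.
- by move=> k d x y _ IHx _ IHy e_k; apply: JD; auto.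
- by move=> k d a x _ IHx e_k; apply: JZ; auto.
by move=> k d k' d' b x _ _ _ lt_k e_k; move: lt_k; rewrite -e_k.
Qed.

Lemma bracket_abel_ns b b' t : abel b -> ns_neg b' ->
  List.In t (sh_bracket K b b') ->
  [\/ abel t.2, t.2 = shCalpha | t.2 = shCLalpha].
Proof.
by case: b => // m _; case: b' => // n _ /=; repeat case=> //; move=> <- /=;
  constructor.
Qed.

Lemma words_bracket (P : V -> Prop) b b' x : subspace P -> abel b -> ns_neg b' ->
  P x -> (forall c, abel c -> P (sh_act V c x)) ->
  P (\sum_(t <- sh_bracket K b b') t.1 *: sh_act V t.2 x).
Proof.
move=> sP b_ab b'_neg Px Pc; apply: bracket_mem => // t /bracket_abel_ns.
have [P0 _ PZ] := sP.
case/(_ b_ab b'_neg) => [t_ab|->|->]; apply: (PZ); first exact: Pc.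
  by case: (V0 x) => -> _.
by case: (V0 x) => _ ->; apply: (PZ).
Qed.

Lemma words_abel k d b x : abel b -> words k d x -> words k d (sh_act V b x).
Proof.
move=> b_ab wx; elim: wx b b_ab => {k d x}
  [k d x Jx|k d x y _ IHx _ IHy|k d a x _ IHx|k d k' d' b' x wx IHx b'_neg lt_k] b b_ab.
- by apply: words_base; apply: J_abel.
- by rewrite actD; apply: wordsD; [apply: IHx|apply: IHy].
- by rewrite actZ; apply: wordsZ; apply: IHx.
have up y : words k d y -> words k' d' y by move=> wy; apply: words_mono wy _; lia.
rewrite sh_swap; apply: wordsD.
  by apply: wordsZ; apply: (words_act (IHx _ b_ab)).
apply: (words_bracket (P := words k' d')) => //; first exact: words_subspace.
  exact: up.
by move=> c c_ab; apply: up; apply: IHx.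
Qed.

(** What lies below [(k, 0)] in the lexicographic order; [lower] does the same
    for all pairs. *)
Definition short (k : nat) (x : V) : Prop :=
  if k is k'.+1 then exists d, words k' d x else x = 0.

Lemma short_subspace k : subspace (short k).
Proof.
case: k => [|k] /=.
  by split=> [|x y -> ->|a x ->]; rewrite ?addr0 ?scaler0.
split=> [|x y [d wx] [d' wy]|a x [d wx]].
- by exists 0%N; case: (words_subspace k 0).
- exists (maxn d d'); apply: wordsD.
    by apply: words_mono wx _; lia.
  by apply: words_mono wy _; lia.
by exists d; apply: wordsZ.
Qed.

Lemma short_words k d x : short k x -> words k d x.
Proof.
case: k => [->|k [d' wx]]; first by case: (words_subspace 0 d).
by apply: words_mono wx _; lia.
Qed.

Lemma words_short k k' d x : (k < k')%N -> words k d x -> short k' x.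
Proof. by case: k' => // k' lt_k wx; exists d; apply: words_mono wx _; lia. Qed.

Lemma short_mono k k' x : (k <= k')%N -> short k x -> short k' x.
Proof.
case: k => [_ ->|k lt_k [d wx]]; first by case: (short_subspace k').
exact: words_short wx.
Qed.

Lemma short_act k b x : ns_neg b -> short k x -> short k.+1 (sh_act V b x).
Proof.
case: k => [|k] b_neg; first by move=> ->; rewrite act0; case: (short_subspace 1).
case=> d wx; exists (d + depth b)%N; apply: (words_act wx) => //.
by rewrite eqxx leqnn orbT.
Qed.

Lemma words_abel_pos k d b x : abel_pos b -> words k d x -> short k (sh_act V b x).
Proof.
move=> b_pos wx; elim: wx b b_pos => {k d x}
  [k d x Jx|k d x y _ IHx _ IHy|k d a x _ IHx|k d k' d' b' x wx IHx b'_neg lt_k] b b_pos.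
- have [al_x Psi_x _] := J_inert Jx.
  have [s0 _ _] := short_subspace k.
  by case: b b_pos => //= n n_pos; rewrite ?al_x ?Psi_x.
- by have [_ sD _] := short_subspace k; rewrite actD; apply: (sD); auto.
- by have [_ _ sZ] := short_subspace k; rewrite actZ; apply: (sZ); auto.
have [s0 sD sZ] := short_subspace k'.
rewrite sh_swap; apply: (sD).
  by apply: (sZ); apply: (@short_mono k.+1); [lia|apply: short_act => //; apply: (IHx)].
apply: (words_bracket (P := short k')) => //.
- by case: b b_pos.
- by apply: words_short wx; lia.
by move=> c c_ab; apply: (words_short _ (words_abel c_ab wx)); lia.
Qed.

Lemma words_al0 k d x : words k d x -> al 0 x = ha *: x.
Proof.
elim=> {k d x} [k d x Jx|k d x y _ IHx _ IHy|k d a x _ IHx|k d k' d' b x wx IHx b_neg _].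
- by case: (J_inert Jx).
- by rewrite actD IHx IHy scalerDr.
- by rewrite actZ IHx !scalerA mulrC.
case: b b_neg => //= n n_neg.
  rewrite (alpha_L V0) IHx actZ scale0r addr0 kron_neq ?addr0; last by lia.
  by rewrite !mul0r scale0r addr0.
by rewrite alpha_G IHx actZ scale0r addr0.
Qed.

Definition lower (k d : nat) (x : V) : Prop :=
  if d is d'.+1 then words k d' x else short k x.

Lemma lower_subspace k d : subspace (lower k d).
Proof. by case: d => [|d]; [apply: short_subspace|apply: words_subspace]. Qed.

Lemma words_lower k d d' x : (d < d')%N -> words k d x -> lower k d' x.
Proof. by case: d' => // d' lt_d wx; apply: words_mono wx _; lia. Qed.

Lemma short_lower k d x : short k x -> lower k d x.
Proof. by case: d => // d; apply: short_words. Qed.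

Lemma lower_act k d b x : ns_neg b -> lower k d x ->
  lower k.+1 (d + depth b) (sh_act V b x).
Proof.
case: d => [|d] b_neg lx; first by apply: short_lower; apply: short_act.
rewrite addSn; apply: (words_act lx) => //.
by rewrite eqxx leqnn orbT.
Qed.

Lemma lower_mono k d d' x : (d <= d')%N -> lower k d x -> lower k d' x.
Proof.
case: d => [_|d lt_d]; first exact: short_lower.
exact: words_lower.
Qed.

Lemma lower_abel_pos k d d' b c x : ns_neg b -> abel_pos c -> words k d x ->
  lower k.+1 d' (sh_act V b (sh_act V c x)).
Proof.
by move=> b_neg c_pos wx; apply: short_lower; apply: short_act => //; apply: words_abel_pos wx.
Qed.

Lemma lower_abel k d d' b c x : ns_neg b -> abel c -> words k d x ->
  (d + depth b < d')%N -> lower k.+1 d' (sh_act V b (sh_act V c x)).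
Proof.
move=> b_neg c_ab wx lt_d; apply: words_lower lt_d _.
by apply: (words_act (words_abel c_ab wx)) => //; rewrite eqxx leqnn orbT.
Qed.

(** The element [sum L(-n) alpha(n) + sum G(-s) Psi(s)], normalized by the
    values of [[alpha(n), L(-n)]] and [[Psi(s), G(-s)]] on a highest weight
    vector; these never vanish because [p >= 0]. It acts on the words of length
    [k] as [k] plus terms that are strictly lower. *)
Definition euler_ns (N : nat) (x : V) : V :=
  \sum_(1 <= n < N.+1) (n%:R * cLa * (p + n)%:R)^-1 *: L (- n%:Z) (al n%:Z x)
  + \sum_(0 <= j < N.+1) ((1 + p + 2 * j)%:R * cLa)^-1 *: G (- j%:Z - 1) (Psi j%:Z x).

Lemma euler_ns_linear N a x y :
  euler_ns N (a *: x + y) = a *: euler_ns N x + euler_ns N y.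
Proof.
rewrite /euler_ns scalerDr addrACA !scaler_sumr -!big_split /=.
by congr (_ + _); apply: eq_bigr => n _;
   rewrite !actD !actZ scalerDr !scalerA [a * _]mulrC.
Qed.

Lemma euler_ns_mem (P : V -> Prop) N x : subspace P ->
  (forall n : nat, (0 < n)%N -> P (L (- n%:Z) (al n%:Z x))) ->
  (forall j : nat, P (G (- j%:Z - 1) (Psi j%:Z x))) -> P (euler_ns N x).
Proof.
move=> sP PL PG; have [_ PD PZ] := sP; apply: (PD).
  by rewrite big_nat; apply: subspace_sum => // n /andP[n0 _]; apply: (PZ); apply: PL.
by apply: subspace_sum => // j _; apply: (PZ); apply: PG.
Qed.

Lemma euler_ns_short N k d x : words k d x -> short k.+1 (euler_ns N x).
Proof.
move=> wx; apply: euler_ns_mem => [|n n0|j]; first exact: short_subspace.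
  apply: short_act => /=; first by lia.
  by apply: words_abel_pos wx => /=; lia.
apply: short_act => /=; first by lia.
by apply: words_abel_pos wx => /=; lia.
Qed.

(** The contribution of one summand to the commutator of [euler_ns] with a
    letter [b], up to lower terms: the letter itself for the dual summand. *)
Lemma euler_ns_term_L k d b x (n : nat) : ns_neg b -> words k d x -> (0 < n)%N ->
  lower k.+1 (d + depth b)
    ((n%:R * cLa * (p + n)%:R)^-1 *: L (- n%:Z) (al n%:Z (sh_act V b x))
     - (n%:R * cLa * (p + n)%:R)^-1 *: sh_act V b (L (- n%:Z) (al n%:Z x))
     - (if b is shL m then if n == `|m|%N then sh_act V b x else 0 else 0)).
Proof.
move=> b_neg wx n_gt0; have [l0 lD lZ] := lower_subspace k.+1 (d + depth b).
set c := (_ * _ * _)^-1.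
have al_x : short k (al n%:Z x) by apply: words_abel_pos wx => /=; lia.
case: b b_neg l0 lD lZ => // m m_neg l0 lD lZ.
  have e_m : m = - `|m|%N%:Z by move: m_neg => /=; lia.
  have q_gt0 : (0 < `|m|)%N by move: m_neg => /=; lia.
  move: e_m q_gt0; set q := `|m|%N => e_m q_gt0; rewrite e_m in m_neg l0 lD lZ *.
  rewrite (alpha_L V0) !actD !actZ L_L [kron K (- n%:Z + _)]kron_neq; last by lia.
  have -> : - q%:Z + n%:Z = n%:Z - q%:Z by lia.
  have low1 : lower k.+1 (d + depth (shL (- q%:Z))) (L (- n%:Z - q%:Z) (al n%:Z x)).
    by apply: short_lower; apply: short_act => //=; lia.
  have [lt_nq|lt_qn|e_nq] := ltngtP n q.
  - rewrite kron_neq; last by lia.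
    have low2 : lower k.+1 (d + depth (shL (- q%:Z))) (L (- n%:Z) (al (n%:Z - q%:Z) x)).
      by apply: lower_abel wx _ => //=; rewrite ?/depth /=; lia.
    set y1 := L (- n%:Z - q%:Z) _ in low1 *; set y2 := L (- n%:Z) (al (_ - _) _) in low2 *.
    have := lD _ _ (lZ (c * (- n%:Z - - q%:Z)%:~R) _ low1) (lZ (c * n%:R) _ low2).
    congr (lower _ _ _); lin_coefs K V; rewrite -?pmulrn; ring.
  - rewrite kron_neq; last by lia.
    have low2 : lower k.+1 (d + depth (shL (- q%:Z))) (L (- n%:Z) (al (n%:Z - q%:Z) x)).
      by apply: lower_abel_pos wx => /=; lia.
    set y1 := L (- n%:Z - q%:Z) _ in low1 *; set y2 := L (- n%:Z) (al (_ - _) _) in low2 *.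
    have := lD _ _ (lZ (c * (- n%:Z - - q%:Z)%:~R) _ low1) (lZ (c * n%:R) _ low2).
    congr (lower _ _ _); lin_coefs K V; rewrite -?pmulrn; ring.
  rewrite -e_nq; have -> : n%:Z - n%:Z = 0 by lia.
  rewrite kron0 (words_al0 wx) actZ.
  set y1 := L (- n%:Z - n%:Z) _; rewrite -e_nq -/y1 in low1.
  have := lZ (c * (- n%:Z - - n%:Z)%:~R) _; rewrite -e_nq => /(_ _ low1).
  congr (lower _ _ _); rewrite /c; lin_coefs K V; rewrite -?pmulrn ?natrD; field;
    by rewrite ?cLa_neq0 -?natrD !pnatr_eq0; lia.
have [j e_m] : exists j : nat, m = - j%:Z - 1.
  by exists (`|m|.-1)%N; move: m_neg => /=; lia.
rewrite e_m in m_neg l0 lD lZ *; rewrite subr0.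
rewrite alpha_G actD actZ L_G.
have low1 : lower k.+1 (d + depth (shG (- j%:Z - 1))) (G (- n%:Z + (- j%:Z - 1)) (al n%:Z x)).
  by apply: short_lower; apply: short_act => //=; lia.
have low2 : lower k.+1 (d + depth (shG (- j%:Z - 1))) (L (- n%:Z) (Psi (n%:Z + (- j%:Z - 1)) x)).
  have [lt_nj|lt_jn] := leqP n j.
    by apply: lower_abel wx _ => //=; rewrite ?/depth /=; lia.
  by apply: lower_abel_pos wx => /=; lia.
have := lD _ _ (lZ (c * ((- n%:Z)%:~R / 2 - (- j%:Z - 1)%:~R - 1 / 2)) _ low1) (lZ (c * n%:R) _ low2).
congr (lower _ _ _); lin_coefs K V; rewrite -?pmulrn; ring.
Qed.

Lemma euler_ns_term_G k d b x (j : nat) : ns_neg b -> words k d x ->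
  lower k.+1 (d + depth b)
    (((1 + p + 2 * j)%:R * cLa)^-1 *: G (- j%:Z - 1) (Psi j%:Z (sh_act V b x))
     - ((1 + p + 2 * j)%:R * cLa)^-1 *: sh_act V b (G (- j%:Z - 1) (Psi j%:Z x))
     - (if b is shG m then if j == (`|m|.-1)%N then sh_act V b x else 0 else 0)).
Proof.
move=> b_neg wx; have [l0 lD lZ] := lower_subspace k.+1 (d + depth b).
set c := (_ * _)^-1.
have Psi_x : short k (Psi j%:Z x) by apply: words_abel_pos wx => /=; lia.
case: b b_neg l0 lD lZ => // m m_neg l0 lD lZ.
  have e_m : m = - `|m|%N%:Z by move: m_neg => /=; lia.
  move: e_m; set q := `|m|%N => e_m; rewrite e_m in m_neg l0 lD lZ *.
  rewrite Psi_L actD actZ subr0.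
  have low1 : lower k.+1 (d + depth (shL (- q%:Z))) (G (- q%:Z + (- j%:Z - 1)) (Psi j%:Z x)).
    by apply: short_lower; apply: short_act => //=; lia.
  have low2 : lower k.+1 (d + depth (shL (- q%:Z))) (G (- j%:Z - 1) (Psi (j%:Z + - q%:Z) x)).
    have [le_qj|lt_jq] := leqP q j.
      by apply: lower_abel_pos wx => /=; lia.
    by apply: lower_abel wx _ => //=; rewrite ?/depth /=; lia.
  rewrite L_G.
  have := lD _ _ (lZ (- c * ((- q%:Z)%:~R / 2 - (- j%:Z - 1)%:~R - 1 / 2)) _ low1)
                 (lZ (c * ((2 * j%:Z + - q%:Z + 1)%:~R / 2)) _ low2).
  by congr (lower _ _ _); lin_coefs K V; ring.
have [q e_m] : exists q : nat, m = - q%:Z - 1.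
  by exists (`|m|.-1)%N; move: m_neg => /=; lia.
rewrite e_m in m_neg l0 lD lZ *.
have -> : (`|(- q%:Z - 1)%R|.-1)%N = q by lia.
rewrite (Psi_G V0) !actD actN !actZ G_G [kron K (- j%:Z - 1 + _ + _)]kron_neq; last by lia.
have low1 : lower k.+1 (d + depth (shG (- q%:Z - 1)))
    (L (- j%:Z - 1 + (- q%:Z - 1) + 1) (Psi j%:Z x)).
  by apply: short_lower; apply: short_act => //=; lia.
set y1 := L _ _ in low1 *.
have -> : j%:Z + (- q%:Z - 1) + 1 = j%:Z - q%:Z by lia.
have [lt_jq|lt_qj|e_jq] := ltngtP j q.
- rewrite kron_neq; last by lia.
  have low2 : lower k.+1 (d + depth (shG (- q%:Z - 1))) (G (- j%:Z - 1) (al (j%:Z - q%:Z) x)).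
    by apply: lower_abel wx _ => //=; rewrite ?/depth /=; lia.
  have := lD _ _ (lZ (- c * 2) _ low1) (lZ c _ low2).
  by congr (lower _ _ _); lin_coefs K V; ring.
- rewrite kron_neq; last by lia.
  have low2 : lower k.+1 (d + depth (shG (- q%:Z - 1))) (G (- j%:Z - 1) (al (j%:Z - q%:Z) x)).
    by apply: lower_abel_pos wx => /=; lia.
  have := lD _ _ (lZ (- c * 2) _ low1) (lZ c _ low2).
  by congr (lower _ _ _); lin_coefs K V; ring.
rewrite e_jq; have -> : q%:Z - q%:Z = 0 by lia.
rewrite kron0 (words_al0 wx) actZ.
have := lZ (- c * 2) _ low1.
congr (lower _ _ _); rewrite /c e_jq; lin_coefs K V;
  rewrite -?pmulrn ?natrD ?natrM; field;
  by rewrite cLa_neq0 nat1r -!natrD pnatr_eq0.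
Qed.

Lemma euler_ns_act N k d b x : ns_neg b -> words k d x -> (depth b <= N)%N ->
  lower k.+1 (d + depth b)
    (euler_ns N (sh_act V b x) - sh_act V b (euler_ns N x) - sh_act V b x).
Proof.
move=> b_neg wx le_bN; have [l0 lD lZ] := lower_subspace k.+1 (d + depth b).
pose tL n : V := if b is shL m then if n == `|m|%N then sh_act V b x else 0 else 0.
pose tG j : V := if b is shG m then if j == (`|m|.-1)%N then sh_act V b x else 0 else 0.
have sum_t : \sum_(1 <= n < N.+1) tL n + \sum_(0 <= j < N.+1) tG j = sh_act V b x.
  rewrite /tL /tG; case: b b_neg le_bN {l0 lD lZ tL tG} => //= m m_neg; rewrite /depth /= => le_mN.
    by rewrite sum_delta ?big1 ?addr0 //; lia.
  by rewrite big1 // add0r sum_delta //; lia.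
have -> : euler_ns N (sh_act V b x) - sh_act V b (euler_ns N x) - sh_act V b x
    = \sum_(1 <= n < N.+1)
        ((n%:R * cLa * (p + n)%:R)^-1 *: L (- n%:Z) (al n%:Z (sh_act V b x))
         - (n%:R * cLa * (p + n)%:R)^-1 *: sh_act V b (L (- n%:Z) (al n%:Z x)) - tL n)
      + \sum_(0 <= j < N.+1)
        (((1 + p + 2 * j)%:R * cLa)^-1 *: G (- j%:Z - 1) (Psi j%:Z (sh_act V b x))
         - ((1 + p + 2 * j)%:R * cLa)^-1 *: sh_act V b (G (- j%:Z - 1) (Psi j%:Z x)) - tG j).
  rewrite !sumrB -[X in _ - X = _]sum_t /euler_ns actD !act_sum.
  under [X in _ - (X + _) - _ = _]eq_bigr => n _ do rewrite actZ.
  under [X in _ - (_ + X) - _ = _]eq_bigr => j _ do rewrite actZ.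
  by lin_coefs K V; ring.
apply: (lD).
  rewrite big_nat; apply: subspace_sum; first exact: lower_subspace.
  by move=> n /andP[n_gt0 _]; apply: euler_ns_term_L.
apply: subspace_sum; first exact: lower_subspace.
by move=> j _; apply: euler_ns_term_G.
Qed.

Lemma euler_ns_words N k d x : words k d x -> (d <= N)%N ->
  lower k d (euler_ns N x - k%:R *: x).
Proof.
elim=> {k d x} [k d x Jx|k d x y _ IHx _ IHy|k d a x _ IHx
  |k d k' d' b x wx IHx b_neg lt_k] le_dN.
- have [al_x Psi_x _] := J_inert Jx.
  have -> : euler_ns N x = 0.
    rewrite /euler_ns !big_nat !big1 ?addr0 // => n n_N.
      by rewrite Psi_x ?act0 ?scaler0.
    by rewrite al_x ?act0 ?scaler0 //; lia.
  rewrite sub0r; apply: subspaceN; first exact: lower_subspace.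
  case: k => [|k]; first by rewrite scale0r; case: (lower_subspace 0 d).
  apply: short_lower; exists 0%N; apply: wordsZ; exact: words_base.
- have [_ lD _] := lower_subspace k d.
  have := lD _ _ (IHx le_dN) (IHy le_dN); congr (lower _ _ _).
  by have [_ -> _] := linear_split (euler_ns_linear N); lin_coefs K V; ring.
- have [_ _ lZ] := lower_subspace k d.
  have := lZ a _ (IHx le_dN); congr (lower _ _ _).
  by have [_ _ ->] := linear_split (euler_ns_linear N); lin_coefs K V; ring.
have [lD lZ] : (forall y z, lower k' d' y -> lower k' d' z -> lower k' d' (y + z))
  /\ (forall a y, lower k' d' y -> lower k' d' (a *: y)) by case: (lower_subspace k' d').
have [lt_kk|] := ltnP k.+1 k'.
  have wbx : words k.+1 (d + depth b) (sh_act V b x).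
    by apply: (words_act wx) => //; rewrite eqxx leqnn orbT.
  apply: subspaceB; first exact: lower_subspace.
    by apply: short_lower; apply: (short_mono _ (euler_ns_short N wbx)).
  by apply: lZ; apply: short_lower; apply: (words_short _ wbx).
move=> le_kk; have [e_k le_d] : k.+1 = k' /\ (d + depth b <= d')%N by lia.
rewrite -e_k in lD lZ *; apply: (lower_mono le_d).
have [_ lD' _] := lower_subspace k.+1 (d + depth b).
have le1 : (d <= N)%N by lia.
have le2 : (depth b <= N)%N by lia.
have := lD' _ _ (euler_ns_act b_neg wx le2) (lower_act b_neg (IHx le1)).
congr (lower _ _ _); rewrite actD actN actZ -natr1.
by lin_coefs K V; ring.
Qed.

(** The hypothesis puts [euler_ns x] in [Z]; so [x] is congruent to
    [x - k^-1 euler_ns x], whose words are lower, and the words of positive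
    length are stripped off one depth at a time until only [J] remains. *)
Theorem abel_singular (Z : V -> Prop) x : subspace Z ->
  (forall b y, Z y -> Z (sh_act V b y)) ->
  opspan ns_neg J x ->
  (forall b, abel_pos b -> Z (sh_act V b x)) ->
  exists y z, [/\ J y, Z z & x = y + z].
Proof.
move=> sZ actZ' /opspan_words[k [d wx]]; have [Z0 ZD ZZ] := sZ.
have step k1 d1 y : words k1.+1 d1 y -> (forall b, abel_pos b -> Z (sh_act V b y)) ->
  exists y' z, [/\ lower k1.+1 d1 y', Z z, y = y' + z
                & forall b, abel_pos b -> Z (sh_act V b y')].
  move=> wy Zy; have Ze : Z (k1.+1%:R^-1 *: euler_ns d1 y).
    apply: (ZZ); apply: euler_ns_mem => // n *; apply: actZ'; apply: Zy => //=; lia.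
  exists (y - k1.+1%:R^-1 *: euler_ns d1 y), (k1.+1%:R^-1 *: euler_ns d1 y).
  split=> //; last first.
  - by move=> b b_pos; rewrite actB; apply: subspaceB; auto.
  - by rewrite subrK.
  have [_ _ lZ] := lower_subspace k1.+1 d1.
  have := lZ (- k1.+1%:R^-1) _ (euler_ns_words wy (leqnn d1)); congr (lower _ _ _).
  lin_coefs K V; rewrite -natr1; field; by rewrite natr1 pnatr_eq0.
elim: k d x wx => [|k IHk] d x wx Zx.
  by exists x, 0; split; rewrite ?addr0 //; apply: words0 wx.
elim: d x wx Zx => [|d IHd] x wx Zx.
  have [x' [z [[d wx'] Zz -> Zx']]] := step _ _ _ wx Zx.
  have [y [z' [Jy Zz' ->]]] := IHk _ _ wx' Zx'.
  by exists y, (z' + z); rewrite addrA; split=> //; apply: (ZD).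
have [x' [z [wx' Zz -> Zx']]] := step _ _ _ wx Zx.
have [y [z' [Jy Zz' ->]]] := IHd _ wx' Zx'.
by exists y, (z' + z); rewrite addrA; split=> //; apply: (ZD).
Qed.

End Straightening.

(** * Polynomials in the negative [alpha]s and [Psi]s *)

Section Monomials.

Variables (K : numFieldType) (cLa : K) (V : shModule K) (h : nat) (v : V).
Hypothesis V0 : level_zero cLa V.
Local Notation p := h.*2.+1.
Local Notation ha := ((1 + p%:R) * cLa).
Hypothesis v_inert : inert ha v.
Hypothesis G_v : forall j : nat, sh_act V (shG j%:Z) v = 0.

Local Notation L n := (sh_act V (shL n)).
Local Notation al n := (sh_act V (shAlpha n)).
Local Notation G n := (sh_act V (shG n)).
Local Notation Psi n := (sh_act V (shPsi n)).
Local Notation S t k := (@schur_alpha K cLa V t k).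
Local Notation T e := (@dressed_Psi K cLa V e).

(** Filtered from both sides: [k] bounds the number of letters from below, [d]
    the depth from above. Large [k] thus leaves nothing for fixed [d], by
    [monomials_large]. *)
Inductive monomials : nat -> nat -> V -> Prop :=
  | monomials0 k d : monomials k d 0
  | monomials_hw d : monomials 0 d v
  | monomialsD k d x y of monomials k d x & monomials k d y : monomials k d (x + y)
  | monomialsZ k d a x of monomials k d x : monomials k d (a *: x)
  | monomials_act k d k' d' b x of abel_neg b & monomials k d x &
      (k' <= k.+1)%N & (d + depth b <= d')%N : monomials k' d' (sh_act V b x).

Lemma monomials_subspace k d : subspace (monomials k d).
Proof. by split; [exact: monomials0|exact: monomialsD|exact: monomialsZ]. Qed.

Lemma monomials_mono k d k' d' x : (k' <= k)%N -> (d <= d')%N ->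
  monomials k d x -> monomials k' d' x.
Proof.
move=> le_k le_d mx; elim: mx k' d' le_k le_d => {k d x}
  [k d|d|k d x y _ IHx _ IHy|k d a x _ IHx|k d k1 d1 b x b_neg mx _ le_k1 le_d1] k' d' le_k le_d.
- exact: monomials0.
- by move: le_k; rewrite leqn0 => /eqP ->; apply: monomials_hw.
- by apply: monomialsD; [apply: IHx|apply: IHy].
- by apply: monomialsZ; apply: IHx.
by apply: (monomials_act b_neg mx); lia.
Qed.

Lemma abel_neg_abel b : abel_neg b -> abel b. Proof. by case: b. Qed.

Lemma depth_gt0 b : abel_neg b -> (0 < depth b)%N.
Proof. by case: b => // n; rewrite /depth /=; lia. Qed.

Lemma inert_abel b x : abel b -> inert ha x -> inert ha (sh_act V b x).
Proof. by case: b => // n _; [apply: inert_alpha|apply: inert_Psi]. Qed.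

Lemma inert_monomials k d x : monomials k d x -> inert ha x.
Proof.
have [i0 iD iZ] := inert_subspace V ha.
elim=> {k d x} // [k d x y _ IHx _ IHy|k d a x _ IHx|k d k1 d1 b x b_neg _ IHx _ _].
- exact: (iD).
- exact: (iZ).
by apply: inert_abel IHx; apply: abel_neg_abel.
Qed.

Lemma monomials_large k d x : monomials k d x -> (d < k)%N -> x = 0.
Proof.
elim=> {k d x} // [k d x y _ IHx _ IHy lt_dk|k d a x _ IHx lt_dk
  |k d k1 d1 b x /depth_gt0 b_neg _ IHx le_k le_d lt_dk].
- by rewrite IHx // IHy // addr0.
- by rewrite IHx // scaler0.
by rewrite IHx ?act0 //; lia.
Qed.

Lemma monomials_pos k d x : monomials k d x ->
  exists c y, monomials 1 d y /\ x = c *: v + y.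
Proof.
elim=> {k d x} [k d|d|k d x y _ [c [x' [mx ->]]] _ [c' [y' [my ->]]]
  |k d a x _ [c [x' [mx ->]]]|k d k1 d1 b x b_neg mx _ _ le_d].
- by exists 0, 0; split; [exact: monomials0|rewrite scale0r addr0].
- by exists 1, 0; split; [exact: monomials0|rewrite scale1r addr0].
- exists (c + c'), (x' + y'); split; first exact: monomialsD.
  by rewrite scalerDl addrACA.
- by exists (a * c), (a *: x'); split; [exact: monomialsZ|rewrite scalerDr scalerA].
exists 0, (sh_act V b x); split; last by rewrite scale0r add0r.
exact: (monomials_act b_neg mx).
Qed.

Lemma opspan_monomials x : opspan abel_neg (eq v) x -> exists d, monomials 0 d x.
Proof.
elim=> {x} [_ <-||x y _ [d mx] _ [d' my]|a x _ [d mx]|b x b_neg _ [d mx]].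
- by exists 0%N; apply: monomials_hw.
- by exists 0%N; apply: monomials0.
- exists (maxn d d'); apply: monomialsD.
    by apply: monomials_mono mx; lia.
  by apply: monomials_mono my; lia.
- by exists d; apply: monomialsZ.
by exists (d + depth b)%N; apply: (monomials_act b_neg mx).
Qed.

Lemma monomials_abel_neg b k d d' x : abel_neg b -> monomials k d x ->
  (d + depth b = d')%N -> monomials k.+1 d' (sh_act V b x).
Proof. by move=> b_neg mx <-; apply: (monomials_act b_neg mx). Qed.

Lemma monomials_al k d d' (n : nat) x : (0 < n)%N -> monomials k d x ->
  d' = (d + n.*2)%N -> monomials k.+1 d' (al (- n%:Z) x).
Proof.
by move=> n0 mx ->; apply: monomials_abel_neg mx _ => /=; rewrite /depth /=; lia.
Qed.

Lemma monomials_Psi k d d' (n : nat) x : (0 < n)%N -> monomials k d x ->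
  d' = (d + n.*2.-1)%N -> monomials k.+1 d' (Psi (- n%:Z) x).
Proof.
by move=> n0 mx ->; apply: monomials_abel_neg mx _ => /=; rewrite /depth /=; lia.
Qed.

(** ** The two critical letters [alpha(-p)] and [Psi(-p/2)] *)

Definition critical (b : sh_basis) : bool :=
  match b with
  | shAlpha n => n == - p%:Z
  | shPsi n => n == - h.+1%:Z
  | _ => false
  end.

Inductive regular : nat -> nat -> V -> Prop :=
  | regular0 k d : regular k d 0
  | regular_hw d : regular 0 d v
  | regularD k d x y of regular k d x & regular k d y : regular k d (x + y)
  | regularZ k d a x of regular k d x : regular k d (a *: x)
  | regular_act k d d' b x of abel_neg b & ~~ critical b & regular k d x &
      (d + depth b <= d')%N : regular k.+1 d' (sh_act V b x).

Lemma regular_monomials k d x : regular k d x -> monomials k d x.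
Proof.
elim=> {k d x} [k d|d|k d x y _ IHx _ IHy|k d a x _ IHx|k d d' b x b_neg _ _ IHx le_d].
- exact: monomials0.
- exact: monomials_hw.
- exact: monomialsD.
- exact: monomialsZ.
exact: (monomials_act b_neg IHx).
Qed.

Lemma abelC b b' x : abel b -> abel b' -> exists e : K,
  sh_act V b (sh_act V b' x) = e *: sh_act V b' (sh_act V b x).
Proof.
case: b => // m _; case: b' => // n _.
- by exists 1; rewrite scale1r (alphaC V0).
- by exists 1; rewrite scale1r alpha_PsiC.
- by exists 1; rewrite scale1r alpha_PsiC.
by exists (-1); rewrite scaleN1r (PsiC V0).
Qed.

Variable Z : V -> Prop.
Hypothesis Z_subspace : subspace Z.
Hypothesis Z_act : forall b x, Z x -> Z (sh_act V b x).
Hypothesis Z_alpha : exists2 y, monomials 2 p.*2 y & Z (al (- p%:Z) v - y).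
Hypothesis Z_Psi : exists2 y, monomials 2 p y & Z (Psi (- h.+1%:Z) v - y).

Lemma critical_reduce k d b x : abel_neg b -> critical b -> monomials k d x ->
  exists2 y, monomials k.+2 (d + depth b) y & Z (sh_act V b x - y).
Proof.
have [Z0 ZD ZZ] := Z_subspace.
move=> b_neg b_crit mx; elim: mx => {k d x}
  [k d|d|k d x y _ [x' mx Zx] _ [y' my Zy]|k d a x _ [x' mx Zx]
  |k d k1 d1 b' x b'_neg _ [x' mx Zx] le_k le_d].
- by exists 0; [exact: monomials0|rewrite act0 subr0].
- case: b b_neg b_crit => // n /= n_neg /eqP ->.
    have [y my Zy] := Z_alpha; exists y => //.
    by apply: monomials_mono my => //; rewrite /depth /=; lia.
  have [y my Zy] := Z_Psi; exists y => //.
  by apply: monomials_mono my => //; rewrite /depth /=; lia.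
- exists (x' + y'); first exact: monomialsD.
  by rewrite actD opprD addrACA; apply: ZD.
- by exists (a *: x'); [exact: monomialsZ|rewrite actZ -scalerBr; apply: ZZ].
have [e ->] := abelC x (abel_neg_abel b_neg) (abel_neg_abel b'_neg).
exists (e *: sh_act V b' x').
  by apply: monomialsZ; apply: (monomials_act b'_neg mx); lia.
by rewrite -scalerBr -actB; apply: ZZ; apply: Z_act.
Qed.

Lemma regular_decomp k d x : monomials k d x -> exists y z,
  [/\ regular k d y, monomials k.+1 d z & Z (x - y - z)].
Proof.
have [Z0 ZD ZZ] := Z_subspace.
elim=> {k d x} [k d|d|k d x y _ [x1 [x2 [rx mx Zx]]] _ [y1 [y2 [ry my Zy]]]
  |k d a x _ [x1 [x2 [rx mx Zx]]]|k d k1 d1 b x b_neg mx0 [x1 [x2 [rx mx Zx]]] le_k le_d].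
- by exists 0, 0; rewrite !subr0; split; [exact: regular0|exact: monomials0|].
- by exists v, 0; rewrite subr0 subrr; split; [exact: regular_hw|exact: monomials0|].
- exists (x1 + y1), (x2 + y2); split; [exact: regularD|exact: monomialsD|].
  have := ZD _ _ Zx Zy; congr Z; lin_coefs K V; ring.
- exists (a *: x1), (a *: x2); split; [exact: regularZ|exact: monomialsZ|].
  by have := ZZ a _ Zx; rewrite !scalerBr.
have [lt_k1|le_k1] := ltnP k1 k.+1.
  exists 0, (sh_act V b x); split; first exact: regular0.
    by apply: (monomials_act b_neg mx0) => //; lia.
  by rewrite subr0 subrr.
have -> : k1 = k.+1 by lia.
have [b_crit|b_reg] := boolP (critical b).
  have [y my Zy] := critical_reduce b_neg b_crit (regular_monomials rx).
  exists 0, (y + sh_act V b x2); split; first exact: regular0.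
    apply: monomialsD; first by apply: monomials_mono my.
    by apply: (monomials_act b_neg mx).
  have := ZD _ _ Zy (Z_act b Zx); congr Z; rewrite !actB.
  by lin_coefs K V; ring.
exists (sh_act V b x1), (sh_act V b x2); split.
- exact: (regular_act b_neg b_reg rx).
- exact: (monomials_act b_neg mx).
by rewrite -!actB; apply: Z_act.
Qed.

Hypothesis cLa_neq0 : cLa != 0.

(** The mirror image of [euler_ns]: the coefficients are the values of
    [[L(n), alpha(-n)]] and [[G(s), Psi(-s)]], which vanish exactly for the two
    critical letters. It acts on regular monomials with [k] factors as [k] plus
    terms with more factors. *)
Definition euler_ab (N : nat) (x : V) : V :=
  \sum_(1 <= n < N.+1)
     (if n == p then 0 else (n%:R * cLa * (p%:R - n%:R))^-1) *: al (- n%:Z) (L n%:Z x)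
  + \sum_(0 <= j < N.+1)
     (if j == h then 0 else ((p%:R - (1 + 2 * j)%:R) * cLa)^-1)
       *: Psi (- j%:Z - 1) (G j%:Z x).

Lemma euler_ab_linear N a x y :
  euler_ab N (a *: x + y) = a *: euler_ab N x + euler_ab N y.
Proof.
rewrite /euler_ab scalerDr addrACA !scaler_sumr -!big_split /=.
by congr (_ + _); apply: eq_bigr => n _;
   rewrite !actD !actZ scalerDr !scalerA [a * _]mulrC.
Qed.

Lemma L_hw (n : nat) : (0 < n)%N -> L n%:Z v = 0.
Proof.
case: n => // n _; rewrite L_of_G; last by lia.
have -> : n.+1%:Z - 1 = n%:Z by lia.
by rewrite !G_v !act0 addr0 scaler0.
Qed.

Lemma euler_ab_term_L k d b x (n : nat) : abel_neg b -> monomials k d x -> (0 < n)%N ->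
  let c := if n == p then 0 else (n%:R * cLa * (p%:R - n%:R))^-1 in
  monomials k.+2 (d + depth b)
    (c *: al (- n%:Z) (L n%:Z (sh_act V b x))
     - c *: sh_act V b (al (- n%:Z) (L n%:Z x))
     - (if b is shAlpha m then if n == `|m|%N then
          (if critical b then 0 else 1) *: sh_act V b x else 0 else 0)).
Proof.
move=> b_neg mx n_gt0 c; have [m0 mD mZ] := monomials_subspace k.+2 (d + depth b).
have [al_x Psi_x al0_x] := inert_monomials mx.
case: b b_neg m0 mD mZ => // m m_neg m0 mD mZ.
  have e_m : m = - `|m|%N%:Z by move: m_neg => /=; lia.
  have q_gt0 : (0 < `|m|)%N by move: m_neg => /=; lia.
  move: e_m q_gt0; set q := `|m|%N => e_m q_gt0; rewrite e_m in m_neg m0 mD mZ *.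
  rewrite (L_alpha V0) !actB !actZ (alphaC V0 (- n%:Z) (- q%:Z)).
  have [lt_nq|lt_qn|e_nq] := ltngtP n q.
  - rewrite kron_neq; last by lia.
    have mm : monomials k.+2 (d + depth (shAlpha (- q%:Z))) (al (- n%:Z) (al (n%:Z - q%:Z) x)).
      have -> : n%:Z - q%:Z = - (q - n)%N%:Z by lia.
      apply: (monomials_al n_gt0 (monomials_al _ mx erefl)); first by lia.
      by rewrite /depth /=; lia.
    have := mZ (c * q%:R) _ mm.
    congr (monomials _ _ _); rewrite mulrNz -pmulrn; lin_coefs K V; ring.
  - rewrite kron_neq; last by lia.
    rewrite [al (n%:Z - q%:Z) x]al_x; last by lia.
    rewrite act0 !mul0r scale0r.
    by move: m0; congr (monomials _ _ _); rewrite !scaler0 !subr0; lin_coefs K V; ring.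
  rewrite -e_nq in m0 *; have -> : n%:Z - n%:Z = 0 by lia.
  rewrite kron0 al0_x actZ /=.
  have -> : (- n%:Z == - p%:Z) = (n == p) by lia.
  move: m0; congr (monomials _ _ _); rewrite /c; case: (eqVneq n p) => [e_np|ne_np].
    by lin_coefs K V; ring.
  rewrite mulrNz -!pmulrn; lin_coefs K V; field;
    by rewrite cLa_neq0 pnatr_eq0 nat1r subr_eq0 eqr_nat; lia.
have [q e_m] : exists q : nat, m = - q%:Z - 1.
  by exists (`|m|.-1)%N; move: m_neg => /=; lia.
rewrite e_m in m_neg m0 mD mZ *.
rewrite L_Psi actB actZ alpha_PsiC subr0.
have [lt_nq|le_qn] := leqP n q.
  have mm : monomials k.+2 (d + depth (shPsi (- q%:Z - 1)))
      (al (- n%:Z) (Psi (- q%:Z - 1 + n%:Z) x)).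
    have -> : - q%:Z - 1 + n%:Z = - (q.+1 - n)%N%:Z by lia.
    apply: (monomials_al n_gt0 (monomials_Psi _ mx erefl)); first by lia.
    by rewrite /depth /=; lia.
  have := mZ (- c * ((2 * (- q%:Z - 1) + n%:Z + 1)%:~R / 2)) _ mm.
  by congr (monomials _ _ _); lin_coefs K V; ring.
rewrite [Psi (- q%:Z - 1 + n%:Z) x]Psi_x ?act0; last by lia.
by move: m0; congr (monomials _ _ _); rewrite !scaler0; lin_coefs K V; ring.
Qed.

Lemma euler_ab_term_G k d b x (j : nat) : abel_neg b -> monomials k d x ->
  let c := if j == h then 0 else ((p%:R - (1 + 2 * j)%:R) * cLa)^-1 in
  monomials k.+2 (d + depth b)
    (c *: Psi (- j%:Z - 1) (G j%:Z (sh_act V b x))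
     - c *: sh_act V b (Psi (- j%:Z - 1) (G j%:Z x))
     - (if b is shPsi m then if j == (`|m|.-1)%N then
          (if critical b then 0 else 1) *: sh_act V b x else 0 else 0)).
Proof.
move=> b_neg mx c; have [m0 mD mZ] := monomials_subspace k.+2 (d + depth b).
have [al_x Psi_x al0_x] := inert_monomials mx.
have Psi_neg (q : nat) : - q%:Z - 1 = - q.+1%:Z by lia.
case: b b_neg m0 mD mZ => // m m_neg m0 mD mZ.
  have e_m : m = - `|m|%N%:Z by move: m_neg => /=; lia.
  move: e_m; set q := `|m|%N => e_m; rewrite e_m in m_neg m0 mD mZ *.
  rewrite G_alpha actB actZ (alpha_PsiC (- q%:Z)) subr0.
  have [lt_jq|le_qj] := ltnP j q.
    have mm : monomials k.+2 (d + depth (shAlpha (- q%:Z)))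
        (Psi (- j%:Z - 1) (Psi (- q%:Z + j%:Z) x)).
      have -> : - q%:Z + j%:Z = - (q - j)%N%:Z by lia.
      rewrite (Psi_neg j); apply: (monomials_Psi _ (monomials_Psi _ mx erefl)) => //.
        by lia.
      by rewrite /depth /=; lia.
    have := mZ (- c * (- q%:Z)%:~R) _ mm.
    by congr (monomials _ _ _); lin_coefs K V; ring.
  rewrite [Psi (- q%:Z + j%:Z) x]Psi_x ?act0; last by lia.
  by move: m0; congr (monomials _ _ _); rewrite !scaler0; lin_coefs K V; ring.
have [q e_m] : exists q : nat, m = - q%:Z - 1.
  by exists (`|m|.-1)%N; move: m_neg => /=; lia.
rewrite e_m in m_neg m0 mD mZ *.
have -> : (`|(- q%:Z - 1)%R|.-1)%N = q by lia.
rewrite (G_Psi V0) !actD actN actZ (PsiC V0 (- j%:Z - 1) (- q%:Z - 1)).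
have -> : - q%:Z - 1 + j%:Z + 1 = j%:Z - q%:Z by lia.
have [lt_jq|lt_qj|e_jq] := ltngtP j q.
- rewrite kron_neq; last by lia.
  have mm : monomials k.+2 (d + depth (shPsi (- q%:Z - 1)))
      (Psi (- j%:Z - 1) (al (j%:Z - q%:Z) x)).
    have -> : j%:Z - q%:Z = - (q - j)%N%:Z by lia.
    rewrite (Psi_neg j); apply: (monomials_Psi _ (monomials_al _ mx erefl)) => //.
      by lia.
    by rewrite /depth /=; lia.
  have := mZ c _ mm.
  by congr (monomials _ _ _); lin_coefs K V; ring.
- rewrite kron_neq; last by lia.
  rewrite [al (j%:Z - q%:Z) x]al_x ?act0; last by lia.
  by move: m0; congr (monomials _ _ _); lin_coefs K V; ring.
rewrite e_jq; have -> : q%:Z - q%:Z = 0 by lia.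
rewrite kron0 al0_x actZ /=.
have -> : (- q%:Z - 1 == - h.+1%:Z) = (q == h) by lia.
move: m0; congr (monomials _ _ _); rewrite /c e_jq; case: (eqVneq q h) => [e_qh|ne_qh].
  by lin_coefs K V; ring.
rewrite rmorphB /= mulrNz -!pmulrn natrD natrM; lin_coefs K V; field;
  by rewrite cLa_neq0 -natrM !nat1r subr_eq0 eqr_nat; lia.
Qed.

Lemma euler_ab_act N k d b x : abel_neg b -> monomials k d x -> (depth b <= N)%N ->
  monomials k.+2 (d + depth b)
    (euler_ab N (sh_act V b x) - sh_act V b (euler_ab N x)
     - (if critical b then 0 else 1) *: sh_act V b x).
Proof.
move=> b_neg mx le_bN; have [l0 lD lZ] := monomials_subspace k.+2 (d + depth b).
pose y := (if critical b then 0 else 1 : K) *: sh_act V b x.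
pose tL n : V := if b is shAlpha m then if n == `|m|%N then y else 0 else 0.
pose tG j : V := if b is shPsi m then if j == (`|m|.-1)%N then y else 0 else 0.
have sum_t : \sum_(1 <= n < N.+1) tL n + \sum_(0 <= j < N.+1) tG j = y.
  rewrite /tL /tG; case: b b_neg le_bN {l0 lD lZ tL tG} @y => //= m m_neg; rewrite /depth /= => le_mN.
    by rewrite [X in _ + X]big1 // addr0 sum_delta //; lia.
  by rewrite [X in X + _]big1 // add0r sum_delta //; lia.
pose cL n := if n == p then 0 else (n%:R * cLa * (p%:R - n%:R))^-1.
pose cG j := if j == h then 0 else ((p%:R - (1 + 2 * j)%:R) * cLa)^-1.
have -> : euler_ab N (sh_act V b x) - sh_act V b (euler_ab N x) - y
    = \sum_(1 <= n < N.+1)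
        (cL n *: al (- n%:Z) (L n%:Z (sh_act V b x))
         - cL n *: sh_act V b (al (- n%:Z) (L n%:Z x)) - tL n)
      + \sum_(0 <= j < N.+1)
        (cG j *: Psi (- j%:Z - 1) (G j%:Z (sh_act V b x))
         - cG j *: sh_act V b (Psi (- j%:Z - 1) (G j%:Z x)) - tG j).
  rewrite !sumrB -[X in _ - X = _]sum_t /euler_ab actD !act_sum.
  under [X in _ - (X + _) - _ = _]eq_bigr => n _ do rewrite actZ.
  under [X in _ - (_ + X) - _ = _]eq_bigr => j _ do rewrite actZ.
  by lin_coefs K V; ring.
apply: (lD).
  rewrite big_nat; apply: subspace_sum; first exact: monomials_subspace.
  by move=> n /andP[n_gt0 _]; apply: euler_ab_term_L.
apply: subspace_sum; first exact: monomials_subspace.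
by move=> j _; apply: euler_ab_term_G.
Qed.

Lemma euler_ab_hw N : euler_ab N v = 0.
Proof.
rewrite /euler_ab !big_nat !big1 ?addr0 // => n n_N.
  by rewrite G_v act0 scaler0.
by rewrite L_hw ?act0 ?scaler0 //; lia.
Qed.

Let euler_abD N x y : euler_ab N (x + y) = euler_ab N x + euler_ab N y.
Proof. by case: (linear_split (euler_ab_linear N)). Qed.

Let euler_ab0 N : euler_ab N 0 = 0.
Proof. by case: (linear_split (euler_ab_linear N)). Qed.

Let euler_abZ N a x : euler_ab N (a *: x) = a *: euler_ab N x.
Proof. by case: (linear_split (euler_ab_linear N)). Qed.

Lemma euler_ab_monomials N k d x : monomials k d x -> (d <= N)%N ->
  monomials k d (euler_ab N x).
Proof.
elim=> {k d x} [k d|d|k d x y _ IHx _ IHy|k d a x _ IHx|k d k1 d1 b x b_neg mx IHx le_k le_d] le_N.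
- by rewrite euler_ab0; apply: monomials0.
- by rewrite euler_ab_hw; apply: monomials0.
- by rewrite euler_abD; apply: monomialsD; [apply: IHx|apply: IHy].
- by rewrite euler_abZ; apply: monomialsZ; apply: IHx.
have le1 : (d <= N)%N by lia.
have le2 : (depth b <= N)%N by lia.
have mb y : monomials k d y -> monomials k1 d1 (sh_act V b y).
  by move=> my; apply: (monomials_act b_neg my).
have mact := euler_ab_act b_neg mx le2.
have {}mact := monomials_mono (leq_trans le_k (leqnSn k.+1)) le_d mact.
have := monomialsD (monomialsD mact (mb _ (IHx le1)))
  (monomialsZ (if critical b then 0 else 1) (mb _ mx)).
by congr (monomials _ _ _); lin_coefs K V; ring.
Qed.

Lemma euler_ab_regular N k d x : regular k d x -> (d <= N)%N ->
  monomials k.+1 d (euler_ab N x - k%:R *: x).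
Proof.
elim=> {k d x} [k d|d|k d x y _ IHx _ IHy|k d a x _ IHx|k d d1 b x b_neg b_reg rx IHx le_d] le_N.
- by rewrite euler_ab0 scaler0 subr0; apply: monomials0.
- by rewrite euler_ab_hw scale0r subr0; apply: monomials0.
- have := monomialsD (IHx le_N) (IHy le_N); congr (monomials _ _ _).
  by rewrite euler_abD; lin_coefs K V; ring.
- have := monomialsZ a (IHx le_N); congr (monomials _ _ _).
  by rewrite euler_abZ; lin_coefs K V; ring.
have le1 : (d <= N)%N by lia.
have le2 : (depth b <= N)%N by lia.
have mact := euler_ab_act b_neg (regular_monomials rx) le2.
rewrite (negPf b_reg) in mact.
have {}mact := monomials_mono (leqnn k.+2) le_d mact.
have mb : monomials k.+2 d1 (sh_act V b (euler_ab N x - k%:R *: x)).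
  exact: (monomials_act b_neg (IHx le1)).
have := monomialsD mact mb; congr (monomials _ _ _).
by rewrite actB actZ -natr1; lin_coefs K V; ring.
Qed.

(** Modulo [Z], critical letters can be traded for longer monomials, so the
    shortest monomials of [x] may be taken regular; subtracting [k^-1 euler_ab]
    then replaces [x] by longer monomials of the same depth. This ends at zero
    because every letter has positive depth. *)
Lemma monomials_singular k d x : (0 < k)%N -> monomials k d x ->
  (forall j : nat, Z (G j%:Z x)) -> Z x.
Proof.
have [Z0 ZD ZZ] := Z_subspace.
move: {2}(d.+1 - k)%N (leqnn (d.+1 - k)%N) => n.
elim: n k x => [|n IHn] k x le_n k_gt0 mx Zx.
  by rewrite (monomials_large mx) //; lia.
have Ze y : (forall j : nat, Z (G j%:Z y)) -> Z (euler_ab d y).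
  move=> Zy; apply: (ZD).
    rewrite big_nat; apply: subspace_sum => // m /andP[m_gt0 _]; apply: (ZZ).
    apply: Z_act; rewrite L_of_G; last by lia.
    have -> : m%:Z - 1 = m.-1%:Z by lia.
    by apply: (ZZ); apply: (ZD); apply: Z_act; [apply: (Zy 0%N)|apply: Zy].
  by apply: subspace_sum => // j _; apply: (ZZ); apply: Z_act.
have [x1 [x2 [rx1 mx2 Zx12]]] := regular_decomp mx.
pose z := x - x1 - x2.
have nz_k : k%:R != 0 :> K by rewrite pnatr_eq0; lia.
pose x' := x2 - k%:R^-1 *: (euler_ab d x1 - k%:R *: x1 + euler_ab d x2).
have mx' : monomials k.+1 d x'.
  have [_ mD mZ] := monomials_subspace k.+1 d.
  apply: (mD) => //; apply: subspaceN; first exact: monomials_subspace.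
  apply: (mZ); apply: (mD).
    exact: euler_ab_regular.
  exact: euler_ab_monomials.
have Zxx' : Z (x - x').
  have Zez : Z (euler_ab d z) by apply: Ze => j; apply: Z_act.
  have := ZD _ _ Zx12 (ZZ k%:R^-1 _ (ZD _ _ (Ze _ Zx) (ZZ (-1) _ Zez))).
  congr Z; have ex : euler_ab d x = euler_ab d x1 + euler_ab d x2 + euler_ab d z.
    by rewrite -!euler_abD /z; congr (euler_ab d _); lin_coefs K V; ring.
  by rewrite ex /x'; lin_coefs K V; field.
have Zx' : Z x'.
  apply: (IHn k.+1) => //; first by lia.
  move=> j; have -> : x' = x - (x - x') by rewrite subKr.
  by rewrite actB; apply: subspaceB => //; apply: Z_act.
by rewrite -[x](subrK x'); apply: (ZD).
Qed.

End Monomials.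

(** ** The leading terms of the two vectors *)

Section LeadingTerms.

Variables (K : numFieldType) (cLa : K) (V : shModule K) (h : nat) (v : V).
Hypothesis V0 : level_zero cLa V.
Local Notation p := h.*2.+1.

Local Notation al n := (sh_act V (shAlpha n)).
Local Notation Psi n := (sh_act V (shPsi n)).
Local Notation S t k := (@schur_alpha K cLa V t k).
Local Notation T e := (@dressed_Psi K cLa V e).
Local Notation monomials := (monomials v).

Let monomials_term t k d i n x : (0 < n <= i)%N -> monomials k (d + (i - n).*2) x ->
  monomials k.+1 (d + i.*2) ((- (t%:R * cLa)^-1) *: al (- n%:Z) x).
Proof.
move=> n_i mx; apply: monomialsZ; apply: (monomials_al _ mx); first by lia.
by rewrite -addnA -doubleD subnK //; lia.
Qed.

Lemma monomials_schur t k d i x : monomials k d x ->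
  monomials (k + (0 < i)) (d + i.*2) (S t i x).
Proof.
move=> mx; elim/ltn_ind: i => [[|i]] IHi; first by rewrite schur_alpha0 !addn0.
have nz_i : i.+1%:R != 0 :> K by rewrite pnatr_eq0.
rewrite -[S t i.+1 x](scalerK nz_i) (schur_alpha_rec V0) addn1; apply: monomialsZ.
rewrite big_nat; apply: subspace_sum; first exact: monomials_subspace.
move=> n n_i; apply: monomials_term; first by lia.
by apply: monomials_mono (IHi (i.+1 - n)%N _); lia.
Qed.

Lemma monomials_schur_lead t k d i x : (0 < i)%N -> monomials k d x ->
  monomials k.+2 (d + i.*2) (S t i x - (- (i%:R * (t%:R * cLa))^-1) *: al (- i%:Z) x).
Proof.
move=> i_gt0 mx; have nz_i : i%:R != 0 :> K by rewrite pnatr_eq0; lia.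
rewrite -[S t i x](scalerK nz_i) (schur_alpha_rec V0).
rewrite (big_cat_nat (n := i)) //= big_nat1 subnn schur_alpha0.
rewrite scalerDr -addrA [X in _ + X](_ : _ = 0) ?addr0.
  apply: monomialsZ; rewrite big_nat; apply: subspace_sum.
    exact: monomials_subspace.
  move=> n n_i; apply: monomials_term; first by lia.
  apply: monomials_mono (monomials_schur t (i - n) mx); lia.
by rewrite scalerA [(i%:R * _)^-1]invfM mulrN subrr.
Qed.

Lemma monomials_dressed k d e x : (0 < e)%N -> monomials k d x ->
  monomials k.+1 (d + e.*2.-1) (T e x).
Proof.
move=> e_gt0 mx; rewrite /dressed_Psi big_nat.
apply: subspace_sum; first exact: monomials_subspace.
move=> i i_e; have -> : i%:Z - e%:Z = - (e - i)%N%:Z by lia.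
have mS := monomials_mono (leq_addr _ _) (leqnn _) (monomials_schur 2 i mx).
by apply: (monomials_Psi _ mS); lia.
Qed.

Lemma monomials_dressed_lead k d e x : (0 < e)%N -> monomials k d x ->
  monomials k.+2 (d + e.*2.-1) (T e x - Psi (- e%:Z) x).
Proof.
move=> e_gt0 mx; rewrite /dressed_Psi big_ltn // schur_alpha0 sub0r addrC addKr.
rewrite big_nat; apply: subspace_sum; first exact: monomials_subspace.
move=> i i_e; have -> : i%:Z - e%:Z = - (e - i)%N%:Z by lia.
have mS := monomials_schur 2 i mx.
have -> : k.+2 = (k + (0 < i)).+1 by lia.
by apply: (monomials_Psi _ mS); lia.
Qed.

Lemma sing_vec_lead : monomials 2 p (sing_vec cLa h v - Psi (- h.+1%:Z) v).
Proof.
apply: monomials_mono (monomials_dressed_lead _ (monomials_hw v 0)) => //; lia.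
Qed.

Lemma sub_vec_lead :
  monomials 2 p.*2 (sub_vec cLa h v - (- (p%:R * cLa)^-1) *: al (- p%:Z) v).
Proof.
have mw := monomials_schur_lead 1 (ltn0Sn h.*2) (monomials_hw v 0).
rewrite mul1r add0n in mw; rewrite /sub_vec addrAC; apply: monomialsD => //.
apply: monomialsZ; rewrite big_nat; apply: subspace_sum.
  exact: monomials_subspace.
move=> k k_h; apply: monomialsZ.
have mT := monomials_dressed (ltn0Sn _ : 0 < h.+1 + k)%N (monomials_hw v 0).
have lt_k : (0 < h.+1 - k)%N by lia.
by apply: monomials_mono (monomials_dressed lt_k mT); lia.
Qed.

End LeadingTerms.

(** * The free field realization *)

Section IntSum.

Variable U : nmodType.
Implicit Types (f : int -> U) (N : nat).

(** For [f] of finite support this is, for [N] large, the sum over all integers. *)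
Definition int_sum N f : U := \sum_(0 <= i < N) (f (Posz i) + f (Negz i)).

Lemma int_sum_stable f N0 N : (N0 <= N)%N ->
  (forall i : nat, (N0 <= i)%N -> f (Posz i) = 0 /\ f (Negz i) = 0) ->
  int_sum N f = int_sum N0 f.
Proof.
move=> le_N f0; rewrite /int_sum (big_cat_nat (n := N0)) //= [X in _ + X]big_nat.
rewrite [X in _ + X]big1 ?addr0 // => i /andP[/f0[-> ->] _]; exact: addr0.
Qed.

Lemma int_sumD N f g : int_sum N (fun m => f m + g m) = int_sum N f + int_sum N g.
Proof. by rewrite /int_sum -big_split; apply: eq_bigr => i _; rewrite addrACA. Qed.

Lemma int_sum_delta N (n : int) x : (`|n| < N)%N ->
  int_sum N (fun m => if m == n then x else 0) = x.
Proof.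
move=> lt_n; rewrite /int_sum; case: n lt_n => [n|n] lt_n.
  rewrite -[RHS](@sum_delta U 0 N n x) //; apply: eq_big_nat => i _.
  by rewrite eqz_nat addr0.
rewrite -[RHS](@sum_delta U 0 N n x); last by lia.
apply: eq_big_nat => i _; rewrite add0r.
by have -> : (Negz i == Negz n) = (i == n) by lia.
Qed.

Lemma eq_int_sum N f g : f =1 g -> int_sum N f = int_sum N g.
Proof. by move=> fg; apply: eq_bigr => i _; rewrite !fg. Qed.

End IntSum.

Lemma int_sumZ (K : pzRingType) (U : lmodType K) N c (f : int -> U) :
  int_sum N (fun m => c *: f m) = c *: int_sum N f.
Proof. by rewrite /int_sum scaler_sumr; apply: eq_bigr => i _; rewrite scalerDr. Qed.

(** The free fields: [F Fe n] and [F Fa (- n)] will be dual bosons, [F Fy n] and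
    [F FP (- n - 1)] dual fermions. *)
Inductive free_field := Fe | Fa | FP | Fy.

(** The relations of the oscillators and of their vacuum, abstracted from the
    construction of the Fock space. The zero mode [a 0] is a scalar; it has no
    dual, and [e 0] vanishes. *)
Section FockRelations.

Variables (K : numFieldType) (cL cLa hw ha : K) (M : lmodType K).
Variables (F : free_field -> int -> {linear M -> M}) (vac : M) (vev : M -> K).
Variable par : bool -> M -> Prop.

Local Notation e := (F Fe).
Local Notation a := (F Fa).
Local Notation P := (F FP).
Local Notation y := (F Fy).

Hypothesis eC : forall m n x, e m (e n x) = e n (e m x).
Hypothesis aC : forall m n x, a m (a n x) = a n (a m x).
Hypothesis e_a : forall m n x, m != 0 ->
  e m (a n x) = a n (e m x) + kron K (m + n) *: x.
Hypothesis a0 : forall x, a 0 x = ha *: x.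
Hypothesis e0 : forall x, e 0 x = 0.
Hypothesis PC : forall m n x, P m (P n x) = - P n (P m x).
Hypothesis yC : forall m n x, y m (y n x) = - y n (y m x).
Hypothesis y_P : forall m n x,
  y m (P n x) = - P n (y m x) + kron K (m + n + 1) *: x.
Hypothesis e_P : forall m n x, e m (P n x) = P n (e m x).
Hypothesis e_y : forall m n x, e m (y n x) = y n (e m x).
Hypothesis a_P : forall m n x, a m (P n x) = P n (a m x).
Hypothesis a_y : forall m n x, a m (y n x) = y n (a m x).

Hypothesis vac_pos : forall n : int,
  [/\ 0 < n -> e n vac = 0, 0 < n -> a n vac = 0,
      0 <= n -> P n vac = 0 & 0 <= n -> y n vac = 0].
Hypothesis vev_linear : forall c x z, vev (c *: x + z) = c * vev x + vev z.
Hypothesis vev_vac : vev vac = 1.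
Hypothesis vev_neg : forall (n : int) x, n < 0 ->
  [/\ vev (e n x) = 0, vev (a n x) = 0, vev (P n x) = 0 & vev (y n x) = 0].
Hypothesis vac_unique : forall x,
  (forall n : int, [/\ 0 < n -> e n x = 0, 0 < n -> a n x = 0,
      0 <= n -> P n x = 0 & 0 <= n -> y n x = 0]) -> x = vev x *: vac.
Hypothesis vac_cyclic : forall Q : M -> Prop,
  Q 0 -> (forall x z, Q x -> Q z -> Q (x + z)) -> (forall c x, Q x -> Q (c *: x)) ->
  Q vac ->
  (forall n x, Q x -> [/\ Q (e n x), Q (a n x), Q (P n x) & Q (y n x)]) ->
  forall x, Q x.

Hypothesis par_sub : forall b, [/\ par b 0,
  forall x z, par b x -> par b z -> par b (x + z) & forall c x, par b x -> par b (c *: x)].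
Hypothesis par_vac : par false vac.
Hypothesis par_mode : forall b n x, par b x ->
  [/\ par b (e n x), par b (a n x), par (~~ b) (P n x) & par (~~ b) (y n x)].
Hypothesis par_vev : forall x, par true x -> vev x = 0.

Let vevD x z : vev (x + z) = vev x + vev z.
Proof. by have := vev_linear 1 x z; rewrite scale1r mul1r. Qed.

Let vev0 : vev 0 = 0.
Proof. by apply: (addrI (vev 0)); rewrite -vevD !addr0. Qed.

Let vevZ c x : vev (c *: x) = c * vev x.
Proof. by have := vev_linear c x 0; rewrite addr0 vev0 addr0. Qed.

Let vevN x : vev (- x) = - vev x.
Proof. by rewrite -scaleN1r vevZ mulN1r. Qed.

Lemma mode0 c n : F c n 0 = 0. Proof. exact: linear0. Qed.
Lemma modeD c n x z : F c n (x + z) = F c n x + F c n z. Proof. exact: linearD. Qed.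
Lemma modeN c n x : F c n (- x) = - F c n x. Proof. exact: linearN. Qed.
Lemma modeB c n x z : F c n (x - z) = F c n x - F c n z. Proof. exact: linearB. Qed.
Lemma modeZ c n t x : F c n (t *: x) = t *: F c n x. Proof. exact: linearZ. Qed.

Lemma mode_int_sum c n N (g : int -> M) :
  F c n (int_sum N g) = int_sum N (fun m => F c n (g m)).
Proof. by rewrite /int_sum linear_sum; apply: eq_bigr => i _; rewrite modeD. Qed.

Lemma locally_finite x : exists N : nat, forall n : int, N%:Z <= n ->
  [/\ e n x = 0, a n x = 0, P n x = 0 & y n x = 0].
Proof.
apply: (vac_cyclic (Q := fun x => exists N : nat, forall n : int, N%:Z <= n ->
  [/\ e n x = 0, a n x = 0, P n x = 0 & y n x = 0])) => {x}.
- by exists 0%N => n _; rewrite !mode0.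
- move=> x z [N1 hx] [N2 hz]; exists (maxn N1 N2) => n le_n.
  have le1 : N1%:Z <= n by lia.
  have le2 : N2%:Z <= n by lia.
  have [x1 x2 x3 x4] := hx _ le1; have [z1 z2 z3 z4] := hz _ le2.
  by rewrite !modeD x1 x2 x3 x4 z1 z2 z3 z4 !addr0.
- move=> c x [N hx]; exists N => n /hx[x1 x2 x3 x4].
  by rewrite !modeZ x1 x2 x3 x4 scaler0.
- exists 1%N => n n1; have [v1 v2 v3 v4] := vac_pos n.
  by rewrite v1 ?v2 ?v3 ?v4 //; lia.
move=> m x [N hx].
have big n : (N + `|m| + 2)%N%:Z <= n ->
   N%:Z <= n /\ [/\ n != 0, n + m != 0, m + n != 0, n + m + 1 != 0 & m + n + 1 != 0].
  by move=> le_n; do 2?split; lia.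
split; exists (N + `|m| + 2)%N => n /big[/hx[x1 x2 x3 x4] [nz_n nz_nm nz_mn nz_nm1 nz_mn1]].
- rewrite eC x1 -e_P x3 -e_y x4 !mode0; split=> //.
  have [->|nz_m] := eqVneq m 0; first by rewrite !e0 mode0.
  have := e_a n x nz_m; rewrite x2 mode0 kron_neq // scale0r addr0; exact: esym.
- by rewrite e_a // x1 aC x2 -a_P x3 -a_y x4 !mode0 kron_neq // scale0r addr0.
- rewrite e_P x1 a_P x2 PC x3 y_P x4 !mode0 kron_neq //.
  by rewrite ?oppr0 scale0r addr0.
rewrite e_y x1 a_y x2 yC x4 !mode0 ?oppr0; split=> //.
have := y_P m n x; rewrite x3 mode0 kron_neq // scale0r addr0 => /eqP.
by rewrite eq_sym oppr_eq0 => /eqP.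
Qed.

(** The linear coefficient of [Psi] in [G]: it carries the central charge and
    the weight of the vacuum. *)
Variables (mu nu : K).
Let rho (j : int) : K := mu * (j%:~R + 1 / 2) + nu.

(** The summands of [G(j+1/2)]. Every product pairs a boson with a fermion, which
    commute, so no normal ordering is needed. *)
Definition G_term (j m : int) (x : M) : M :=
  - (m%:~R *: P (m + j) (e (- m) x))
  + (a (j + m + 1) (y (- m - 1) x)
     + (2 * m%:~R * kron K (j + m + 1) * cLa) *: y (- m - 1) x).

Definition G_part (N : nat) (j : int) (x : M) : M :=
  int_sum N (fun m => G_term j m x) + rho j *: P j x.

Definition mode_bound (x : M) : nat := sval (cid (locally_finite x)).

Definition G_fun (j : int) (x : M) : M := G_part (mode_bound x + `|j| + 2) j x.

Lemma G_fun_part j x : exists N0 : nat, forall N, (N0 <= N)%N -> G_fun j x = G_part N j x.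
Proof.
exists (mode_bound x + `|j| + 2)%N => N le_N; rewrite /G_fun /G_part; congr (_ + _).
symmetry; apply: int_sum_stable => // i le_i.
have hx := svalP (cid (locally_finite x)); rewrite -/(mode_bound x) in hx.
have e_x n : (mode_bound x)%:Z <= n -> e n x = 0 by case/hx.
have a_x n : (mode_bound x)%:Z <= n -> a n x = 0 by case/hx.
have P_x n : (mode_bound x)%:Z <= n -> P n x = 0 by case/hx.
have y_x n : (mode_bound x)%:Z <= n -> y n x = 0 by case/hx.
split; rewrite /G_term.
  rewrite -e_P P_x ?mode0; last by lia.
  rewrite a_y a_x ?mode0; last by lia.
  rewrite kron_neq; last by lia.
  by rewrite mulr0 mul0r !scale0r ?scaler0 ?oppr0 !addr0.
rewrite e_x ?mode0; last by lia.
by rewrite y_x ?mode0 ?scaler0 ?oppr0 ?addr0 //; lia.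
Qed.

Lemma G_term_linear j m c x z : G_term j m (c *: x + z) = c *: G_term j m x + G_term j m z.
Proof. by rewrite /G_term !modeD !modeZ; lin_coefs K M; ring. Qed.

Lemma G_part_linear N j c x z : G_part N j (c *: x + z) = c *: G_part N j x + G_part N j z.
Proof.
rewrite /G_part (eq_int_sum _ (fun m => G_term_linear j m c x z)) int_sumD modeD modeZ int_sumZ.
by lin_coefs K M; ring.
Qed.

Lemma G_fun_linear j c x z : G_fun j (c *: x + z) = c *: G_fun j x + G_fun j z.
Proof.
have [N1 h1] := G_fun_part j x; have [N2 h2] := G_fun_part j z.
have [N3 h3] := G_fun_part j (c *: x + z); pose N := (N1 + N2 + N3)%N.
by rewrite (h1 N) ?(h2 N) ?(h3 N) ?G_part_linear // /N; lia.
Qed.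

HB.instance Definition _ j := GRing.isLinear.Build K M M _ (G_fun j) (G_fun_linear j).

(** The existence statement seals the sum: conversion never unfolds it. *)
Lemma G_exists : {g : int -> {linear M -> M} | forall j x,
  exists N0 : nat, forall N, (N0 <= N)%N -> g j x = G_part N j x}.
Proof. by exists (fun j => G_fun j : {linear M -> M}) => j x; apply: G_fun_part. Qed.

Definition field_G : int -> {linear M -> M} := sval G_exists.
Local Notation G := field_G.

Lemma G_partE j x : exists N0 : nat, forall N, (N0 <= N)%N -> G j x = G_part N j x.
Proof. exact: (svalP G_exists). Qed.

(** A (skew) commutator with [G] is computed one summand at a time. *)
Lemma G_mode c n (s : K) j m0 (w : M) (x : M) (f := F c n) :
  (forall m, f (G_term j m x) = s *: G_term j m (f x) + (if m == m0 then w else 0)) ->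
  forall w', f (P j x) = s *: P j (f x) + w' ->
  f (G j x) = s *: G j (f x) + w + rho j *: w'.
Proof.
move=> f_term w' f_P; rewrite /f in f_term f_P *.
have [N1 h1] := G_partE j x; have [N2 h2] := G_partE j (f x).
pose N := (N1 + N2 + `|m0|.+1)%N; rewrite (h1 N) ?(h2 N); try by rewrite /N; lia.
rewrite /G_part modeD modeZ f_P mode_int_sum (eq_int_sum _ f_term) int_sumD.
rewrite int_sum_delta; last by rewrite /N; lia.
rewrite int_sumZ.
by lin_coefs K M; ring.
Qed.

Lemma a_G n j x : a n (G j x) = G j (a n x) + n%:~R *: P (n + j) x.
Proof.
rewrite (@G_mode Fa n 1 j n (n%:~R *: P (n + j) x) x _ 0) ?scale1r.
- by rewrite scaler0 addr0.
- move=> m; rewrite scale1r /G_term modeD modeN modeZ a_P modeD modeZ aC !a_y.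
  have [->|nz_m] := eqVneq m 0.
    rewrite !scale0r oppr0 eq_sym; case: eqVneq => [->|_]; last by rewrite [RHS]addr0.
    by rewrite [X in _ = _ + X]scale0r [RHS]addr0.
  have nz_Nm : - m != 0 by rewrite oppr_eq0.
  have -> : a n (e (- m) x) = e (- m) (a n x) - kron K (- m + n) *: x.
    by rewrite e_a // addrK.
  rewrite modeB modeZ; have [<-|ne_nm] := eqVneq m n.
    by rewrite addNr kron0; lin_coefs K M; ring.
  rewrite kron_neq; last by lia.
  by lin_coefs K M; ring.
by rewrite addr0 a_P.
Qed.

Lemma P_G n j x : P n (G j x)
  = - G j (P n x) + a (n + j + 1) x + (2 * n%:~R * kron K (n + j + 1) * cLa) *: x.
Proof.
pose w := a (n + j + 1) x + (2 * n%:~R * kron K (n + j + 1) * cLa) *: x.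
rewrite (@G_mode FP n (-1) j n w x _ 0) ?scaleN1r.
- by rewrite scaler0 addr0 /w addrA.
- move=> m; rewrite /G_term modeD modeN modeZ PC modeD modeZ -a_P -e_P.
  have yP : P n (y (- m - 1) x) = - y (- m - 1) (P n x) + kron K (n - m) *: x.
    rewrite y_P (_ : - m - 1 + n + 1 = n - m); last by lia.
    by lin_coefs K M; ring.
  rewrite yP modeD modeN modeZ /w; have [->|ne_mn] := eqVneq m n.
    rewrite subrr kron0 [j + n]addrC; lin_coefs K M; ring.
  rewrite kron_neq; last by lia.
  by lin_coefs K M; ring.
by rewrite PC addr0.
Qed.

Lemma e_G n j x : n != 0 -> e n (G j x) = G j (e n x) + y (j + n) x.
Proof.
move=> nz_n.
rewrite (@G_mode Fe n 1 j (- n - j - 1) (y (j + n) x) x _ 0) ?scale1r.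
- by rewrite scaler0 addr0.
- move=> m; rewrite scale1r /G_term modeD modeN modeZ e_P eC modeD modeZ e_a // !e_y.
  have [->|ne_m] := eqVneq m (- n - j - 1).
    have -> : n + (j + (- n - j - 1) + 1) = 0 by lia.
    have -> : - (- n - j - 1) - 1 = j + n by lia.
    by rewrite kron0; lin_coefs K M; ring.
  rewrite (kron_neq K (_ : n + (j + m + 1) != 0)); last by lia.
  by lin_coefs K M; ring.
by rewrite e_P addr0.
Qed.

Lemma y_G n j x : y n (G j x) = - G j (y n x)
  + (j + n + 1)%:~R *: e (j + n + 1) x + (rho j * kron K (j + n + 1)) *: x.
Proof.
pose w := (j + n + 1)%:~R *: e (j + n + 1) x.
rewrite (@G_mode Fy n (-1) j (- j - n - 1) w x _ (kron K (j + n + 1) *: x)) ?scaleN1r.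
- by rewrite scalerA.
- move=> m; rewrite /G_term modeD modeN modeZ y_P modeD modeZ -a_y yC -e_y modeN /w.
  have [->|ne_m] := eqVneq m (- j - n - 1).
    have -> : n + (- j - n - 1 + j) + 1 = 0 by lia.
    have -> : - (- j - n - 1) = j + n + 1 by lia.
    by rewrite kron0; lin_coefs K M; ring.
  rewrite (kron_neq K (_ : n + (m + j) + 1 != 0)); last by lia.
  by lin_coefs K M; ring.
by rewrite y_P; congr (- _ + kron K _ *: _); lia.
Qed.

Lemma G_vac (j : int) : 0 <= j -> G j vac = 0.
Proof.
move=> j0; have [N h] := G_partE j vac; rewrite (h N) // /G_part.
have [_ _ Pv _] := vac_pos j; rewrite Pv // scaler0 addr0.
rewrite /int_sum big1 // => i _.
have e_v n : 0 < n -> e n vac = 0 by case: (vac_pos n).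
have a_v n : 0 < n -> a n vac = 0 by case: (vac_pos n).
have P_v n : 0 <= n -> P n vac = 0 by case: (vac_pos n).
have y_v n : 0 <= n -> y n vac = 0 by case: (vac_pos n).
have vt m : G_term j m vac = 0.
  rewrite /G_term; have [m0|m0] := ltP m 0.
    by rewrite e_v ?y_v ?mode0 ?scaler0 ?oppr0 ?addr0 //; lia.
  rewrite -e_P P_v; last by lia.
  rewrite a_y a_v; last by lia.
  rewrite kron_neq; last by lia.
  by rewrite !mode0 mulr0 mul0r scale0r scaler0 oppr0 !addr0.
by rewrite !vt addr0.
Qed.

Lemma vev_G (j : int) x : j < 0 -> vev (G j x) = 0.
Proof.
move=> j0; have [N h] := G_partE j x; rewrite (h N) // /G_part vevD vevZ.
have [_ _ -> _] := vev_neg x j0; rewrite mulr0 addr0.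
have vt m : vev (G_term j m x) = 0.
  rewrite /G_term !vevD vevN !vevZ.
  have vE : m%:~R * vev (P (m + j) (e (- m) x)) = 0.
    have [->|nz_m] := eqVneq m 0; first by rewrite mul0r.
    have [m0|m0] := ltP m 0.
      have [|_ _ -> _] := @vev_neg (m + j) (e (- m) x); first by lia.
      by rewrite mulr0.
    by rewrite -e_P; have [|-> _ _ _] := @vev_neg (- m) (P (m + j) x); [lia|rewrite mulr0].
  rewrite vE oppr0 add0r; have [m0|m0] := ltP m 0.
    have [|_ -> _ _] := @vev_neg (j + m + 1) (y (- m - 1) x); first by lia.
    rewrite kron_neq; last by lia.
    by rewrite mulr0 !mul0r addr0.
  rewrite a_y; have [|_ _ _ ->] := @vev_neg (- m - 1) (a (j + m + 1) x); first by lia.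
  by have [|_ _ _ ->] := @vev_neg (- m - 1) x; [lia|rewrite mulr0 addr0].
rewrite /int_sum (big_morph vev vevD vev0) big1 // => i _.
by rewrite vevD !vt addr0.
Qed.

Lemma par_G b j x : par b x -> par (~~ b) (G j x).
Proof.
move=> px; have [N h] := G_partE j x; rewrite (h N) // /G_part.
have [p0 pD pZ] := par_sub (~~ b).
have pt m : par (~~ b) (G_term j m x).
  have [p1 p2 p3 p4] := par_mode (- m) px.
  have [q1 q2 q3 q4] := par_mode (- m - 1) px.
  apply: (pD); first by rewrite -scaleN1r scalerA; apply: (pZ); case: (par_mode (m + j) p1).
  by apply: (pD); [case: (par_mode (j + m + 1) q4)|apply: (pZ)].
apply: (pD); last by apply: (pZ); case: (par_mode j px).
by apply: (big_ind (par (~~ b))) => // i _; apply: (pD).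
Qed.

(** Schur's lemma: [X] maps the vacuum to a vector that is killed by all
    annihilation operators, hence to a multiple of the vacuum, and the vacuum is
    cyclic. *)
Lemma free_field_schur (X : M -> M) (s : K) : linear X -> s != 0 ->
  (forall n x, n != 0 -> X (e n x) = e n (X x)) ->
  (forall n x, X (a n x) = a n (X x)) ->
  (forall n x, X (P n x) = s *: P n (X x)) ->
  (forall n x, X (y n x) = s *: y n (X x)) ->
  vev (X vac) = 0 -> forall x, X x = 0.
Proof.
move=> /linear_split[X0 XD XZ] nz_s Xe Xa XP Xy vevX.
have Xe' n x : X (e n x) = e n (X x).
  by have [->|/Xe//] := eqVneq n 0; rewrite !e0 X0.
have Xvac : X vac = 0.
  rewrite (@vac_unique (X vac)) ?vevX ?scale0r // => n.
  have [v1 v2 v3 v4] := vac_pos n.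
  split=> n0; first by rewrite -Xe' v1 ?X0.
  - by rewrite -Xa v2 ?X0.
  - by apply: (scalerI nz_s); rewrite -XP v3 ?X0 ?scaler0.
  by apply: (scalerI nz_s); rewrite -Xy v4 ?X0 ?scaler0.
apply: (vac_cyclic (Q := fun x => X x = 0)) => //.
- by move=> x z Xx Xz; rewrite XD Xx Xz addr0.
- by move=> c x Xx; rewrite XZ Xx scaler0.
by move=> n x Xx; rewrite Xe' Xa XP Xy Xx !mode0 !scaler0.
Qed.

Lemma G_0 j : G j 0 = 0. Proof. exact: linear0. Qed.
Lemma G_D j x z : G j (x + z) = G j x + G j z. Proof. exact: linearD. Qed.
Lemma G_N j x : G j (- x) = - G j x. Proof. exact: linearN. Qed.
Lemma G_Z j t x : G j (t *: x) = t *: G j x. Proof. exact: linearZ. Qed.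

(** The commutators of this anticommutator with the free fields depend only on
    [j + k]; so, by [free_field_schur], does [GG j k] itself, up to a scalar. *)
Definition GG (j k : int) (x : M) : M := G j (G k x) + G k (G j x).

Lemma GG_linear j k : linear (GG j k).
Proof. by move=> c x z; rewrite /GG !(G_D, G_Z); lin_coefs K M; ring. Qed.

Lemma a_GG n j k x : a n (GG j k x) = GG j k (a n x)
  + (2 * n%:~R) *: a (n + j + k + 1) x
  + (2 * n%:~R * (n - 1)%:~R * kron K (n + j + k + 1) * cLa) *: x.
Proof.
rewrite /GG modeD !a_G !(G_D, G_Z) !P_G.
have -> : n + k + j + 1 = n + j + k + 1 by lia.
have [n0|n0] := eqVneq (n + j + k + 1) 0; last first.
  by rewrite kron_neq //; lin_coefs K M; ring.
have -> : j = - n - k - 1 by lia.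
by lin_coefs K M; ring.
Qed.

Lemma P_GG n j k x : P n (GG j k x) = GG j k (P n x)
  + (2 * n + j + k + 2)%:~R *: P (n + j + k + 1) x.
Proof.
rewrite /GG modeD !P_G !(G_D, G_Z, G_N) !a_G.
have -> : n + k + 1 + j = n + j + k + 1 by lia.
have -> : n + j + 1 + k = n + j + k + 1 by lia.
by lin_coefs K M; ring.
Qed.

Lemma e_GG n j k x : n != 0 -> e n (GG j k x) = GG j k (e n x)
  + (2 * (n + j + k + 1))%:~R *: e (n + j + k + 1) x
  + ((mu * (j + k + 1)%:~R + 2 * nu) * kron K (n + j + k + 1)) *: x.
Proof.
move=> nz_n; rewrite /GG modeD !e_G // !(G_D, G_Z, G_N) !y_G /rho.
have -> : k + (j + n) + 1 = n + j + k + 1 by lia.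
have -> : j + (k + n) + 1 = n + j + k + 1 by lia.
by lin_coefs K M; field.
Qed.

Lemma y_GG n j k x : y n (GG j k x) = GG j k (y n x)
  + (2 * n + j + k + 2)%:~R *: y (n + j + k + 1) x.
Proof.
rewrite /GG modeD !y_G !(G_D, G_Z, G_N).
have eG i l : (i + n + 1)%:~R *: e (i + n + 1) (G l x)
    = (i + n + 1)%:~R *: (G l (e (i + n + 1) x) + y (l + (i + n + 1)) x).
  have [->|nz_i] := eqVneq (i + n + 1) 0; first by rewrite !scale0r.
  by rewrite e_G.
rewrite !eG.
have -> : k + (j + n + 1) = n + j + k + 1 by lia.
have -> : j + (k + n + 1) = n + j + k + 1 by lia.
by lin_coefs K M; ring.
Qed.

(** ** Vacuum expectation values *)

Let vac_e n : 0 < n -> e n vac = 0. Proof. by case: (vac_pos n). Qed.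
Let vac_a n : 0 < n -> a n vac = 0. Proof. by case: (vac_pos n). Qed.
Let vac_P n : 0 <= n -> P n vac = 0. Proof. by case: (vac_pos n). Qed.
Let vac_y n : 0 <= n -> y n vac = 0. Proof. by case: (vac_pos n). Qed.
Let vev_e n x : n < 0 -> vev (e n x) = 0. Proof. by case/(vev_neg x). Qed.
Let vev_a n x : n < 0 -> vev (a n x) = 0. Proof. by case/(vev_neg x). Qed.
Let vev_P n x : n < 0 -> vev (P n x) = 0. Proof. by case/(vev_neg x). Qed.
Let vev_y n x : n < 0 -> vev (y n x) = 0. Proof. by case/(vev_neg x). Qed.

Lemma vev_a_vac n : vev (a n vac) = kron K n * ha.
Proof.
have [n0|n0|->] := ltgtP n 0.
- by rewrite vev_a // kron_neq ?mul0r //; lia.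
- by rewrite vac_a // vev0 kron_neq ?mul0r //; lia.
by rewrite a0 vevZ vev_vac kron0 mulr1 mul1r.
Qed.

Lemma vev_e_vac n : vev (e n vac) = 0.
Proof.
have [n0|n0|->] := ltgtP n 0; first exact: vev_e.
  by rewrite vac_e.
by rewrite e0.
Qed.

Lemma vev_ae b c : c != 0 ->
  vev (a b (e c vac)) = if c < 0 then - kron K (b + c) else 0.
Proof.
move=> nz_c; have [c0|c0] := ltP c 0; last first.
  by rewrite vac_e ?mode0 //; lia.
have -> : a b (e c vac) = e c (a b vac) - kron K (c + b) *: vac.
  by rewrite e_a // addrK.
by rewrite vevD vev_e // vevN vevZ vev_vac mulr1 add0r addrC.
Qed.

Lemma vev_Py b c : vev (P b (y c vac)) = if c < 0 then kron K (b + c + 1) else 0.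
Proof.
have [c0|c0] := ltP c 0; last by rewrite vac_y ?mode0.
have -> : P b (y c vac) = - y c (P b vac) + kron K (c + b + 1) *: vac.
  by rewrite y_P; lin_coefs K M; ring.
by rewrite vevD vevN vev_y // oppr0 add0r vevZ vev_vac mulr1 [b + c]addrC.
Qed.

Lemma vev_G_term (k : nat) (j m : int) :
  vev (G k%:Z (G_term j m vac)) = kron K (j + k%:Z + 1) *
    ((if (0 <= m <= k%:Z) then k%:R else 0)
     + (if m == k%:Z then rho k%:Z * (ha + 2 * k%:R * cLa) else 0)).
Proof.
have Gk : G k%:Z vac = 0 by rewrite G_vac.
rewrite /G_term G_D G_N G_Z vevD vevN vevZ.
have termE : m%:~R * vev (G k%:Z (P (m + j) (e (- m) vac)))
    = - (kron K (j + k%:Z + 1) * (if 0 < m <= k%:Z then m%:~R else 0)).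
  have [->|nz_m] := eqVneq m 0; first by rewrite ltxx /= mulr0 mulr0z mul0r oppr0.
  have [m0|m0] := ltP m 0.
    rewrite vac_e ?mode0 ?G_0 ?vev0; last by lia.
    by rewrite ifF ?mulr0 ?oppr0 //; lia.
  have -> : G k%:Z (P (m + j) (e (- m) vac)) = - P (m + j) (G k%:Z (e (- m) vac))
      + a (m + j + k%:Z + 1) (e (- m) vac)
      + (2 * (m + j)%:~R * kron K (m + j + k%:Z + 1) * cLa) *: e (- m) vac.
    by rewrite P_G; lin_coefs K M; ring.
  have -> : G k%:Z (e (- m) vac) = - y (k%:Z - m) vac.
    have := @e_G (- m) k%:Z vac; rewrite Gk mode0 => /(_ _)/esym/eqP.
    by rewrite addr_eq0 => /(_ _)/eqP; apply; rewrite oppr_eq0.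
  rewrite modeN opprK !vevD vevZ vev_e_vac mulr0 addr0 vev_Py vev_ae; last by rewrite oppr_eq0.
  have -> : - m < 0 by lia.
  have -> : m + j + (k%:Z - m) + 1 = j + k%:Z + 1 by lia.
  have -> : m + j + k%:Z + 1 - m = j + k%:Z + 1 by lia.
  have -> : (k%:Z - m < 0) = ~~ (m <= k%:Z) by lia.
  have -> : (0 < m) = true by lia.
  by case: (m <= k%:Z) => /=; ring.
have termO : vev (G k%:Z (a (j + m + 1) (y (- m - 1) vac)
      + (2 * m%:~R * kron K (j + m + 1) * cLa) *: y (- m - 1) vac))
    = kron K (j + k%:Z + 1) * ((if 0 <= m < k%:Z then (k%:Z - m)%:~R else 0)
       + (if m == k%:Z then rho k%:Z * (ha + 2 * k%:R * cLa) else 0)).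
  have [m0|m0] := ltP m 0.
    rewrite vac_y ?mode0 ?scaler0 ?addr0 ?G_0 ?vev0; last by lia.
    rewrite ifF; last by lia.
    by rewrite /= addr0 mulr0.
  have Gz : G k%:Z (y (- m - 1) vac)
      = (k%:Z - m)%:~R *: e (k%:Z - m) vac + (rho k%:Z * kron K (k%:Z - m)) *: vac.
    have := y_G (- m - 1) k%:Z vac; rewrite Gk mode0.
    have -> : k%:Z + (- m - 1) + 1 = k%:Z - m by lia.
    move=> yG; have := congr1 (fun x => G k%:Z (y (- m - 1) vac) + x) yG.
    by rewrite addr0 => ->; lin_coefs K M; ring.
  rewrite G_D G_Z.
  have -> : G k%:Z (a (j + m + 1) (y (- m - 1) vac)) = a (j + m + 1) (G k%:Z (y (- m - 1) vac))
      - (j + m + 1)%:~R *: P (j + m + 1 + k%:Z) (y (- m - 1) vac).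
    by rewrite a_G addrK.
  rewrite vevD vevD vevN !vevZ Gz modeD !modeZ !vevD !vevZ.
  rewrite vev_e_vac vev_vac vev_a_vac vev_Py ifT; last by lia.
  have -> : j + m + 1 + k%:Z + (- m - 1) + 1 = j + k%:Z + 1 by lia.
  have [->|ne_mk] := eqVneq m k%:Z.
    rewrite subrr kron0 ltxx andbF.
    have [b0|b0] := eqVneq (j + k%:Z + 1) 0; last by rewrite kron_neq //; ring.
    by rewrite b0 kron0; ring.
  rewrite (kron_neq K (_ : k%:Z - m != 0)); last by lia.
  rewrite vev_ae; last by lia.
  have -> : j + m + 1 + (k%:Z - m) = j + k%:Z + 1 by lia.
  have [b0|b0] := eqVneq (j + k%:Z + 1) 0; last first.
    by rewrite !(kron_neq _ b0); case: ifP => _; ring.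
  have -> : j + m + 1 = m - k%:Z by lia.
  rewrite b0 kron0 /=; have -> : (m < k%:Z) = ~~ (k%:Z - m < 0) by lia.
  by case: (k%:Z - m < 0) => /=; ring.
rewrite termE termO; have [b0|b0] := eqVneq (j + k%:Z + 1) 0; last first.
  by rewrite !(kron_neq _ b0) !mul0r !oppr0 addr0.
rewrite b0 kron0; have [m0|m0] := ltP m 0.
  have -> : (0 < m) = false by lia.
  have -> : (m == k%:Z) = false by lia.
  by rewrite /= !(mulr0, addr0, oppr0).
have [lt_mk|lt_km|->] := ltgtP m k%:Z => /=.
- have [->|nz_m] := eqVneq m 0.
    by rewrite ltxx subr0 /= -pmulrn; ring.
  have -> : 0 < m by lia.
  by rewrite rmorphB /= -!pmulrn; ring.
- by rewrite andbF; ring.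
have [->|nz_k] := eqVneq k 0%N; first by rewrite ltxx /=; ring.
have -> : 0 < k%:Z by lia.
by rewrite /= -pmulrn; ring.
Qed.

Lemma vev_G_P (k : nat) (j : int) : vev (G k%:Z (P j vac))
  = kron K (j + k%:Z + 1) * (ha + 2 * j%:~R * cLa).
Proof.
have -> : G k%:Z (P j vac) = - P j (G k%:Z vac) + a (j + k%:Z + 1) vac
    + (2 * j%:~R * kron K (j + k%:Z + 1) * cLa) *: vac.
  by rewrite P_G; lin_coefs K M; ring.
rewrite G_vac // mode0 oppr0 add0r vevD vev_a_vac vevZ vev_vac; ring.
Qed.

Lemma vev_GG_half (k : nat) (j : int) : vev (G k%:Z (G j vac))
  = kron K (j + k%:Z + 1) * (k%:R * k.+1%:R
    + rho k%:Z * (ha + 2 * k%:R * cLa) + rho j * (ha + 2 * j%:~R * cLa)).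
Proof.
have [N0 h] := G_partE j vac; rewrite (h (N0 + k.+1)%N) ?leq_addr // /G_part.
rewrite G_D G_Z vevD vevZ vev_G_P.
have -> : vev (G k%:Z (int_sum (N0 + k.+1) (fun m => G_term j m vac)))
    = int_sum (N0 + k.+1) (fun m => vev (G k%:Z (G_term j m vac))).
  rewrite /int_sum linear_sum (big_morph vev vevD vev0).
  by apply: eq_bigr => i _; rewrite /= G_D vevD.
rewrite (eq_int_sum _ (vev_G_term k j)).
have -> : forall f : int -> K, int_sum (N0 + k.+1) (fun m => kron K (j + k%:Z + 1) * f m)
    = kron K (j + k%:Z + 1) * int_sum (N0 + k.+1) f.
  by move=> f; rewrite /int_sum mulr_sumr; apply: eq_bigr => i _; rewrite mulrDr.
rewrite int_sumD int_sum_delta; last by rewrite absz_nat; lia.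
have -> : int_sum (N0 + k.+1) (fun m => if 0 <= m <= k%:Z then k%:R else 0 : K)
    = k%:R * k.+1%:R.
  rewrite /int_sum (big_cat_nat (n := k.+1)) //=; last by lia.
  rewrite [X in _ + X]big_nat [X in _ + X]big1 ?addr0; last first.
    by move=> i i_k; rewrite !ifF ?addr0 //; lia.
  transitivity (\sum_(0 <= i < k.+1) (k%:R : K)).
    by apply: eq_big_nat => i i_k; rewrite ifT ?addr0 //; lia.
  by rewrite sumr_const_nat subn0 mulr_natr.
ring.
Qed.

Hypothesis mu_cL : 1 + 4 * mu * cLa = cL / 3.
Hypothesis mu_hw : mu * cLa + 2 * nu * (ha - cLa) = 2 * hw.

Lemma vev_GG (j k : int) :
  vev (GG j k vac) = kron K (j + k + 1) * ((j ^+ 2 + j)%:~R * (cL / 3) + 2 * hw).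
Proof.
have half (n : nat) i : i < 0 -> vev (GG i n%:Z vac)
    = kron K (i + n%:Z + 1) * ((i ^+ 2 + i)%:~R * (cL / 3) + 2 * hw).
  move=> i0; rewrite /GG vevD [X in X + _]vev_G // add0r vev_GG_half.
  have [e0'|ne0] := eqVneq (i + n%:Z + 1) 0; last by rewrite kron_neq // !mul0r.
  rewrite e0' kron0 -mu_cL -mu_hw /rho; have -> : i = - n%:Z - 1 by lia.
  by rewrite -[n.+1%:R]natr1 -!pmulrn; field.
have [j0|j0] := ltP j 0; have [k0|k0] := ltP k 0.
- by rewrite /GG vevD !vev_G // addr0 kron_neq ?mul0r //; lia.
- by have -> : k = `|k|%N%:Z by [lia]; apply: half.
- have -> : GG j k vac = GG k j vac by rewrite /GG addrC.
  have -> : j = `|j|%N%:Z by lia.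
  rewrite half // [k + _]addrC.
  have [e0'|ne0] := eqVneq (`|j|%N%:Z + k + 1) 0; last by rewrite kron_neq // !mul0r.
  have -> : k = - `|j|%N%:Z - 1 by lia.
  by congr (_ * (_%:~R * _ + _)); ring.
rewrite /GG vevD !G_vac // !G_0 !vev0 addr0 kron_neq ?mul0r //; lia.
Qed.

(** ** The relations of the [N = 1] Heisenberg-Virasoro algebra *)

Definition L_fun (m : int) (x : M) : M := 2^-1 *: GG (m - 1) 0 x.

Lemma L_fun_linear m : linear (L_fun m).
Proof. by move=> c x z; rewrite /L_fun GG_linear scalerDr !scalerA mulrC. Qed.

HB.instance Definition _ m := GRing.isLinear.Build K M M _ (L_fun m) (L_fun_linear m).

Lemma L_exists : {l : int -> {linear M -> M} | forall m x, l m x = 2^-1 *: GG (m - 1) 0 x}.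
Proof. by exists (fun m => L_fun m : {linear M -> M}). Qed.

Definition field_L : int -> {linear M -> M} := sval L_exists.
Local Notation L := field_L.

Lemma L_GG m x : L m x = 2^-1 *: GG (m - 1) 0 x.
Proof. exact: (svalP L_exists). Qed.

Lemma L_0 j : L j 0 = 0. Proof. exact: linear0. Qed.
Lemma L_D j x z : L j (x + z) = L j x + L j z. Proof. exact: linearD. Qed.
Lemma L_N j x : L j (- x) = - L j x. Proof. exact: linearN. Qed.
Lemma L_Z j t x : L j (t *: x) = t *: L j x. Proof. exact: linearZ. Qed.

Lemma a_Lf n m x : a n (L m x) = L m (a n x) + n%:~R *: a (m + n) x
  + (n%:~R * (n - 1)%:~R * kron K (m + n) * cLa) *: x.
Proof.
rewrite !L_GG modeZ a_GG; have -> : n + (m - 1) + 0 + 1 = m + n by lia.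
by lin_coefs K M; field.
Qed.

Lemma P_Lf n m x : P n (L m x) = L m (P n x)
  + ((2 * n + m + 1)%:~R / 2) *: P (n + m) x.
Proof.
rewrite !L_GG modeZ P_GG; have -> : n + (m - 1) + 0 + 1 = n + m by lia.
by lin_coefs K M; field.
Qed.

Lemma e_Lf n m x : n != 0 -> e n (L m x) = L m (e n x) + (n + m)%:~R *: e (n + m) x
  + ((mu * m%:~R + 2 * nu) / 2 * kron K (n + m)) *: x.
Proof.
move=> nz_n; rewrite !L_GG modeZ e_GG //; have -> : n + (m - 1) + 0 + 1 = n + m by lia.
by lin_coefs K M; field.
Qed.

Lemma y_Lf n m x : y n (L m x) = L m (y n x)
  + ((2 * n + m + 1)%:~R / 2) *: y (n + m) x.
Proof.
rewrite !L_GG modeZ y_GG; have -> : n + (m - 1) + 0 + 1 = n + m by lia.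
by lin_coefs K M; field.
Qed.

Lemma G_Gf j k x : G j (G k x) + G k (G j x) = 2 *: L (j + k + 1) x
  + (kron K (j + k + 1) * ((j ^+ 2 + j)%:~R / 3 * cL)) *: x.
Proof.
pose c := kron K (j + k + 1) * ((j ^+ 2 + j)%:~R / 3 * cL).
pose X z := GG j k z - GG (j + k) 0 z - c *: z.
have X0 : forall z, X z = 0.
  apply: (free_field_schur (s := 1)); rewrite ?oner_eq0 //.
  - by move=> b z z'; rewrite /X !GG_linear; lin_coefs K M; ring.
  - move=> n z nz_n; rewrite /X !modeB !e_GG // modeZ.
    by rewrite !addr0 !addrA; lin_coefs K M; ring.
  - by move=> n z; rewrite /X !modeB !a_GG modeZ !addr0 !addrA; lin_coefs K M; ring.
  - by move=> n z; rewrite /X !modeB !P_GG modeZ !addr0 !addrA; lin_coefs K M; ring.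
  - by move=> n z; rewrite /X !modeB !y_GG modeZ !addr0 !addrA; lin_coefs K M; ring.
  rewrite /X vevD vevD !vevN vevZ vev_vac !vev_GG addr0 /c.
  have [b0|b0] := eqVneq (j + k + 1) 0; last by rewrite kron_neq //; ring.
  have -> : j + k = -1 by lia.
  by rewrite kron0; ring.
have := X0 x; rewrite /X => X0x; rewrite L_GG addrK.
have -> : G j (G k x) + G k (G j x) = X x + GG (j + k) 0 x + c *: x.
  by rewrite /X /GG; lin_coefs K M; ring.
by rewrite X0 /c; lin_coefs K M; field.
Qed.

Lemma par_L b m x : par b x -> par b (L m x).
Proof.
move=> px; have [p0 pD pZ] := par_sub b; rewrite L_GG; apply: (pZ); rewrite /GG.
by apply: (pD); rewrite -[b]negbK; apply: par_G; apply: par_G.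
Qed.

Lemma L_Gf m n x : L m (G n x) = G n (L m x)
  + (m%:~R / 2 - n%:~R - 1 / 2) *: G (m + n) x.
Proof.
pose c : K := m%:~R / 2 - n%:~R - 1 / 2.
pose Y z := L m (G n z) - G n (L m z) - c *: G (m + n) z.
suff Y0 : forall z, Y z = 0.
  have := Y0 x; rewrite /Y => Y0x.
  have -> : L m (G n x) = Y x + (G n (L m x) + c *: G (m + n) x).
    by rewrite /Y; lin_coefs K M; ring.
  by rewrite Y0 add0r.
apply: (free_field_schur (s := -1)); rewrite ?oppr_eq0 ?oner_eq0 //.
- by move=> b z z'; rewrite /Y !(G_D, G_Z, L_D, L_Z); lin_coefs K M; ring.
- move=> i z nz_i; have eGi j w := @e_G i j w nz_i; have eLi j w := @e_Lf i j w nz_i.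
  rewrite /Y !modeB modeZ eLi !eGi L_D eLi !G_D !G_Z y_Lf.
  have -> : n + i + m = n + m + i by lia.
  have -> : m + n + i = n + m + i by lia.
  have eG : (i + m)%:~R *: e (i + m) (G n z)
      = (i + m)%:~R *: (G n (e (i + m) z) + y (n + m + i) z).
    have [->|nz_im] := eqVneq (i + m) 0; first by rewrite !scale0r.
    by rewrite e_G //; congr (_ *: (_ + y _ _)); lia.
  by rewrite eG /c; lin_coefs K M; field.
- move=> i z; rewrite /Y !modeB modeZ !a_Lf !a_G L_D L_Z !a_Lf !G_D !G_Z P_Lf.
  have -> : m + i + n = i + (m + n) by lia.
  have -> : i + n + m = i + (m + n) by lia.
  by rewrite /c; lin_coefs K M; field.
- move=> i z; rewrite /Y !modeB modeZ !P_Lf !P_G !(L_D, L_Z, L_N) !a_Lf !P_Lf !(G_D, G_Z).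
  have -> : i + m + n + 1 = i + n + m + 1 by lia.
  have -> : i + (m + n) + 1 = i + n + m + 1 by lia.
  have -> : m + (i + n + 1) = i + n + m + 1 by lia.
  have [b0|b0] := eqVneq (i + n + m + 1) 0; last first.
    by rewrite !(kron_neq K b0) /c; lin_coefs K M; field.
  have -> : i = - n - m - 1 by lia.
  by rewrite /c; lin_coefs K M; field.
- move=> i z; rewrite /Y !modeB modeZ !y_Lf !y_G !(L_D, L_Z, L_N) !y_Lf !(G_D, G_Z).
  have eL : (n + i + 1)%:~R *: e (n + i + 1) (L m z)
      = (n + i + 1)%:~R *: (L m (e (n + i + 1) z) + (n + i + 1 + m)%:~R *: e (n + i + 1 + m) z
  + ((mu * m%:~R + 2 * nu) / 2 * kron K (n + i + 1 + m)) *: z).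
    have [->|nz_i] := eqVneq (n + i + 1) 0; first by rewrite !scale0r.
    by rewrite e_Lf.
  rewrite eL.
  have -> : n + (i + m) + 1 = n + i + 1 + m by lia.
  have -> : m + n + i + 1 = n + i + 1 + m by lia.
  have [b0|b0] := eqVneq (n + i + 1 + m) 0; last first.
    by rewrite !(kron_neq K b0) /c /rho; lin_coefs K M; field.
  have -> : i = - n - m - 1 by lia.
  by rewrite /c /rho; lin_coefs K M; field.
(* The difference of the two sides is odd: its vacuum expectation vanishes. *)
have py : par true (Y vac).
  have [p0 pD pZ] := par_sub true; rewrite /Y.
  have pG j : par true (G j vac) by apply: (@par_G false).
  apply: (pD); last by rewrite -scaleNr; apply: (pZ).
  apply: (pD); first exact: par_L.
  by rewrite -scaleN1r; apply: (pZ); apply: (@par_G false); apply: par_L.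
exact: par_vev.
Qed.

Lemma L_Lf m n x : L m (L n x) = L n (L m x) + (m - n)%:~R *: L (m + n) x
  + (kron K (m + n) * ((m ^+ 3 - m)%:~R / 12 * cL)) *: x.
Proof.
rewrite [L n x]L_GG [L n (L m x)]L_GG /GG L_Z L_D !L_Gf !G_D !G_Z.
have GG1 := G_Gf (m + (n - 1)) 0 x; have GG2 := G_Gf (n - 1) m x.
have e1 : m + (n - 1) + 0 + 1 = m + n by lia.
have e2 : n - 1 + m + 1 = m + n by lia.
rewrite e1 in GG1; rewrite e2 in GG2; rewrite addr0.
have -> : G (m + (n - 1)) (G 0 x) = 2 *: L (m + n) x
  + (kron K (m + n) * (((m + (n - 1)) ^+ 2 + (m + (n - 1)))%:~R / 3 * cL)) *: x
  - G 0 (G (m + (n - 1)) x) by rewrite -GG1 addrK.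
have -> : G (n - 1) (G m x) = 2 *: L (m + n) x
  + (kron K (m + n) * (((n - 1) ^+ 2 + (n - 1))%:~R / 3 * cL)) *: x
  - G m (G (n - 1) x) by rewrite -GG2 addrK.
have [b0|b0] := eqVneq (m + n) 0; last first.
  by rewrite !(kron_neq K b0); lin_coefs K M; field.
have -> : n = - m by lia.
by rewrite subrr kron0; lin_coefs K M; field.
Qed.

Definition field_act (b : sh_basis) : {linear M -> M} :=
  match b with
  | shL n => L n
  | shAlpha n => a n
  | shG n => G n
  | shPsi n => P n
  | shCL => GRing.scale cL
  | shCalpha => GRing.scale 0
  | shCLalpha => GRing.scale cLa
  end.

Lemma field_table b c s x : sh_table K b c = Some s ->
  field_act b (field_act c x)
    - (-1) ^+ (sh_odd b && sh_odd c) *: field_act c (field_act b x)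
  = \sum_(t <- s) t.1 *: field_act t.2 x.
Proof.
case: b c => [m|m|m|m|||] [n|n|n|n|||] //= [<-];
  rewrite ?expr0 ?expr1 ?big_cons big_nil /=.
- by rewrite L_Lf; lin_coefs K M; ring.
- rewrite a_Lf; have [b0|b0] := eqVneq (m + n) 0; last first.
    by rewrite !(kron_neq K b0); lin_coefs K M; ring.
  by have -> : n = - m by [lia]; lin_coefs K M; ring.
- by rewrite L_Gf; lin_coefs K M; ring.
- by rewrite aC scale0r scale1r subrr scaler0 addr0.
- by rewrite a_G; lin_coefs K M; ring.
- by rewrite a_P scale1r subrr.
- by rewrite scaleN1r opprK G_Gf; lin_coefs K M; ring.
- by rewrite P_Lf; lin_coefs K M; ring.
- by rewrite P_G; lin_coefs K M; ring.
by rewrite PC scale0r scaler0 addr0 scaleN1r opprK addNr.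
Qed.

Lemma field_actP b c x :
  field_act b (field_act c x)
    - (-1) ^+ (sh_odd b && sh_odd c) *: field_act c (field_act b x)
  = \sum_(t <- sh_bracket K b c) t.1 *: field_act t.2 x.
Proof.
rewrite /sh_bracket; case bc: (sh_table K b c) => [s|]; first exact: field_table.
case cb: (sh_table K c b) => [s|].
  rewrite big_map; set eps := (-1) ^+ _.
  have eps2 : eps * eps = 1 by rewrite /eps -expr2 sqrr_sign.
  transitivity (- eps *: \sum_(t <- s) t.1 *: field_act t.2 x); last first.
    by rewrite scaler_sumr; apply: eq_bigr => t _; rewrite scalerA.
  rewrite -(field_table x cb) andbC -/eps scalerBr scalerA mulNr eps2.
  by rewrite scaleNr scaleN1r opprK addrC.
rewrite big_nil.
case: b c bc cb => [m|m|m|m|||] [n|n|n|n|||] //= _ _;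
  rewrite ?andbF expr0 scale1r;
  by rewrite ?(L_Z, G_Z, modeZ) ?subrr // !scalerA mulrC subrr.
Qed.

Definition field_module : shModule K := SHModule field_actP.

Lemma L_vac : L 0 vac = hw *: vac.
Proof.
rewrite [LHS]vac_unique => [|n].
  rewrite L_GG vevZ vev_GG; congr (_ *: _).
  have -> : (0 - 1 + 0 + 1 : int) = 0 by lia.
  by rewrite kron0; field.
have [v1 v2 v3 v4] := vac_pos n; split=> n0.
- rewrite e_Lf ?v1 //; last by lia.
  by rewrite L_0 addr0 v1 // scaler0 kron_neq ?mulr0 ?scale0r ?addr0 //; lia.
- rewrite a_Lf [0 + n]add0r v2 // L_0 scaler0 kron_neq ?mulr0 ?mul0r ?scale0r ?addr0 //; lia.
- by rewrite P_Lf [n + 0]addr0 v3 // L_0 scaler0 addr0.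
by rewrite y_Lf [n + 0]addr0 v4 // L_0 scaler0 addr0.
Qed.

Lemma field_module_hw : @hw_vector K cL cLa hw ha field_module vac.
Proof.
split=> [u|b b_pos||].
- by split=> //=; rewrite scale0r.
- case: b b_pos => //= n n_pos.
    by rewrite L_GG /GG !G_vac ?G_0 ?addr0 ?scaler0 //; lia.
  exact: G_vac.
- exact: L_vac.
exact: a0.
Qed.

(** The dual free fields read off the coefficients of the linear monomials. *)
Lemma field_module_dual (n : nat) (f : free_field) (x : M) b c :
  (0 < n)%N -> f = Fe \/ f = Fy -> abel_neg b -> abel_neg c ->
  vev (F f (if f is Fe then n%:Z else n.-1%:Z) (field_act b (field_act c x))) = 0.
Proof.
move=> n_gt0 f_eq b_neg c_neg.
have vc : vev (field_act c x) = 0.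
  by case: c c_neg => //= m m0; [exact: vev_a|exact: vev_P].
case: f_eq => ->; case: b b_neg => //= m m0.
- by rewrite e_a ?vevD ?vev_a ?vevZ ?vc ?mulr0 ?addr0 //; lia.
- by rewrite e_P vev_P.
- by rewrite -a_y vev_a.
by rewrite y_P vevD vevN vev_P // vevZ vc mulr0 oppr0 addr0.
Qed.

Lemma field_module_lead (n : nat) : (0 < n)%N ->
  [/\ vev (e n%:Z (a (- n%:Z) vac)) = 1,
      forall m : int, m < 0 -> vev (e n%:Z (P m vac)) = 0
    & vev (y n.-1%:Z (P (- n%:Z) vac)) = 1].
Proof.
move=> n_gt0; split=> [|m m0|].
- rewrite e_a; last by lia.
  by rewrite vac_e // mode0 add0r subrr kron0 scale1r.
- by rewrite e_P vev_P.
rewrite y_P vac_y // mode0 oppr0 add0r.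
have -> : n.-1%:Z - n%:Z + 1 = 0 by lia.
by rewrite kron0 scale1r.
Qed.

End FockRelations.

(** * The Fock space *)

Definition upd (I : eqType) (A : Type) (f : I -> A) (i : I) (t : A) : I -> A :=
  fun j => if j == i then t else f j.

Section Update.

Variables (I : eqType) (A : Type).
Implicit Types (f : I -> A) (i j : I) (s t : A).

Lemma upd_eq f i t : upd f i t i = t. Proof. by rewrite /upd eqxx. Qed.

Lemma upd_neq f i j t : j != i -> upd f i t j = f j.
Proof. by rewrite /upd => /negPf ->. Qed.

Lemma upd_upd f i s t : upd (upd f i s) i t = upd f i t.
Proof. by apply: funext => j; rewrite /upd; case: eqP. Qed.

Lemma upd_id f i : upd f i (f i) = f.
Proof. by apply: funext => j; rewrite /upd; case: eqP => [->|]. Qed.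

Lemma updC f i j s t : i != j -> upd (upd f i s) j t = upd (upd f j t) i s.
Proof.
move=> ne_ij; apply: funext => k; rewrite /upd.
by have [->|_] := eqVneq k j; rewrite // eq_sym (negPf ne_ij).
Qed.

End Update.

(** The labels of the bosonic oscillators are the nonzero integers, renumbered
    by all integers; those of the fermionic ones are all integers, renumbered by
    the natural numbers, whose order gives the signs. *)
Definition boson_label (n : int) : int := if 0 < n then n - 1 else n.

Definition fermion_label (n : int) : nat :=
  match n with Posz m => m.*2 | Negz m => m.*2.+1 end.

Lemma boson_label_inj m n : m != 0 -> n != 0 ->
  (boson_label m == boson_label n) = (m == n).
Proof. by rewrite /boson_label => *; do 2 case: ltP => ?; apply/eqP/eqP; lia. Qed.

Lemma fermion_label_inj m n : (fermion_label m == fermion_label n) = (m == n).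
Proof. by case: m => m; case: n => n /=; lia. Qed.

Section Fock.

Variables (K : numFieldType) (ha : K).

(** Occupation numbers of the bosonic and the fermionic oscillators. A vector
    of the Fock space is represented by its coefficients on them. *)
Definition config : Type := ((int -> nat) * (nat -> bool))%type.
Definition coeffs : Type := config -> K^o.

HB.instance Definition _ := GRing.Lmodule.on coeffs.

Definition fermion_count (b : nat -> bool) (n : nat) : nat := \sum_(0 <= k < n) b k.
Definition fermion_sign (b : nat -> bool) (i : nat) : K := (-1) ^+ odd (fermion_count b i).

Lemma count_upd b i n :
  odd (fermion_count (upd b i (~~ b i)) n) = odd (fermion_count b n) (+) (i < n)%N.
Proof.
elim: n => [|n IHn]; first by rewrite /fermion_count !big_geq.
rewrite /fermion_count !big_nat_recr //= -!/(fermion_count _ n) !oddD IHn ltnS.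
have [<-|ne_ni] := eqVneq n i.
  by rewrite upd_eq ltnn leqnn; case: (odd _); case: (b n).
rewrite upd_neq // [(i <= n)%N]leq_eqVlt eq_sym (negPf ne_ni) /=.
by rewrite addbAC.
Qed.

Lemma sgn_sqr b i : fermion_sign b i * fermion_sign b i = 1.
Proof. by rewrite /fermion_sign -expr2 sqrr_sign. Qed.

Lemma sgn_upd b i j : fermion_sign (upd b i (~~ b i)) j = (-1) ^+ (i < j)%N * fermion_sign b j.
Proof. by rewrite /fermion_sign count_upd signr_addb mulrC. Qed.

Definition lower_boson (i : int) (x : coeffs) : coeffs :=
  fun c => x (upd c.1 i (c.1 i).+1, c.2).

Definition raise_boson (i : int) (x : coeffs) : coeffs :=
  fun c => (c.1 i)%:R * x (upd c.1 i (c.1 i).-1, c.2).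

(** The creation ([s = true]) and annihilation ([s = false]) operators of a
    fermion. *)
Definition fermion (s : bool) (i : nat) (x : coeffs) : coeffs :=
  fun c => if c.2 i == s then fermion_sign c.2 i * x (c.1, upd c.2 i (~~ s)) else 0.

Lemma lower_bosonC i j x :
  lower_boson i (lower_boson j x) = lower_boson j (lower_boson i x).
Proof.
apply: funext => -[n b]; rewrite /lower_boson /=; congr (x (_, b)).
have [->|ne_ij] := eqVneq i j; first by [].
by rewrite (upd_neq _ _ (_ : j != i)) 1?eq_sym // (upd_neq _ _ ne_ij) updC.
Qed.

Lemma raise_bosonC i j x :
  raise_boson i (raise_boson j x) = raise_boson j (raise_boson i x).
Proof.
apply: funext => -[n b]; rewrite /raise_boson /=.
have [->|ne_ij] := eqVneq i j; first by [].
rewrite (upd_neq _ _ (_ : j != i)) 1?eq_sym // (upd_neq _ _ ne_ij) updC //.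
by rewrite mulrCA.
Qed.

Lemma lower_raise i j x : lower_boson i (raise_boson j x)
  = raise_boson j (lower_boson i x) + (i == j)%:R *: x.
Proof.
apply: funext => -[n b].
transitivity (raise_boson j (lower_boson i x) (n, b) + (i == j)%:R * x (n, b)); last by [].
rewrite /lower_boson /raise_boson /=.
have [->|ne_ij] := eqVneq i j.
  rewrite upd_eq upd_upd upd_eq upd_id upd_upd mul1r.
  case n_j: (n j) => [|m] /=; first by rewrite mul0r mul1r add0r.
  by rewrite -n_j upd_id -natr1 mulrDl mul1r n_j.
rewrite mul0r addr0.
by rewrite (upd_neq _ _ (_ : j != i)) 1?eq_sym // (upd_neq _ _ ne_ij) updC.
Qed.

Lemma fermionC s i t j x : fermion s i (fermion t j x)
  = - fermion t j (fermion s i x) + ((i == j) && (s != t))%:R *: x.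
Proof.
apply: funext => -[n b].
transitivity (- fermion t j (fermion s i x) (n, b)
  + ((i == j) && (s != t))%:R * x (n, b)); last by [].
rewrite /fermion /=; have [->|ne_ij] := eqVneq i j.
  rewrite !upd_eq !upd_upd; have [->|ne_st] := eqVneq s t.
    by rewrite mul0r addr0; case: t (b j) => [] [] /=; rewrite ?mulr0 oppr0.
  have -> : t = ~~ s by case: (s) (t) ne_st => [] [].
  rewrite negbK eqxx; have [b_j|] := eqVneq (b j) s.
    have -> : upd b j s = b by rewrite -b_j upd_id.
    have -> : upd b j (~~ s) = upd b j (~~ b j) by rewrite b_j.
    rewrite sgn_upd ltnn expr0 mul1r mulrA sgn_sqr mul1r b_j.
    by case: (s); rewrite /= oppr0 add0r.
  move=> ne_bs; have b_j : b j = ~~ s by case: (b j) (s) ne_bs => [] [].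
  have -> : upd b j (~~ s) = b by rewrite -b_j upd_id.
  have -> : upd b j s = upd b j (~~ b j) by rewrite b_j negbK.
  by rewrite eqxx sgn_upd ltnn expr0 mul1r mulrA sgn_sqr !mul1r b_j eqxx addNr.
rewrite mul0r addr0 (upd_neq _ _ (_ : j != i)) 1?eq_sym // (upd_neq _ _ ne_ij).
have [b_i|] := eqVneq (b i) s; have [b_j|] := eqVneq (b j) t;
  rewrite ?mulr0 ?oppr0 //.
rewrite -b_i -b_j !sgn_upd updC //; set y := x _.
have -> : (i < j)%N = ~~ (j < i)%N by lia.
by case: (j < i)%N => /=; ring.
Qed.

(** ** The free fields and the vacuum *)

Definition field_op (f : free_field) (n : int) (x : coeffs) : coeffs :=
  match f with
  | Fe => if n == 0 then 0
          else if 0 < n then lower_boson (boson_label n) x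
          else - raise_boson (boson_label n) x
  | Fa => if n == 0 then ha *: x
          else if n < 0 then raise_boson (boson_label (- n)) x
          else lower_boson (boson_label (- n)) x
  | FP => fermion (n < 0) (fermion_label (- n - 1)) x
  | Fy => fermion (n < 0) (fermion_label n) x
  end.

Lemma lower_boson_linear i : linear (lower_boson i).
Proof. by move=> c x z; apply: funext => -[n b]. Qed.

Lemma raise_boson_linear i : linear (raise_boson i).
Proof.
move=> c x z; apply: funext => -[n b].
transitivity (c * raise_boson i x (n, b) + raise_boson i z (n, b)); last by [].
rewrite /raise_boson -[(c *: x + z) _]/(c * x _ + z _); ring.
Qed.

Lemma fermion_linear s i : linear (fermion s i).
Proof.
move=> c x z; apply: funext => -[n b].
transitivity (c * fermion s i x (n, b) + fermion s i z (n, b)); last by [].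
rewrite /fermion -[(c *: x + z) _]/(c * x _ + z _); case: ifP => _; ring.
Qed.

Lemma field_op_linear f n : linear (field_op f n).
Proof.
move=> c x z; case: f => /=; [| | exact: fermion_linear | exact: fermion_linear].
  case: eqP => _; first by rewrite scaler0 addr0.
  case: ltP => _; first exact: lower_boson_linear.
  by rewrite raise_boson_linear opprD scalerN.
case: eqP => _; first by rewrite scalerDr !scalerA mulrC.
by case: ltP => _; [apply: raise_boson_linear|apply: lower_boson_linear].
Qed.

Definition vacuum : coeffs := fun c => if `[< c = (fun=> 0%N, fun=> false) >] then 1 else 0.

Inductive cyclic_vec : coeffs -> Prop :=
  | cyclic_vacuum : cyclic_vec vacuum
  | cyclic0 : cyclic_vec 0
  | cyclicD x z of cyclic_vec x & cyclic_vec z : cyclic_vec (x + z)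
  | cyclicZ c x of cyclic_vec x : cyclic_vec (c *: x)
  | cyclic_field f n x of cyclic_vec x : cyclic_vec (field_op f n x).

(** Coefficient functions of infinite support are discarded by restricting to
    what the free fields generate from the vacuum. *)
Definition cyclic_pred : {pred coeffs} := fun x => `[< cyclic_vec x >].

Lemma cyclic_submod : GRing.submod_closed cyclic_pred.
Proof.
split=> [|c x z /asboolP cx /asboolP cz]; first by apply/asboolP; apply: cyclic0.
by apply/asboolP; apply: cyclicD => //; apply: cyclicZ.
Qed.

HB.instance Definition _ :=
  GRing.isSubmodClosed.Build K coeffs cyclic_pred cyclic_submod.

Definition fock : Type := {x : coeffs | x \in cyclic_pred}.

HB.instance Definition _ := SubChoice.on fock.
HB.instance Definition _ := [SubChoice_isSubLmodule of fock by <:].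

Section RawRelations.

Implicit Types (m n : int) (x : coeffs).

Let opZ f n c x : field_op f n (c *: x) = c *: field_op f n x.
Proof. by case: (linear_split (field_op_linear f n)). Qed.

Let lowerN i x : lower_boson i (- x) = - lower_boson i x. Proof. by []. Qed.
Let raiseN i x : raise_boson i (- x) = - raise_boson i x.
Proof.
by apply: funext => -[n b]; exact: mulrN.
Qed.

Let lower0 i : lower_boson i 0 = 0. Proof. by []. Qed.
Let raise0 i : raise_boson i 0 = 0.
Proof. by apply: funext => -[k b]; exact: mulr0. Qed.
Let lowerZ i c x : lower_boson i (c *: x) = c *: lower_boson i x. Proof. by []. Qed.
Let raiseZ i c x : raise_boson i (c *: x) = c *: raise_boson i x.
Proof. by case: (linear_split (raise_boson_linear i)). Qed.

Let lower_raise_neq i j x : (i == j) = false ->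
  lower_boson i (raise_boson j x) = raise_boson j (lower_boson i x).
Proof. by move=> ne_ij; rewrite lower_raise ne_ij scale0r addr0. Qed.

Lemma op_eC m n x : field_op Fe m (field_op Fe n x) = field_op Fe n (field_op Fe m x).
Proof.
rewrite /=; have [m0|m0|m0] := ltgtP m 0; have [n0|n0|n0] := ltgtP n 0;
  rewrite ?lower0 ?raise0 ?oppr0 ?raiseN ?lowerN //.
- by rewrite raise_bosonC.
- by rewrite lower_raise_neq // boson_label_inj; lia.
- by rewrite lower_raise_neq // boson_label_inj; lia.
by rewrite lower_bosonC.
Qed.

Lemma op_aC m n x : field_op Fa m (field_op Fa n x) = field_op Fa n (field_op Fa m x).
Proof.
rewrite /=; have [m0|m0|m0] := ltgtP m 0; have [n0|n0|n0] := ltgtP n 0;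
  rewrite ?lowerZ ?raiseZ //.
- by rewrite raise_bosonC.
- by rewrite lower_raise_neq // boson_label_inj; lia.
- by rewrite lower_raise_neq // boson_label_inj; lia.
by rewrite lower_bosonC.
Qed.

Lemma op_ea m n x : m != 0 -> field_op Fe m (field_op Fa n x)
  = field_op Fa n (field_op Fe m x) + kron K (m + n) *: x.
Proof.
move=> nz_m; have [n0|nz_n] := eqVneq n 0.
  by rewrite n0 addr0 kron_neq // scale0r addr0 [field_op Fa 0 x]/= opZ.
have kronE : kron K (m + n) = (m == - n)%:R.
  by rewrite /kron; congr (nat_of_bool _)%:R; lia.
have nz_Nn : - n != 0 by rewrite oppr_eq0.
rewrite kronE /= (negPf nz_m) (negPf nz_n).
have [m0|m0] := ltP 0 m; have [n0|n0] := ltP n 0.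
- by rewrite lower_raise boson_label_inj.
- have -> : (m == - n) = false by lia.
  by rewrite lower_bosonC scale0r addr0.
- have -> : (m == - n) = false by lia.
  by rewrite raise_bosonC raiseN scale0r addr0.
rewrite lowerN lower_raise boson_label_inj // eq_sym opprD.
by rewrite -addrA addNr addr0.
Qed.

Lemma op_PC m n x : field_op FP m (field_op FP n x) = - field_op FP n (field_op FP m x).
Proof.
rewrite /= fermionC fermion_label_inj.
have [e_mn|] := eqVneq (- m - 1) (- n - 1); last by rewrite scale0r addr0.
have -> : m = n by lia.
by rewrite eqxx scale0r addr0.
Qed.

Lemma op_yC m n x : field_op Fy m (field_op Fy n x) = - field_op Fy n (field_op Fy m x).
Proof.
rewrite /= fermionC fermion_label_inj.
have [->|] := eqVneq m n; last by rewrite scale0r addr0.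
by rewrite eqxx scale0r addr0.
Qed.

Lemma op_yP m n x : field_op Fy m (field_op FP n x)
  = - field_op FP n (field_op Fy m x) + kron K (m + n + 1) *: x.
Proof.
rewrite /= fermionC fermion_label_inj; congr (_ + _%:R *: x).
by rewrite /=; apply/eqP/eqP; have [] := ltP m 0; have [] := ltP n 0; lia.
Qed.

Definition bosonic (f : free_field) : bool :=
  match f with Fe | Fa => true | _ => false end.

Lemma op_boson_fermion f g m n x : bosonic f -> ~~ bosonic g ->
  field_op f m (field_op g n x) = field_op g n (field_op f m x).
Proof.
have lowC i s j z : lower_boson i (fermion s j z) = fermion s j (lower_boson i z) by [].
have raiC i s j z : raise_boson i (fermion s j z) = fermion s j (raise_boson i z).
  apply: funext => -[k b]; rewrite /raise_boson /fermion /=.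
  by case: ifP => _; rewrite ?mulr0 // mulrCA.
have ferZ s j c z : fermion s j (c *: z) = c *: fermion s j z.
  by case: (linear_split (fermion_linear s j)).
have fer0 s j : fermion s j 0 = 0 by case: (linear_split (fermion_linear s j)).
have ferN s j z : fermion s j (- z) = - fermion s j z by rewrite -scaleN1r ferZ scaleN1r.
by case: f => // _; case: g => // _ /=; do 2?case: ifP => _;
   rewrite ?fer0 ?raiC ?ferN ?ferZ ?lowC.
Qed.

Lemma op_vacuum f n : (if bosonic f then 0 < n else 0 <= n) -> field_op f n vacuum = 0.
Proof.
have low i : lower_boson i vacuum = 0.
  apply: funext => -[k b]; rewrite /lower_boson /vacuum /=.
  case: asboolP => // -[ki _]; have := congr1 (fun g => g i) ki.
  by rewrite upd_eq.
have ann j : fermion false j vacuum = 0.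
  apply: funext => -[k b]; rewrite /fermion /vacuum /=.
  case: eqP => // _; case: asboolP => [[_ bj]|]; last by rewrite mulr0.
  by have := congr1 (fun g => g j) bj; rewrite upd_eq.
case: f => /= n0; last 2 first.
- have -> : (n < 0) = false by lia.
  exact: ann.
- have -> : (n < 0) = false by lia.
  exact: ann.
- have -> : (n == 0) = false by lia.
  by rewrite n0.
have -> : (n == 0) = false by lia.
by have -> : (n < 0) = false by lia.
Qed.

Definition vacuum_coef (x : coeffs) : K := x (fun=> 0%N, fun=> false).

Lemma vacuum_coef_op f n x : n < 0 -> vacuum_coef (field_op f n x) = 0.
Proof.
move=> n0; rewrite /vacuum_coef; case: f => /=.
- have -> : (n == 0) = false by lia.
  have -> : (0 < n) = false by lia.
  by rewrite -[LHS]/(- (_ * _)) /= mul0r oppr0.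
- have -> : (n == 0) = false by lia.
  by rewrite n0 /raise_boson /= mul0r.
- by rewrite n0 /fermion.
by rewrite n0 /fermion.
Qed.

Lemma vacuum_coef_vacuum : vacuum_coef vacuum = 1.
Proof. by rewrite /vacuum_coef /vacuum; case: asboolP. Qed.

(** A configuration other than the empty one is occupied by some oscillator, and
    the annihilation operator of that oscillator reads off its coefficient. *)
Lemma vacuum_unique x :
  (forall f n, (if bosonic f then 0 < n else 0 <= n) -> field_op f n x = 0) ->
  x = vacuum_coef x *: vacuum.
Proof.
move=> x_pos; apply: funext => -[k b].
rewrite -[RHS]/(_ * _) /vacuum /=; case: asboolP => [[-> ->]|ne]; first by rewrite mulr1.
rewrite mulr0; have [[i k_i]|k0] := pselect (exists i, k i <> 0%N).
  have low : lower_boson i x = 0.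
    have [i0|i0] := ltP i 0.
      have := x_pos Fa (- i) _; rewrite /= opprK /boson_label.
      have -> : (- i == 0) = false by lia.
      have -> : (- i < 0) = false by lia.
      by rewrite ifF; [apply; lia|lia].
    have := x_pos Fe (i + 1) _; rewrite /= /boson_label.
    have -> : (i + 1 == 0) = false by lia.
    have -> : 0 < i + 1 by lia.
    by rewrite addrK; apply.
  have := congr1 (fun y : coeffs => y (upd k i (k i).-1, b)) low.
  rewrite /lower_boson /= upd_eq upd_upd prednK ?upd_id //; lia.
have [[i b_i]|b0] := pselect (exists i, b i = true); last first.
  case: ne; congr (_, _); apply: funext => i.
    by apply: contrapT => k_i; apply: k0; exists i.
  by apply/negbTE/negP => b_i; apply: b0; exists i.
have ann : fermion false i x = 0.
  have [io|ie] := boolP (odd i).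
    have := x_pos FP i./2%:Z _ => /=.
    have -> : (Posz i./2 < 0) = false by lia.
    have -> : - Posz i./2 - 1 = Negz i./2 by lia.
    have -> : fermion_label (Negz i./2) = i.
      by rewrite /= -[RHS]odd_double_half io.
    by apply.
  have := x_pos Fy i./2%:Z _ => /=.
  have -> : (Posz i./2 < 0) = false by lia.
  have -> : i./2.*2 = i by rewrite -[RHS]odd_double_half (negPf ie).
  by apply.
have := congr1 (fun y : coeffs => y (k, upd b i false)) ann.
rewrite /fermion /= upd_eq eqxx upd_upd.
have -> : upd b i (~~ false) = b by rewrite -[RHS](upd_id b i) b_i.
move/eqP; rewrite mulf_eq0 => /orP[|/eqP //].
by rewrite /fermion_sign signr_eq0.
Qed.

(** Configurations with infinitely many fermions have no parity and are left
    unconstrained. *)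
Definition has_parity (t : bool) (x : coeffs) : Prop :=
  forall (c : config) N, (forall i, (N <= i)%N -> c.2 i = false) ->
    odd (fermion_count c.2 N) != t -> x c = 0.

Lemma has_parity_sub t : [/\ has_parity t 0,
  forall x z, has_parity t x -> has_parity t z -> has_parity t (x + z)
  & forall c x, has_parity t x -> has_parity t (c *: x)].
Proof.
split=> // [x z px pz c N cN ct|u x px c N cN ct].
  by rewrite -[LHS]/(x c + z c) (px c N) // (pz c N) // addr0.
by rewrite -[LHS]/(u * x c) (px c N) // mulr0.
Qed.

Lemma has_parity_vacuum : has_parity false vacuum.
Proof.
move=> c N cN; rewrite /vacuum; case: asboolP => // ->.
by rewrite /fermion_count /= big1.
Qed.

Lemma has_parity_op t f n x : has_parity t x ->
  has_parity (if bosonic f then t else ~~ t) (field_op f n x).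
Proof.
move=> px; have [p0 pD pZ] := has_parity_sub t.
have low i : has_parity t (lower_boson i x).
  by move=> c N cN ct; apply: (px _ N).
have rai i : has_parity t (raise_boson i x).
  by move=> c N cN ct; rewrite /raise_boson (px _ N) ?mulr0.
have fer s i : has_parity (~~ t) (fermion s i x).
  move=> c N cN ct; rewrite /fermion; case: eqP => // c_i.
  rewrite (px _ (maxn N i.+1)) ?mulr0 //=.
    move=> j le_j; rewrite upd_neq; [apply: cN|]; lia.
  rewrite -c_i count_upd; have -> : (i < maxn N i.+1)%N by lia.
  have -> : fermion_count c.2 (maxn N i.+1) = fermion_count c.2 N.
    rewrite /fermion_count (big_cat_nat (n := N)) //=; last by lia.
    rewrite [X in (_ + X)%N]big_nat [X in (_ + X)%N]big1 ?addn0 // => j j_N.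
    by rewrite cN //; lia.
  by case: (odd _) t ct {px p0 pD pZ low rai} => [] [].
case: f => /=; [| |exact: fer|exact: fer].
  case: ifP => _; first exact: p0.
  by case: ifP => _ //; rewrite -scaleN1r; apply: (pZ).
by case: ifP => _; [apply: (pZ)|case: ifP].
Qed.

End RawRelations.

(** ** The cyclic module of the vacuum *)

Definition fock_val (x : fock) : coeffs := val x.

Lemma fock_val_inj : injective fock_val. Proof. exact: val_inj. Qed.

Lemma fock_op_proof f n (x : fock) : field_op f n (fock_val x) \in cyclic_pred.
Proof. by apply/asboolP; apply: cyclic_field; apply/asboolP; apply: (valP x). Qed.

Definition fock_op_fun f n (x : fock) : fock :=
  exist (fun y : coeffs => y \in cyclic_pred) _ (fock_op_proof f n x).

Lemma fock_op_linear f n : linear (fock_op_fun f n).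
Proof. by move=> c x z; apply: fock_val_inj; apply: field_op_linear. Qed.

HB.instance Definition _ f n :=
  GRing.isLinear.Build K fock fock _ (fock_op_fun f n) (fock_op_linear f n).

Definition fock_op f n : {linear fock -> fock} := fock_op_fun f n.

Lemma fock_opE f n x : fock_val (fock_op f n x) = field_op f n (fock_val x).
Proof. by []. Qed.

Lemma fock_vacuum_proof : vacuum \in cyclic_pred.
Proof. by apply/asboolP; apply: cyclic_vacuum. Qed.

Definition fock_vacuum : fock := exist (fun y : coeffs => y \in cyclic_pred) _ fock_vacuum_proof.

Lemma fock_cyclic (Q : fock -> Prop) :
  Q 0 -> (forall x z, Q x -> Q z -> Q (x + z)) -> (forall c x, Q x -> Q (c *: x)) ->
  Q fock_vacuum -> (forall f n x, Q x -> Q (fock_op f n x)) -> forall x, Q x.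
Proof.
move=> Q0 QD QZ Qv Qop [x x_in]; have cx : cyclic_vec x by apply/asboolP.
suff [z [zx Qz]] : exists z : fock, fock_val z = x /\ Q z.
  by have <- : z = exist (fun y : coeffs => y \in cyclic_pred) x x_in by apply: fock_val_inj.
elim: cx => {x x_in} [||x z _ [x' [<- Qx]] _ [z' [<- Qz]]|c x _ [x' [<- Qx]]|f n x _ [x' [<- Qx]]].
- by exists fock_vacuum.
- by exists 0.
- by exists (x' + z'); split; [|apply: QD].
- by exists (c *: x'); split; [|apply: QZ].
by exists (fock_op f n x'); split; [|apply: Qop].
Qed.

End Fock.

(** By the universal property of the Verma module, [l1] and [l2] become linear
    forms on it that separate [alpha(-p) v] and [Psi(-p/2) v] from products of
    several letters; this is what is used of the linear independence of PBW
    monomials. The parameters [mu] and [nu] are solved for from the central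
    charge and from the weight of the vacuum. *)
Theorem free_field_realization (K : numFieldType) (cL cLa r : K) (h : nat)
    (p := h.*2.+1) : cLa != 0 ->
  exists (W : shModule K) (m : W) (l1 l2 : {linear W -> K^o}),
  [/\ hw_vector cL cLa (h_pr cL p%:R r) ((1 + p%:R) * cLa) m,
      forall b b' x, abel_neg b -> abel_neg b' ->
        l1 (sh_act W b (sh_act W b' x)) = 0 /\ l2 (sh_act W b (sh_act W b' x)) = 0
    & [/\ l1 (sh_act W (shAlpha (- p%:Z)) m) = 1,
          l1 (sh_act W (shPsi (- h.+1%:Z)) m) = 0
        & l2 (sh_act W (shPsi (- h.+1%:Z)) m) = 1]].
Proof.
move=> nz_cLa; pose ha := (1 + p%:R) * cLa.
pose F := @fock_op K ha; pose vac := fock_vacuum ha.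
pose vev (x : fock ha) := vacuum_coef (fock_val x).
pose par t (x : fock ha) := has_parity t (fock_val x).
pose mu := (cL - 3) / (12 * cLa); pose nu := (- r - p%:R * ((cL - 3) / 24)) / cLa.
have val := @fock_val_inj K ha.
have eC m n x : F Fe m (F Fe n x) = F Fe n (F Fe m x) by apply: val; apply: op_eC.
have aC m n x : F Fa m (F Fa n x) = F Fa n (F Fa m x) by apply: val; apply: op_aC.
have e_a m n x : m != 0 -> F Fe m (F Fa n x) = F Fa n (F Fe m x) + kron K (m + n) *: x.
  by move=> nz_m; apply: val; apply: op_ea.
have a0 x : F Fa 0 x = ha *: x by apply: val.
have e0 x : F Fe 0 x = 0 by apply: val.
have PC m n x : F FP m (F FP n x) = - F FP n (F FP m x) by apply: val; apply: op_PC.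
have yC m n x : F Fy m (F Fy n x) = - F Fy n (F Fy m x) by apply: val; apply: op_yC.
have y_P m n x : F Fy m (F FP n x) = - F FP n (F Fy m x) + kron K (m + n + 1) *: x.
  by apply: val; apply: op_yP.
have bf f g m n x : bosonic f -> ~~ bosonic g -> F f m (F g n x) = F g n (F f m x).
  by move=> *; apply: val; apply: op_boson_fermion.
have vac_pos (n : int) : [/\ 0 < n -> F Fe n vac = 0, 0 < n -> F Fa n vac = 0,
    0 <= n -> F FP n vac = 0 & 0 <= n -> F Fy n vac = 0].
  by split=> n0; apply: val; apply: op_vacuum.
have vev_lin c x z : vev (c *: x + z) = c * vev x + vev z by [].
have vev_neg (n : int) x : n < 0 ->
    [/\ vev (F Fe n x) = 0, vev (F Fa n x) = 0, vev (F FP n x) = 0 & vev (F Fy n x) = 0].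
  by move=> n0; split; apply: vacuum_coef_op.
have vac_uniq x : (forall n : int, [/\ 0 < n -> F Fe n x = 0, 0 < n -> F Fa n x = 0,
      0 <= n -> F FP n x = 0 & 0 <= n -> F Fy n x = 0]) -> x = vev x *: vac.
  move=> x_pos; apply: val; apply: (@vacuum_unique K ha) => f n n0.
  have [x1 x2 x3 x4] := x_pos n.
  by rewrite -fock_opE -/F; case: f n0 => /= n0; rewrite ?x1 ?x2 ?x3 ?x4.
have cyc (Q : fock ha -> Prop) : Q 0 -> (forall x z, Q x -> Q z -> Q (x + z)) ->
    (forall c x, Q x -> Q (c *: x)) -> Q vac ->
    (forall n x, Q x -> [/\ Q (F Fe n x), Q (F Fa n x), Q (F FP n x) & Q (F Fy n x)]) ->
    forall x, Q x.
  move=> Q0 QD QZ Qv Qop; apply: fock_cyclic => // f n x /(Qop n)[].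
  by case: f.
have par_sub t : [/\ par t 0, forall x z, par t x -> par t z -> par t (x + z)
    & forall c x, par t x -> par t (c *: x)].
  have [p0 pD pZ] := @has_parity_sub K t.
  by split=> // [x z|c x]; [apply: pD|apply: pZ].
have par_vac : par false vac by apply: has_parity_vacuum.
have par_op t n x : par t x -> [/\ par t (F Fe n x), par t (F Fa n x),
    par (~~ t) (F FP n x) & par (~~ t) (F Fy n x)].
  move=> px; split; first exact: (@has_parity_op K ha t Fe).
  - exact: (@has_parity_op K ha t Fa).
  - exact: (@has_parity_op K ha t FP).
  exact: (@has_parity_op K ha t Fy).
have par_vev x : par true x -> vev x = 0.
  by move=> px; apply: (px _ 0%N) => //; rewrite /fermion_count big_geq.
have e_P m n x : F Fe m (F FP n x) = F FP n (F Fe m x) by apply: bf.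
have e_y m n x : F Fe m (F Fy n x) = F Fy n (F Fe m x) by apply: bf.
have a_P m n x : F Fa m (F FP n x) = F FP n (F Fa m x) by apply: bf.
have a_y m n x : F Fa m (F Fy n x) = F Fy n (F Fa m x) by apply: bf.
have vev_vac : vev vac = 1 by apply: vacuum_coef_vacuum.
have nz2 : (2 : K) != 0 by rewrite pnatr_eq0.
have mu_cL : 1 + 4 * mu * cLa = cL / 3 by rewrite /mu; field.
have mu_hw : mu * cLa + 2 * nu * (ha - cLa) = 2 * h_pr cL p%:R r.
  by rewrite /mu /nu /ha /h_pr; field.
pose W := field_module eC aC e_a a0 e0 PC yC y_P e_P e_y a_P a_y vac_pos vev_lin
  vev_vac vev_neg vac_uniq cyc par_sub par_vac par_op par_vev mu_cL mu_hw.
have dual f (n : nat) x b b' : (0 < n)%N -> f = Fe \/ f = Fy ->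
    abel_neg b -> abel_neg b' ->
    vev (F f (if f is Fe then n%:Z else n.-1%:Z) (sh_act W b (sh_act W b' x))) = 0.
  exact: (field_module_dual cL cLa eC aC e_a e0 PC yC y_P e_P e_y a_P a_y vac_pos
    vev_lin vev_neg cyc mu nu).
have [lead1 lead2 _] := field_module_lead e_a y_P e_P vac_pos vev_vac vev_neg (ltn0Sn h.*2).
have [_ _ lead3] := field_module_lead e_a y_P e_P vac_pos vev_vac vev_neg (ltn0Sn h).
have lin f (n : int) : linear (fun x : W => vev (F f n x) : K^o).
  by move=> c x z; rewrite linearP.
pose form f n : {linear W -> K^o} := HB.pack (fun x : W => vev (F f n x) : K^o)
  (GRing.isLinear.Build K W K^o *:%R _ (lin f n)).
exists W, vac, (form Fe p%:Z), (form Fy h%:Z); split.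
- exact: field_module_hw.
- move=> b b' x b_neg b'_neg; split; first by apply: (dual Fe p) => //; left.
  by apply: (dual Fy h.+1) => //; right.
by split; [exact: lead1|exact: lead2|exact: lead3].
Qed.

(** * The maximal submodule *)

Section MaximalSubmodule.

Variables (K : numFieldType) (cL cLa r : K) (h : nat) (V : shModule K) (v : V).
Local Notation p := h.*2.+1.
Local Notation ha := ((1 + p%:R) * cLa).
Hypothesis cLa_neq0 : cLa != 0.
Hypothesis V_verma : verma_pr cL cLa p%:R r v.

Local Notation L n := (sh_act V (shL n)).
Local Notation al n := (sh_act V (shAlpha n)).
Local Notation G n := (sh_act V (shG n)).
Local Notation Psi n := (sh_act V (shPsi n)).
Local Notation S t k := (@schur_alpha K cLa V t k).
Local Notation T e := (@dressed_Psi K cLa V e).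
Local Notation u := (sing_vec cLa h v).
Local Notation w := (sub_vec cLa h v).

Let v_hw : hw_vector cL cLa (h_pr cL p%:R r) ha v. Proof. by case: V_verma. Qed.
Let v_gen : generated v = setT. Proof. by case: V_verma. Qed.
Let V0 : level_zero cLa V. Proof. exact: hw_level_zero v_hw. Qed.

Let v_inert : inert ha v.
Proof. by case: v_hw => _ pos _ al0; split=> // n n0; apply: pos. Qed.

Let G_v (j : nat) : G j%:Z v = 0.
Proof. by case: v_hw => _ pos _ _; apply: pos. Qed.

(** ** Submodules induced from the negative [alpha]s and [Psi]s *)

Section Induced.

Variable B : V -> Prop.
Hypothesis B_inert : forall x, B x -> inert ha x.
Hypothesis B_G : forall (j : nat) x, B x -> opspan abel_neg B (G j%:Z x).
Hypothesis B_homog : forall x, B x -> exists d, homog v d x.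

Lemma opspan_inert x : opspan abel_neg B x -> inert ha x.
Proof.
apply: opspan_sub => // [|b y /abel_neg_abel b_ab]; first exact: inert_subspace.
exact: inert_abel.
Qed.

Lemma opspan_abel b x : abel b -> opspan abel_neg B x -> opspan abel_neg B (sh_act V b x).
Proof.
move=> b_ab ox; have [al_x Psi_x al0_x] := opspan_inert ox.
have [b_neg|b_pos] := boolP (abel_neg b); first exact: opspan_act.
case: b b_ab b_pos => //= n _ n_ge0; last by rewrite Psi_x; [exact: opspan0|lia].
have [->|nz_n] := eqVneq n 0; first by rewrite al0_x; apply: opspanZ.
by rewrite al_x; [exact: opspan0|lia].
Qed.

Lemma induced_singular (Z : V -> Prop) x : subspace Z ->
  (forall b y, Z y -> Z (sh_act V b y)) -> opspan ns_neg (opspan abel_neg B) x ->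
  (forall b, abel_pos b -> Z (sh_act V b x)) ->
  exists y z, [/\ opspan abel_neg B y, Z z & x = y + z].
Proof.
exact: (abel_singular cLa_neq0 V0 (opspan_subspace _ _) opspan_inert opspan_abel).
Qed.

Lemma opspan_G (j : nat) x : opspan abel_neg B x -> opspan abel_neg B (G j%:Z x).
Proof.
elim=> {x} [x /B_G//||x y _ IHx _ IHy|a x _ IHx|b x b_neg ox IHx].
- by rewrite act0; apply: opspan0.
- by rewrite actD; apply: opspanD.
- by rewrite actZ; apply: opspanZ.
have [_ oD oZ] := opspan_subspace abel_neg B.
have ob := opspan_act b_neg IHx; case: b b_neg ob => // n n_neg ob.
  rewrite G_alpha; apply: (oD) => //; rewrite -scaleNr; apply: (oZ).
  exact: opspan_abel.
rewrite (G_Psi V0); apply: (oD); last exact: (oZ).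
apply: (oD); first by rewrite -scaleN1r; apply: (oZ).
exact: opspan_abel.
Qed.

Lemma opspan_nonneg b x : ~~ ns_neg b -> opspan abel_neg B x ->
  opspan abel_neg B (sh_act V b x).
Proof.
have [_ oD oZ] := opspan_subspace abel_neg B.
case: b => [n|n|n|n|||] /= n_ge0 ox.
- have [n0|nz_n] := eqVneq n 0; last first.
    rewrite (L_of_G _ nz_n); apply: (oZ).
    have -> : n - 1 = `|n|.-1%:Z by lia.
    by apply: (oD); do 2 apply: (opspan_G); rewrite // -[0]/(0%N%:Z).
  rewrite n0; elim: ox => {x} [x Bx||x y _ IHx _ IHy|a x _ IHx|b x b_neg ox IHx].
  + by have [d hx] := B_homog Bx; rewrite (L0_homog v_hw hx); apply: (oZ); apply: opspan_base.
  + by rewrite act0; apply: opspan0.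
  + by rewrite actD; apply: (oD).
  + by rewrite actZ; apply: (oZ).
  rewrite (L0_act v_hw); last by case: b b_neg => //= m; lia.
  by apply: (oD); [apply: opspan_act|apply: (oZ); apply: opspan_act].
- exact: opspan_abel.
- by have -> : n = `|n|%N%:Z by [lia]; apply: opspan_G.
- exact: opspan_abel.
- by case: v_hw => cent _ _ _; case: (cent x) => -> _ _; apply: (oZ).
- by case: (V0 x) => -> _; apply: opspan0.
by case: (V0 x) => _ ->; apply: (oZ).
Qed.

(** The negative [L]s and [G]s can be made to act last: by [opspan_stable], all
    other operators can be moved past them, and these preserve [U(abel_neg) B]. *)
Lemma induced_submodule : submodule (opspan ns_neg (opspan abel_neg B)).
Proof.
have [o0 oD oZ] := opspan_subspace ns_neg (opspan abel_neg B).
split=> // b x ox; have [b_neg|b_pos] := boolP (ns_neg b); first exact: opspan_act.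
apply: (opspan_stable (B := fun c => ~~ ns_neg c)) ox => //.
  by move=> c c' t _ _ _; apply: orbN.
by move=> c y c_pos oy; apply: opspan_base; apply: opspan_nonneg.
Qed.

End Induced.

(** ** The submodules generated by [u] and by [w] *)

Lemma opspan_schur B t k x : opspan abel_neg B x -> opspan abel_neg B (S t k x).
Proof.
move=> ox; elim/ltn_ind: k => [[|k]] IHk; first by rewrite schur_alpha0.
have nz_k : k.+1%:R != 0 :> K by rewrite pnatr_eq0.
rewrite -[S t k.+1 x](scalerK nz_k) (schur_alpha_rec V0); apply: opspanZ.
rewrite big_nat; apply: subspace_sum; first exact: opspan_subspace.
move=> n n_k; apply: opspanZ; apply: opspan_act; last by apply: IHk; lia.
by rewrite /=; lia.
Qed.

Lemma homog_schur t k d x : homog v d x -> homog v (d + (2 * k)%N%:Z) (S t k x).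
Proof.
move=> hx; elim/ltn_ind: k => [[|k]] IHk; first by rewrite schur_alpha0 addr0.
have nz_k : k.+1%:R != 0 :> K by rewrite pnatr_eq0.
rewrite -[S t k.+1 x](scalerK nz_k) (schur_alpha_rec V0); apply: homogZ.
rewrite big_nat; apply: subspace_sum; first exact: homog_subspace.
move=> n n_k; apply: homogZ.
have hn := IHk (k.+1 - n)%N; apply: (homog_act (b := shAlpha (- n%:Z)) _ (hn _)) => /=; lia.
Qed.

Lemma homog_dressed e d x : homog v d x -> homog v (d + (2 * e)%N%:Z - 1) (T e x).
Proof.
move=> hx; rewrite /dressed_Psi big_nat; apply: subspace_sum.
  exact: homog_subspace.
move=> i i_e; apply: (homog_act (b := shPsi (i%:Z - e%:Z)) _ (homog_schur 2 i hx)) => /=; lia.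
Qed.

Lemma homog_sing : homog v p%:Z u.
Proof.
have := homog_dressed h.+1 (homog_hw v); rewrite /sing_vec; congr (homog v _ _); lia.
Qed.

Lemma homog_sub : homog v (2 * p)%N%:Z w.
Proof.
apply: homogD.
  by have := homog_schur 1 p (homog_hw v); rewrite add0r.
apply: homogZ; rewrite big_nat; apply: subspace_sum; first exact: homog_subspace.
move=> k k_h; apply: homogZ.
have := homog_dressed (h.+1 - k) (homog_dressed (h.+1 + k) (homog_hw v)).
congr (homog v _ _); lia.
Qed.

Let u_inert : inert ha u := inert_sing_vec V0 v_inert.
Let w_inert : inert ha w := inert_sub_vec V0 v_inert.
Let G_u (j : nat) : G j%:Z u = 0 := G_sing_vec cLa_neq0 V0 v_inert G_v j.

Lemma G_w (j : nat) : opspan abel_neg (eq u) (G j%:Z w).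
Proof.
rewrite (G_sub_vec cLa_neq0 V0 v_inert G_v); apply: opspanZ.
case: ifP => _; last exact: opspan0.
by apply: opspan_schur; apply: opspan_base.
Qed.

Lemma u_of_w : u = (- cLa) *: G h%:Z w.
Proof.
rewrite (G_sub_vec cLa_neq0 V0 v_inert G_v) leqnn subnn schur_alpha0.
by rewrite scalerA mulrNN divff // scale1r.
Qed.

(** The spanning half of the PBW theorem. *)
Lemma triangular x : opspan ns_neg (opspan abel_neg (eq v)) x.
Proof.
have sub : submodule (opspan ns_neg (opspan abel_neg (eq v))).
  apply: induced_submodule => [_ <-|j _ <-|_ <-] //; last by exists 0; apply: homog_hw.
  by rewrite G_v; apply: opspan0.
have : generated v x by rewrite v_gen.
by apply; split=> // _ ->; do 2 apply: opspan_base.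
Qed.

Let Nu : set V := opspan ns_neg (opspan abel_neg (eq u)).

Lemma Nu_submodule : submodule Nu.
Proof.
apply: induced_submodule => [_ <-|j _ <-|_ <-] //.
- by rewrite G_u; apply: opspan0.
by exists p%:Z; apply: homog_sing.
Qed.

(** ** Subsingularity *)

(** The linear forms of the free field realization, pulled back to the Verma
    module. *)
Lemma separating_forms : exists l1 l2 : {linear V -> K^o},
  (forall d x, monomials v 2 d x -> l1 x = 0 /\ l2 x = 0) /\
  [/\ l1 (al (- p%:Z) v) = 1, l1 (Psi (- h.+1%:Z) v) = 0
    & l2 (Psi (- h.+1%:Z) v) = 1].
Proof.
have [W [m [l1 [l2 [m_hw l_neg [l1a l1P l2P]]]]]] :=
  free_field_realization cL r h cLa_neq0.
have [_ _ /(_ W m m_hw)[f [f_hom fv]]] := V_verma.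
exists (l1 \o f), (l2 \o f); split=> [d x mx|] /=; last by rewrite !f_hom fv.
pose Q x := l1 (f x) = 0 /\ l2 (f x) = 0.
have sQ : subspace Q.
  split=> [|y z [y1 y2] [z1 z2]|c y [y1 y2]]; rewrite /Q ?linear0 //.
    by rewrite !linearD y1 y2 z1 z2 addr0.
  by rewrite !linearZ /= y1 y2 scaler0.
pose P1 x := opspan pred0 (fun y => exists2 b, abel_neg b & exists z, y = sh_act V b z) x.
suff ind k : monomials v k d x -> ((1 <= k)%N -> P1 x) /\ ((2 <= k)%N -> Q x).
  by case: (ind _ mx) => _; apply.
elim=> {mx k d x} [k d|d|k d x y _ [x1 x2] _ [y1 y2]|k d c x _ [x1 x2]
  |k d k' d' b x b_neg _ [x1 _] le_k _].
- by split=> _; [apply: opspan0|case: sQ].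
- by split.
- split=> k0; first by apply: opspanD; [apply: x1|apply: y1].
  by case: sQ => _ QD _; apply: QD; [apply: x2|apply: y2].
- split=> k0; first by apply: opspanZ; apply: x1.
  by case: sQ => _ _ QZ; apply: QZ; apply: x2.
split=> k0; first by apply: opspan_base; exists b => //; exists x.
have {}x1 : P1 x by apply: x1; lia.
elim: x1 => {x} [_ [b' b'_neg [z ->]]||y z _ Qy _ Qz|c y _ Qy|//].
- by rewrite /Q !f_hom; apply: l_neg.
- by rewrite act0; case: sQ.
- by rewrite actD; case: sQ => _ QD _; apply: QD.
by rewrite actZ; case: sQ => _ _ QZ; apply: QZ.
Qed.

Lemma v_neq0 : v <> 0.
Proof.
have [l1 [l2 [_ [l1a _ _]]]] := separating_forms.
by move=> v0; move/eqP: l1a; rewrite v0 act0 linear0 eq_sym oner_eq0.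
Qed.

Lemma u_neq0 : u <> 0.
Proof.
have [l1 [l2 [l_mon [_ _ l2P]]]] := separating_forms.
move=> u0; have := sing_vec_lead h v V0; rewrite u0 sub0r => /l_mon[_].
by rewrite linearN /= l2P => /eqP; rewrite oppr_eq0 oner_eq0.
Qed.

(** Modulo monomials with several factors, [w] is a multiple of [alpha(-p) v]
    and all polynomial multiples of [u] are multiples of [Psi(-p/2) v]. *)
Lemma w_notin_u : ~ opspan abel_neg (eq u) w.
Proof.
have [l1 [l2 [l_mon [l1a l1P _]]]] := separating_forms.
have u_mon : monomials v 1 p u.
  rewrite -[u](subrK (Psi (- h.+1%:Z) v)); apply: monomialsD.
    by apply: monomials_mono (sing_vec_lead h v V0).
  by apply: (monomials_Psi _ (monomials_hw v 0)) => //; lia.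
have lu x : opspan abel_neg (eq u) x -> l1 x = 0 /\ exists d, monomials v 1 d x.
  elim=> {x} [_ <-||x y _ [x0 [d mx]] _ [y0 [d' my]]|a x _ [x0 [d mx]]|b x b_neg _ [x0 [d mx]]].
  - split; last by exists p.
    rewrite -[u](subrK (Psi (- h.+1%:Z) v)) linearD /= l1P addr0.
    by case: (l_mon _ _ (sing_vec_lead h v V0)).
  - by split; [rewrite linear0|exists 0%N; apply: monomials0].
  - split; first by rewrite linearD /= x0 y0 addr0.
    exists (maxn d d'); apply: monomialsD.
      by apply: monomials_mono mx; lia.
    by apply: monomials_mono my; lia.
  - by split; [rewrite linearZ /= x0 scaler0|exists d; apply: monomialsZ].
  have mb k : (k <= 2)%N -> monomials v k (d + depth b) (sh_act V b x).
    by move=> k2; apply: (monomials_act b_neg mx).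
  split; last by exists (d + depth b)%N; apply: mb.
  by case: (l_mon _ _ (mb 2%N _)).
case/lu => w0 _; have := l_mon _ _ (sub_vec_lead h v V0).
case; rewrite linearB linearZ /= l1a w0 sub0r scaleNr opprK => /eqP.
by rewrite scaler_eq0 oner_eq0 orbF invr_eq0 mulf_eq0 (negPf cLa_neq0) pnatr_eq0.
Qed.

(** Being inert, [w] could only lie in the submodule generated by [u] if it were a
    polynomial multiple of [u]. *)
Lemma w_notin_Nu : ~ Nu w.
Proof.
have [al_w Psi_w _] := w_inert.
have B_in x : eq u x -> inert ha x by move=> <-.
have Z_sub : subspace (eq (0 : V)).
  by split=> [|x y <- <-|a x <-]; rewrite ?addr0 ?scaler0.
have Z_act b (x : V) : eq 0 x -> eq 0 (sh_act V b x) by move=> <-; rewrite act0.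
have Z_pos b : abel_pos b -> eq 0 (sh_act V b w).
  by case: b => //= n n_pos; rewrite ?al_w ?Psi_w.
move=> Nw; have [y [z [Jy <- w_y]]] := induced_singular B_in Z_sub Z_act Nw Z_pos.
by apply: w_notin_u; rewrite w_y addr0.
Qed.

Lemma w_subsingular : subsingular w.
Proof.
have [al_w Psi_w _] := w_inert; have [N0 ND NZ Nact] := Nu_submodule.
split.
  case=> _ /(_ (shG h%:Z) isT) Gw; apply: u_neq0.
  by rewrite u_of_w Gw scaler0.
exists Nu; first exact: Nu_submodule.
split; first exact: w_notin_Nu.
have NG (j : nat) : Nu (G j%:Z w) by apply: opspan_base; apply: G_w.
case=> //= n n_pos; last 1 first.
- by rewrite Psi_w.
- rewrite L_of_G; last by lia.
  have -> : n - 1 = `|n|.-1%:Z by lia.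
  by apply: NZ; apply: ND; apply: Nact; [apply: (NG 0%N)|apply: NG].
- by rewrite al_w.
by have -> : n = `|n|%N%:Z by [lia].
Qed.

(** ** Maximality *)

Let Nw : set V := generated w.

Lemma Nw_submodule : submodule Nw.
Proof.
split=> [N [[N0 _ _ _] _]|x y Nx Ny N sN|a x Nx N sN|b x Nx N sN] //.
- by case: (sN.1) => _ ND _ _; apply: ND; [apply: Nx|apply: Ny].
- by case: (sN.1) => _ _ NZ _; apply: NZ; apply: Nx.
by case: (sN.1) => _ _ _ Nact; apply: Nact; apply: Nx.
Qed.

Lemma Nw_w : Nw w. Proof. by move=> N [_]; apply. Qed.

Lemma Nw_u : Nw u.
Proof.
have [_ _ NZ Nact] := Nw_submodule; rewrite u_of_w.
by apply: NZ; apply: Nact; apply: Nw_w.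
Qed.

(** As [G(s) w] is a multiple of [u] for [s > 0], the submodule generated by [w] is
    spanned by negative modes applied to [w] and [u]. *)
Lemma Nw_pos x : Nw x -> homog_pos v x.
Proof.
pose B x := x = w \/ x = u.
have sB : submodule (opspan ns_neg (opspan abel_neg B)).
  apply: induced_submodule => [_ [->|->]|j _ [->|->]|_ [->|->]] //.
  - apply: opspan_sub (G_w j) => [|y <-|b y b_neg]; first exact: opspan_subspace.
      by apply: opspan_base; right.
    exact: opspan_act.
  - by rewrite G_u; apply: opspan0.
  - by exists (2 * p)%N%:Z; apply: homog_sub.
  by exists p%:Z; apply: homog_sing.
move=> Nx; have : opspan ns_neg (opspan abel_neg B) x.
  by apply: Nx; split=> // _ ->; do 2 apply: opspan_base; left.
have pos_sub := opspan_subspace pred0 (fun y => exists2 d : int, 0 < d & homog v d y).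
apply: opspan_sub => [||b y b_neg]; first exact: pos_sub.
  move=> y; apply: opspan_sub => [||b z b_neg]; first exact: pos_sub.
    move=> _ [->|->]; apply: opspan_base.
      by exists (2 * p)%N%:Z; [lia|apply: homog_sub].
    by exists p%:Z; [lia|apply: homog_sing].
  by apply: (homog_pos_neg_act v_hw); case: b b_neg => //= n; lia.
by apply: (homog_pos_neg_act v_hw); case: b b_neg => //= n; lia.
Qed.

Lemma v_notin_Nw : ~ Nw v.
Proof. by move/Nw_pos; apply: (hw_notin_pos v_hw v_neq0). Qed.

(** By induction on the weight, [x] may be taken singular modulo [Nw]. Modulo
    [Nw] it is then a polynomial in the negative [alpha]s and [Psi]s by
    [abel_singular], and a multiple of [v] by [monomials_singular]; the multiple
    is zero as [v] is not in [N]. *)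
Lemma Nw_maximal (N : set V) : submodule N -> (Nw `<=` N)%classic -> ~ N v ->
  (N `<=` Nw)%classic.
Proof.
move=> sN NwN Nv x Nx; have [N0 ND NZ Nact] := sN.
have [Z0 ZD ZZ Zact] := Nw_submodule.
have sZ : subspace Nw by split.
have [d hx] := homog_le_exists v_hw v_gen x.
elim/ltn_ind: d x hx Nx => d IHd x hx Nx.
have Zpos b : wt2 b < 0 -> Nw (sh_act V b x).
  move=> b0; have hb := homog_le_stable v_hw b hx.
  have [d0|d0] := ltP (wt2 b + d%:Z) 0.
    by have [/(_ d0)-> _] := homog_le_low hb.
  apply: (IHd `|(wt2 b + d%:Z)%R|%N); [by lia| |exact: Nact].
  by apply: homog_le_mono hb; lia.
have B_in y : eq v y -> inert ha y by move=> <-.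
have Z_pos b : abel_pos b -> Nw (sh_act V b x).
  by move=> b_pos; apply: Zpos; case: b b_pos => //= n; lia.
have [y [z [Fy Zz x_yz]]] := induced_singular B_in sZ Zact (triangular x) Z_pos.
have [d' my] := opspan_monomials Fy.
have [c [y1 [my1 y_cy]]] := monomials_pos my.
have ZG (j : nat) : Nw (G j%:Z y1).
  have -> : G j%:Z y1 = G j%:Z x - G j%:Z z.
    by rewrite x_yz y_cy !actD actZ G_v scaler0 add0r addrK.
  apply: (subspaceB (P := Nw)) => //; last exact: Zact.
  by apply: Zpos => /=; lia.
have Zy1 : Nw y1.
  apply: (monomials_singular V0 v_inert G_v sZ Zact _ _ cLa_neq0 _ my1 ZG) => //.
    pose k := p%:R * cLa; have nz_k : k != 0 by rewrite mulf_neq0 // pnatr_eq0.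
    exists (al (- p%:Z) v + k *: w).
      have := monomialsZ k (sub_vec_lead h v V0); congr (monomials _ _ _ _).
      by rewrite -/k; lin_coefs K V; field.
    by rewrite opprD addNKr -scaleNr; apply: ZZ; apply: Nw_w.
  exists (Psi (- h.+1%:Z) v - u).
    have := monomialsZ (-1) (sing_vec_lead h v V0); congr (monomials _ _ _ _).
    by lin_coefs K V; ring.
  by rewrite opprB addrCA subrr addr0; apply: Nw_u.
have Ncv : N (c *: v).
  have -> : c *: v = x - (y1 + z) by rewrite x_yz y_cy; lin_coefs K V; ring.
  by apply: (subspaceB (P := N)) => //; apply: NwN; apply: ZD.
have [c0|nz_c] := eqVneq c 0.
  by rewrite x_yz y_cy c0 scale0r add0r; apply: ZD.
case: Nv; rewrite -[v](scalerK nz_c); exact: NZ.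
Qed.

Lemma submodule_proper (N : set V) : submodule N -> N != setT -> ~ N v.
Proof.
move=> sN /eqP N_proper Nv; apply: N_proper; apply/seteqP; split=> // x _.
have : generated v x by rewrite v_gen.
by apply; split=> // _ ->.
Qed.

Lemma proper_homog_pos (N : set V) : submodule N -> N != setT -> forall x, N x ->
  homog_pos v x.
Proof.
move=> sN N_proper x Nx; have [c [y [hy x_cy]]] := homog_pos_decomp v_hw v_gen x.
have [_ _ NZ _] := sN.
have [c0|nz_c] := eqVneq c 0; first by rewrite x_cy c0 scale0r add0r.
case: (submodule_proper sN N_proper); rewrite -[v](scalerK nz_c); apply: NZ.
by apply: (submodule_lowest v_hw sN hy); rewrite -x_cy.
Qed.

Lemma Nw_unique_maximal : unique (@maximal_submodule K V) Nw.
Proof.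
have Nw_proper : Nw != setT.
  by apply/eqP => NwT; apply: v_notin_Nw; rewrite NwT.
split.
  split=> //; first exact: Nw_submodule.
  move=> N sN N_proper NwN; apply/seteqP; split=> //.
  by apply: Nw_maximal => //; apply: submodule_proper.
move=> N [sN N_proper N_max].
have [N0 ND NZ Nact] := sN; have [Z0 ZD ZZ Zact] := Nw_submodule.
pose N' : set V := [set x | exists y z, [/\ N y, Nw z & x = y + z]]%classic.
have sN' : submodule N'.
  split=> [|x x' [y [z [Ny Zz ->]]] [y' [z' [Ny' Zz' ->]]]|a x [y [z [Ny Zz ->]]]
    |b x [y [z [Ny Zz ->]]]].
  - by exists 0, 0; rewrite addr0.
  - exists (y + y'), (z + z'); split; [exact: ND|exact: ZD|by rewrite addrACA].
  - by exists (a *: y), (a *: z); split; [exact: NZ|exact: ZZ|rewrite scalerDr].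
  by exists (sh_act V b y), (sh_act V b z); split; [exact: Nact|exact: Zact|rewrite actD].
have N'_proper : N' != setT.
  apply/eqP => N'T; have : N' v by rewrite N'T.
  case=> y [z [Ny Zz v_yz]]; apply: (hw_notin_pos v_hw v_neq0).
  have : homog_pos v (y + z).
    by apply: opspanD; [exact: (proper_homog_pos sN N_proper Ny)|exact: Nw_pos].
  by rewrite -v_yz.
have NN' : (N `<=` N')%classic by move=> y Ny; exists y, 0; rewrite addr0.
have e_N' := N_max _ sN' N'_proper NN'.
have NwN : (Nw `<=` N)%classic.
  by rewrite -e_N' => z Zz; exists 0, z; rewrite add0r.
apply/seteqP; split=> //; apply: Nw_maximal => //.
exact: submodule_proper.
Qed.

End MaximalSubmodule.

Theorem theorem7p2 (R : realType) (cL cLa : R[i]) (hcLa : cLa != 0)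
    (p : nat) (hp0 : (0 < p)%N) (hp : odd p) (r : R[i])
    (V : shModule R[i]) (v : V) (hV : verma_pr cL cLa p%:R r v) :
  subsingular (w_pr cLa p v) /\
  unique (@maximal_submodule R[i] V) (generated (w_pr cLa p v)).
Proof.
have e_p : p = p./2.*2.+1 by rewrite -[LHS]odd_double_half hp.
rewrite e_p in hV *.
have [v_hw _ _] := hV; have [_ pos _ al0] := v_hw.
have v_inert : inert ((1 + p./2.*2.+1%:R) * cLa) v by split=> // n n0; apply: pos.
rewrite (w_prE hcLa (hw_level_zero v_hw) v_inert).
split; [exact: w_subsingular hV|exact: Nw_unique_maximal hV].
Qed.
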